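(* Let $\mathbf{F}/\mathbb{F}_q$ be a hyperelliptic algebraic function field of genus $g>2$ with full constant field $\mathbb{F}_q$, and $L$-polynomial $L(t)=\sum_{i=0}^{2g}a_it^i$. Then for every integer $k$ with $1\leq k\leq g$, $$h_{g-k,0}=\sum_{i=g-k+1}^{g}a_i+\sum_{i=g-k}^{g-1}q^{g-i}a_i+(q^k-1)\sum_{i=0}^{g-k-1}q^{g-i-k}a_i,$$ where an empty sum is zero.
   Context: All divisors are rational; $\dim(D)$ is the $\mathbb{F}_q$-dimension of $\mathcal{L}(D)=\{x\in\mathbf{F}:(x)\geq -D\}\cup\{0\}$. $L(t)$ is the numerator of the zeta function $Z(t)=\sum_{m\geq0}A_mt^m=L(t)/((1-t)(1-qt))$, $A_m$ being the number of effective divisors of degree $m$. $h_{n,0}$ is the number of linear equivalence classes of divisors of degree $n$ of dimension zero. *)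

(* Defs.v *)
(* with classical choice (Stdlib ClassicalEpsilon) used only
   to turn uniquely-determined numbers (dimensions, degrees, cardinalities)
   into functions. *)
From HB Require Import structures.
From mathcomp Require Import all_boot all_order all_algebra.
From Stdlib Require Import ClassicalEpsilon.
From Stdlib Require List.
Set Implicit Arguments. Unset Strict Implicit. Unset Printing Implicit Defensive.
Import Order.TTheory GRing.Theory Num.Theory.
Local Open Scope ring_scope.

(* [the x0 P] : some x with P x if one exists, else x0.  Used only when the
   witness is unique. *)
Definition the {T : Type} (x0 : T) (P : T -> Prop) : T :=
  match excluded_middle_informative (exists x, P x) with
  | left H => proj1_sig (constructive_indefinite_description P H)
  | right _ => x0
  end.

Definition has_card {T : Type} (P : T -> Prop) (n : nat) : Prop :=
  exists s : list T, List.NoDup s /\ (forall x, P x <-> List.In x s) /\ length s = n.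

(* number of elements of P (0 if P is infinite). *)
Definition cardP {T : Type} (P : T -> Prop) : nat := the 0%N (has_card P).

Section FunctionField.
Variables (F : fieldType) (K : {pred F}).

Definition is_Fq_subfield (q : nat) : Prop :=
  GRing.divring_closed K /\
  exists s : seq F, uniq s /\ (forall x, (x \in K) <-> (x \in s)) /\ size s = q.

Definition algebraic_over (z : F) : Prop :=
  exists p : {poly F}, [/\ p \is a polyOver K, p != 0 & root p z].

Definition full_constant_field : Prop :=
  forall z : F, algebraic_over z -> z \in K.

Definition in_Kx (x f : F) : Prop :=
  exists p r : {poly F},
    [/\ p \is a polyOver K, r \is a polyOver K, r.[x] != 0 & f * r.[x] = p.[x]].

Definition Kx_basis (x : F) (b : seq F) : Prop :=
  (forall f : F, exists c : seq F,
      size c = size b /\ (forall i, in_Kx x c`_i) /\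
      f = \sum_(i < size b) c`_i * b`_i) /\
  (forall c : seq F, size c = size b -> (forall i, in_Kx x c`_i) ->
      \sum_(i < size b) c`_i * b`_i = 0 -> forall i, c`_i = 0).

Definition function_field : Prop :=
  exists x : F, ~ algebraic_over x /\ exists b : seq F, Kx_basis x b.

(* v : F -> int, with the convention v 0 = 0 standing for v 0 = +oo
   (the axioms only constrain v on nonzero elements). *)
Definition is_valuation (v : F -> int) : Prop :=
  [/\ v 0 = 0,
      forall x y, x != 0 -> y != 0 -> v (x * y) = v x + v y,
      forall x y, x != 0 -> y != 0 -> x + y != 0 ->
                  Num.min (v x) (v y) <= v (x + y),
      exists z, z != 0 /\ v z = 1
    & forall a, a \in K -> a != 0 -> v a = 0].

Definition place := {v : F -> int | is_valuation v}.

Definition vP (P : place) : F -> int := proj1_sig P.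

Definition in_OP (P : place) (x : F) : Prop := x = 0 \/ 0 <= vP P x.
Definition in_mP (P : place) (x : F) : Prop := x = 0 \/ 0 < vP P x.

Definition residue_basis (P : place) (b : seq F) : Prop :=
  (forall i, (i < size b)%N -> in_OP P b`_i) /\
  (forall c : seq F, size c = size b -> (forall i, c`_i \in K) ->
      in_mP P (\sum_(i < size b) c`_i * b`_i) -> forall i, c`_i = 0) /\
  (forall z, in_OP P z -> exists c : seq F,
      size c = size b /\ (forall i, c`_i \in K) /\
      in_mP P (z - \sum_(i < size b) c`_i * b`_i)).

Definition pdeg (P : place) : nat :=
  the 0%N (fun n => exists b, size b = n /\ residue_basis P b).

Definition divisor := place -> int.

Definition has_degree (D : divisor) (d : int) : Prop :=
  exists s : seq place, List.NoDup s /\ (forall P, D P != 0 -> List.In P s) /\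
    d = \sum_(P <- s) D P * (pdeg P)%:Z.

Definition is_divisor (D : divisor) : Prop := exists d, has_degree D d.

Definition ddeg (D : divisor) : int := the 0 (has_degree D).

Definition effective (D : divisor) : Prop := forall P, 0 <= D P.

Definition in_LD (D : divisor) (x : F) : Prop :=
  x = 0 \/ forall P, - D P <= vP P x.

Definition LD_basis (D : divisor) (b : seq F) : Prop :=
  (forall i, (i < size b)%N -> in_LD D b`_i) /\
  (forall c : seq F, size c = size b -> (forall i, c`_i \in K) ->
      \sum_(i < size b) c`_i * b`_i = 0 -> forall i, c`_i = 0) /\
  (forall z, in_LD D z -> exists c : seq F,
      size c = size b /\ (forall i, c`_i \in K) /\
      z = \sum_(i < size b) c`_i * b`_i).

Definition ddim (D : divisor) : nat :=
  the 0%N (fun n => exists b, size b = n /\ LD_basis D b).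

Definition lin_equiv (D1 D2 : divisor) : Prop :=
  exists x : F, x != 0 /\ forall P, D1 P = D2 P + vP P x.

(* ---------- genus (Stichtenoth Def. 1.4.15) ---------- *)
Definition is_genus (g : nat) : Prop :=
  (forall D, is_divisor D -> ddeg D - (ddim D)%:Z + 1 <= g%:Z) /\
  (exists D, is_divisor D /\ ddeg D - (ddim D)%:Z + 1 = g%:Z).

Definition hyperelliptic (g : nat) : Prop :=
  (2 <= g)%N /\ exists x b, size b = 2%N /\ Kx_basis x b.

Definition A_eff (m : nat) : nat :=
  cardP (fun D : divisor => effective D /\ has_degree D m%:Z).

(* coefficients of L(t) = (1 - t)(1 - q t) Z(t), Z(t) = sum A_m t^m *)
Definition Lcoef (q i : nat) : int :=
  (A_eff i)%:Z
  - (if i is i'.+1 then ((q.+1) * A_eff i')%N%:Z else 0)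
  + (if i is i''.+2 then (q * A_eff i'')%N%:Z else 0).

Definition class_reps (n : nat) (reps : seq divisor) : Prop :=
  (forall i, (i < size reps)%N ->
      has_degree (nth (fun _ => 0) reps i) n%:Z /\
      ddim (nth (fun _ => 0) reps i) = 0%N) /\
  (forall i j, (i < size reps)%N -> (j < size reps)%N ->
      lin_equiv (nth (fun _ => 0) reps i) (nth (fun _ => 0) reps j) -> i = j) /\
  (forall D, has_degree D n%:Z -> ddim D = 0%N ->
      exists2 i, (i < size reps)%N & lin_equiv D (nth (fun _ => 0) reps i)).

Definition h0 (n : nat) : nat :=
  the 0%N (fun N => exists reps, size reps = N /\ class_reps n reps).

End FunctionField.

(* Main.v *)
(* Write A_n for the number of effective divisors of degree n, G for the pole
   divisor of x (where [F : K(x)] = 2), and B_n = A_n - q A_(n-2).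

   For D effective of degree at most g, L(D) lies in K(x): an element z outside
   K(x) would put all p(x) + r(x) z in some L(MG + D), which is too large for
   genus g. Hence L(D) = L(D - G) + K x^J for the largest J with x^J in L(D),
   so |L(D)| = q |L(D - G)|. Summing |L(D)| - 1 over the classes of degree
   n <= g, B_n is the number of classes of degree n and positive dimension.
   For n = g these are all classes, and every degree has equally many classes,
   so h_(n,0) = B_g - B_n, which is a rearrangement of the claim.

   That every degree has equally many classes is F. K. Schmidt's theorem. If all
   places had even degree, each would split in F' = F K', where K' is the
   quadratic extension of K; the effective divisors of F' are the pairs of
   effective divisors of F, and there are about m q^(2m) pairs of total degree
   2m, whereas F' has finitely many classes of degree 0 and hence only
   O(q^(2m)) effective divisors of that degree.

   The basic theory of divisors is obtained by counting, since K is finite. The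
   genus hypothesis replaces the existence theorem for places: if some L(D) were
   infinite its dimension would be 0 by convention, against Riemann's
   inequality. *)

Require Import Defs.
From HB Require Import structures.
From mathcomp Require Import all_boot all_order all_algebra all_solvable all_field.
From mathcomp Require Import boolp zify ring.
From Stdlib Require Import ClassicalEpsilon.
From Stdlib Require List.
Import Order.TTheory GRing.Theory Num.Theory.
Local Open Scope ring_scope.
Set Implicit Arguments. Unset Strict Implicit. Unset Printing Implicit Defensive.

Local Ltac ilia := intros; lia.
Local Ltac inia := intros; nia.

(** Dimensions are handled as cardinalities, |L(D)| = q^dim(D), so that exact sequences become
    counts of fibres. The obstacle is that [F : K(u)] is not known to be finite for a general u.
    Elements are measured instead by the degrees in x of their coordinates: too many independent
    expressions in u would outnumber the elements of bounded height. This bounds both residue fields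
    and pole divisors.

    In Schmidt's theorem, K' is given by X^2 - X + nu because this form works in every
    characteristic: its discriminant 1 - 4 nu is a nonzero constant, so a root in a residue field
    lifts by Newton's iteration. The sequence of iterates stands for a root in the completion, and
    the valuations of F' are eventual values along it.

    The final rearrangement rests on B_n = sum_(i <= n) a_i + sum_(i < n) q^(n-i) a_i, read off from
    L(t) = (1 - t)(1 - q t) Z(t). *)

Lemma theP (T : Type) (x0 : T) (P : T -> Prop) y :
  P y -> (forall z, P z -> z = y) -> the x0 P = y.
Proof.
move=> Py uniqP; rewrite /the; case: excluded_middle_informative => [ex|[]].
  by apply: uniqP; apply: proj2_sig.
by exists y.
Qed.

Lemma InP (T : eqType) (x : T) (s : seq T) : List.In x s <-> x \in s.
Proof.
elim: s => [|y s IHs] //=; rewrite inE; split.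
  by case=> [->|/IHs ->]; rewrite ?eqxx ?orbT.
by case/orP=> [/eqP->|/IHs]; [left | right].
Qed.

Lemma NoDupP (T : eqType) (s : seq T) : List.NoDup s <-> uniq s.
Proof.
elim: s => [|y s IHs] /=; first by split=> // _; constructor.
split=> [nd|/andP[ys us]].
  by inversion nd; subst; apply/andP; split; [apply/negP => /InP | apply/IHs].
by constructor; [move/InP; apply/negP | apply/IHs].
Qed.

(** * Finite cardinalities *)

(** [{classic T}] carries a decidable equality from excluded middle, so that lists of places or
    divisors, which are functions, can be filtered and compared. *)
Definition finp {T : Type} (P : T -> Prop) : Prop :=
  exists s : seq {classic T}, uniq s /\ forall x : {classic T}, P x <-> x \in s.

Section Finite.
Implicit Types T U : Type.

Lemma has_cardE T (P : T -> Prop) (s : seq {classic T}) :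
  uniq s -> (forall x : {classic T}, P x <-> x \in s) -> has_card P (size s).
Proof.
move=> us sP; exists s; split; first exact/(@NoDupP {classic T}).
by split=> // x; split=> [/sP/(@InP {classic T})|/(@InP {classic T})/sP].
Qed.

Lemma has_card_fun T (P : T -> Prop) n m : has_card P n -> has_card P m -> n = m.
Proof.
case=> s [/(@NoDupP {classic T}) us [sP <-]] [t [/(@NoDupP {classic T}) ut [tP <-]]].
apply: (@perm_size {classic T}); apply: uniq_perm => // x.
by apply/idP/idP=> /(@InP {classic T}) => [/sP/tP|/tP/sP] /(@InP {classic T}).
Qed.

Lemma cardPE T (P : T -> Prop) (s : seq {classic T}) :
  uniq s -> (forall x : {classic T}, P x <-> x \in s) -> cardP P = size s.
Proof.
move=> us sP; apply: theP; first exact: has_cardE.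
by move=> m /has_card_fun; apply; apply: has_cardE.
Qed.

Lemma eq_cardP T (P Q : T -> Prop) : (forall x, P x <-> Q x) -> cardP P = cardP Q.
Proof. by move=> PQ; congr cardP; apply: funext => x; apply: propext. Qed.

Lemma finp_seq (T : eqType) (s : seq T) : finp (fun x => x \in s).
Proof.
exists (undup (s : seq {classic T})); split; first exact: undup_uniq.
move=> x; rewrite mem_undup; split=> /InP xs; last exact/InP.
by apply/(@InP {classic T}).
Qed.

Lemma card_seq (T : eqType) (s : seq T) : uniq s -> cardP (fun x => x \in s) = size s.
Proof.
move=> us; apply: (@cardPE T _ s); first by apply/(@NoDupP {classic T}); apply/(@NoDupP T).
move=> x; split=> [xs|/(@InP {classic T}) xs]; last exact/(@InP T).
by apply/(@InP {classic T}); apply/(@InP T).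
Qed.

Lemma finp_sub T (P Q : T -> Prop) : (forall x, P x -> Q x) -> finp Q -> finp P.
Proof.
move=> PQ [s [us sQ]]; exists [seq x <- s | `[< P x >]]; split; first exact: filter_uniq.
move=> x; rewrite mem_filter; split=> [Px|/andP[/asboolP //]].
by rewrite asboolT //=; apply/sQ/PQ.
Qed.

Lemma leq_card_in T U (P : T -> Prop) (Q : U -> Prop) (f : T -> U) :
  (forall x, P x -> Q (f x)) -> (forall x y, P x -> P y -> f x = f y -> x = y) ->
  finp P -> finp Q -> (cardP P <= cardP Q)%N.
Proof.
move=> PQ injf [s [us sP]] [t [ut tQ]]; rewrite (cardPE us sP) (cardPE ut tQ).
rewrite -(size_map (f : {classic T} -> {classic U})); apply: uniq_leq_size.
  by rewrite map_inj_in_uniq // => x y /sP Px /sP Py; apply: injf.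
by move=> _ /mapP[x /sP Px ->]; apply/tQ/PQ.
Qed.

Lemma leq_card T (P Q : T -> Prop) :
  (forall x, P x -> Q x) -> finp Q -> (cardP P <= cardP Q)%N.
Proof. by move=> PQ fQ; apply: (@leq_card_in _ _ _ _ id) => //; apply: finp_sub fQ. Qed.

Lemma finp_image T U (P : T -> Prop) (Q : U -> Prop) (f : T -> U) :
  (forall y, Q y -> exists2 x, P x & f x = y) -> finp P -> finp Q.
Proof.
move=> surj [s [us sP]].
apply: (@finp_sub _ _ (fun y : {classic U} => y \in map (f : {classic T} -> {classic U}) s)).
  by move=> y /surj[x Px <-]; apply/mapP; exists x => //; apply/sP.
exact: finp_seq.
Qed.

Lemma leq_card_image T U (P : T -> Prop) (Q : U -> Prop) (f : T -> U) :
  (forall y, Q y -> exists2 x, P x & f x = y) -> finp P -> (cardP Q <= cardP P)%N.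
Proof.
move=> surj fP; have fQ := finp_image surj fP.
have [[x0 _]|nT] := pselect (exists x : T, True); last first.
  have nQ y : Q y -> False by case/surj=> x; case: nT; exists x.
  by rewrite (@cardPE _ Q [::]) // => y; split=> // /nQ.
have gP y : exists x, Q y -> P x /\ f x = y.
  by have [/surj[x Px <-]|nQ] := pselect (Q y); [exists x | exists x0].
have [g {}gP] := boolp.choice gP.
apply: (leq_card_in (f := g)) => // [y /gP[] //|x y Qx Qy e].
by rewrite -(gP x Qx).2 e (gP y Qy).2.
Qed.

Lemma finp_inj T U (P : T -> Prop) (Q : U -> Prop) (f : T -> U) :
  (forall x, P x -> Q (f x)) -> (forall x y, P x -> P y -> f x = f y -> x = y) ->
  finp Q -> finp P.
Proof.
move=> PQ injf fQ; have [[x0 Px0]|nP] := pselect (exists x, P x); last first.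
  by exists [::]; split=> // x; split=> // Px; case: nP; exists x.
have gP y : exists x, (exists2 z, P z & f z = y) -> P x /\ f x = y.
  by have [[z Pz <-]|n] := pselect (exists2 z, P z & f z = y); [exists z | exists x0].
have [g {}gP] := boolp.choice gP.
apply: (finp_image (f := g)) fQ => x Px; exists (f x); first exact: PQ.
have [Pg fg] := gP (f x) (ex_intro2 _ _ x Px erefl).
exact: injf.
Qed.

Lemma card_bij T U (P : T -> Prop) (Q : U -> Prop) (f : T -> U) :
  (forall x, P x -> Q (f x)) -> (forall x y, P x -> P y -> f x = f y -> x = y) ->
  (forall y, Q y -> exists2 x, P x & f x = y) -> finp P -> cardP P = cardP Q.
Proof.
move=> PQ injf surj fP; apply/eqP; rewrite eqn_leq (leq_card_in PQ injf fP) /=.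
  exact: leq_card_image surj fP.
exact: finp_image surj fP.
Qed.

Lemma card_gt0 T (P : T -> Prop) x : finp P -> P x -> (0 < cardP P)%N.
Proof. by case=> s [us sP] Px; rewrite (cardPE us sP); case: s {us} sP => // /(_ x)[/(_ Px)]. Qed.

Lemma card_gt1_ex T (P : T -> Prop) x : finp P -> (1 < cardP P)%N -> exists2 y, P y & y <> x.
Proof.
case=> s [us sP]; rewrite (cardPE us sP); case: s us sP => [//|a [//|b s]] /= /andP[ab _] sP _.
move: ab; rewrite inE negb_or => /andP[/eqP ab _].
have [<-|nax] := pselect (a = x); first by exists b => [|e]; [apply/sP; rewrite !inE eqxx orbT | case: ab].
by exists a => //; apply/sP; rewrite !inE eqxx.
Qed.

Lemma card1P T (P : T -> Prop) x : finp P -> P x -> (cardP P = 1)%N <-> (forall y, P y -> y = x).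
Proof.
move=> fP Px; split=> [P1 y Py|Px1].
  case: fP P1 => s [us sP]; rewrite (cardPE us sP); case: s {us} sP => [//|a [|//]] sP _.
  by move: Px Py => /sP + /sP; rewrite !inE => /eqP-> /eqP.
apply: (@cardPE _ P [:: x]) => // y; rewrite inE; split=> [/Px1->|/eqP-> //].
by rewrite eqxx.
Qed.

Lemma finp_prod T U (P : T -> Prop) (Q : U -> Prop) :
  finp P -> finp Q -> finp (fun z : T * U => P z.1 /\ Q z.2) /\
  cardP (fun z : T * U => P z.1 /\ Q z.2) = (cardP P * cardP Q)%N.
Proof.
case=> s [us sP] [t [ut tQ]].
pose st : seq {classic (T * U)} := [seq ((x, y) : {classic (T * U)}) | x <- s, y <- t].
have ust : uniq st.
  by apply: (@allpairs_uniq {classic T} {classic U} {classic (T * U)} pair) => // -[x y] [x' y'] _ _ [-> ->].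
have stP (z : {classic (T * U)}) : P z.1 /\ Q z.2 <-> z \in st.
  split=> [[/sP sx /tQ ty]|].
    by rewrite [z]surjective_pairing; apply: (@allpairs_f {classic T} {classic U} {classic (T * U)}).
  by case/(@allpairsP {classic T} {classic U} {classic (T * U)}) => -[x y] [/sP Px /tQ Qy ->].
by split; [exists st | rewrite (cardPE ust stP) size_allpairs (cardPE us sP) (cardPE ut tQ)].
Qed.

Lemma card_fibers T U (P : T -> Prop) (f : T -> U) (s : seq {classic U}) :
  finp P -> uniq s -> (forall x, P x -> (f x : {classic U}) \in s) ->
  cardP P = (\sum_(y <- s) cardP (fun x => P x /\ f x = y))%N.
Proof.
case=> t [ut tP] us fs; rewrite (cardPE ut tP).
transitivity (\sum_(y <- s) \sum_(x <- t | (f x : {classic U}) == y) 1)%N.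
  rewrite (exchange_big_dep predT) //= -sum1_size big_seq [RHS]big_seq.
  apply: eq_bigr => x /tP /fs fxs; rewrite sum1_count -[LHS]/(true : nat) -fxs -(count_uniq_mem _ us).
  by apply: eq_count => y /=; rewrite eq_sym.
apply: eq_bigr => y _; rewrite sum1_count -size_filter.
rewrite (@cardPE _ _ [seq x <- t | (f x : {classic U}) == y]) ?filter_uniq // => x.
rewrite mem_filter; split=> [[/tP -> ->]|/andP[/eqP fxy /tP]] //; by rewrite eqxx.
Qed.

Lemma card_fiber_leq T U (P : T -> Prop) (Q : U -> Prop) (f : T -> U) c :
  finp Q -> (forall x, P x -> Q (f x)) ->
  (forall y, Q y -> finp (fun x => P x /\ f x = y) /\
    (cardP (fun x => P x /\ f x = y) <= c)%N) ->
  finp P /\ (cardP P <= cardP Q * c)%N.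
Proof.
case=> s [us sQ] PQ fib.
have fP : finp P.
  have tP0 y : exists t : seq {classic T},
      Q y -> forall x : {classic T}, P x /\ f x = y <-> x \in t.
    by have [/fib[[t [_ tP]] _]|nQ] := pselect (Q y); [exists t | exists [::]].
  have [t tP] := boolp.choice tP0.
  apply: (@finp_sub _ _ (fun x : {classic T} => x \in flatten (map (t : {classic U} -> seq {classic T}) s))).
    move=> x Px; apply/flattenP; exists (t (f x)); last by apply/(tP (f x)); [apply: PQ|].
    by apply: (@map_f {classic U}); apply/sQ/PQ.
  exact: finp_seq.
split=> //; rewrite (card_fibers (f := f) fP us) => [|x /PQ /sQ //].
rewrite (cardPE us sQ) -sum1_size big_distrl /= big_seq [X in (_ <= X)%N]big_seq.
by apply: leq_sum => y /sQ /fib[]; rewrite mul1n.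
Qed.

Lemma card_fiber_eq T U (P : T -> Prop) (Q : U -> Prop) (f : T -> U) c :
  finp P -> finp Q -> (forall x, P x -> Q (f x)) ->
  (forall y, Q y -> cardP (fun x => P x /\ f x = y) = c) ->
  cardP P = (cardP Q * c)%N.
Proof.
move=> fP [s [us sQ]] PQ fib; rewrite (card_fibers (f := f) fP us) => [|x /PQ /sQ //].
rewrite (cardPE us sQ) -sum1_size big_distrl /= big_seq [RHS]big_seq.
by apply: eq_bigr => y /sQ /fib; rewrite mul1n.
Qed.

End Finite.

(** The bound |V| <= |V/W| |W| with [r] in the role of the quotient map: translation by one point of
    a fibre embeds that fibre in [W]. *)
Lemma card_quotient_leq (F : zmodType) (U : Type) (V W : F -> Prop) (Q : U -> Prop)
    (r : F -> U) :
  finp Q -> finp W -> (forall x, V x -> Q (r x)) ->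
  (forall x y, V x -> V y -> r x = r y -> W (x - y)) ->
  finp V /\ (cardP V <= cardP Q * cardP W)%N.
Proof.
move=> fQ fW VQ rW; apply: (card_fiber_leq (f := r)) => // y Qy.
have [[x0 [Vx0 rx0]]|n] := pselect (exists x, V x /\ r x = y); last first.
  have e0 x : ~ (V x /\ r x = y) by move=> H; case: n; exists x.
  have f0 : finp (fun x => V x /\ r x = y) by exists [::]; split=> // x; split=> // /e0.
  split=> //; apply: leq_card => // x /e0[].
have im x : V x /\ r x = y -> W (x - x0) by case=> Vx rx; apply: rW; rewrite ?rx ?rx0.
have inj x z : V x /\ r x = y -> V z /\ r z = y -> x - x0 = z - x0 -> x = z.
  by move=> _ _ /addIr.
have fib := finp_inj im inj fW.
by split=> //; apply: (leq_card_in im inj).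
Qed.

(** * Valuations and degrees *)

Section Valuation.
Variables (F : fieldType) (w : F -> int).
Hypothesis wM : forall x y : F, x != 0 -> y != 0 -> w (x * y) = w x + w y.
Hypothesis wD : forall x y : F, x != 0 -> y != 0 -> x + y != 0 -> Num.min (w x) (w y) <= w (x + y).
Implicit Types (x y : F) (m n : int).

(** Restores the value +oo at 0: under the convention that a valuation is 0 at 0, the plain
    inequality would not be stable under sums. *)
Definition vge (m : int) (x : F) : Prop := x = 0 \/ m <= w x.

Lemma val1 : w 1 = 0.
Proof. have e : w 1 = w 1 + w 1 by rewrite -{1}[1]mulr1 wM ?oner_neq0.
lia. Qed.

Lemma valX x (n : nat) : x != 0 -> w (x ^+ n) = n%:Z * w x.
Proof.
move=> x0; elim: n => [|n IHn]; first by rewrite expr0 val1 mul0r.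
by rewrite exprS wM ?expf_neq0 // IHn; ilia.
Qed.

Lemma valV x : x != 0 -> w x^-1 = - w x.
Proof. by move=> x0; apply/eqP; rewrite -addr_eq0 -wM ?invr_neq0 // mulVf // val1. Qed.

Lemma val_exprz x n : x != 0 -> w (x ^ n) = n * w x.
Proof.
move=> x0; case: n => n; first by rewrite -exprnP valX.
by rewrite NegzE -exprnN valV ?expf_neq0 // valX //; ilia.
Qed.

Lemma valN x : w (- x) = w x.
Proof.
have [->|x0] := eqVneq x 0; first by rewrite oppr0.
have n1 : (-1 : F) != 0 by rewrite oppr_eq0 oner_neq0.
have e1 : w (-1) + w (-1) = 0 by rewrite -wM // mulrNN mulr1 val1.
have e2 : w (- x) = w (-1) + w x by rewrite -wM // mulN1r.
lia.
Qed.

Lemma vge0 m : vge m 0. Proof. by left. Qed.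

Lemma vgeE m x : x != 0 -> vge m x <-> m <= w x.
Proof. by move=> x0; split=> [[e|//]|h]; [rewrite e eqxx in x0 | right]. Qed.

Lemma vge_le m n x : m <= n -> vge n x -> vge m x.
Proof. by move=> mn [->|nx]; [left | right; apply: le_trans nx]. Qed.

Lemma vgeN m x : vge m (- x) <-> vge m x.
Proof.
rewrite /vge valN; split=> -[/eqP|]; try by right.
  by rewrite oppr_eq0 => /eqP; left.
by move=> /eqP ->; left; rewrite oppr0.
Qed.

Lemma vgeD m x y : vge m x -> vge m y -> vge m (x + y).
Proof.
move=> [->|mx]; first by rewrite add0r.
move=> [->|my]; first by rewrite addr0; right.
have [->|x0] := eqVneq x 0; first by rewrite add0r; right.
have [->|y0] := eqVneq y 0; first by rewrite addr0; right.
have [->|xy0] := eqVneq (x + y) 0; first by left.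
by right; apply: le_trans (wD x0 y0 xy0); rewrite le_min mx.
Qed.

Lemma vgeB m x y : vge m x -> vge m y -> vge m (x - y).
Proof. by move=> mx my; apply: vgeD => //; apply/vgeN. Qed.

Lemma vgeM m n x y : vge m x -> vge n y -> vge (m + n) (x * y).
Proof.
move=> [->|mx]; first by rewrite mul0r; left.
move=> [->|ny]; first by rewrite mulr0; left.
have [->|x0] := eqVneq x 0; first by rewrite mul0r; left.
have [->|y0] := eqVneq y 0; first by rewrite mulr0; left.
by right; rewrite wM // lerD.
Qed.

Lemma vge_sum m (J : Type) (r : seq J) (P : pred J) (f : J -> F) :
  (forall j, P j -> vge m (f j)) -> vge m (\sum_(j <- r | P j) f j).
Proof.
move=> H; elim/big_rec: _ => [|j x Pj IH]; first exact: vge0.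
by apply: vgeD => //; apply: H.
Qed.

Lemma val_eq x m : x != 0 -> vge m x -> ~ vge (m + 1) x -> w x = m.
Proof. by move=> x0 /(vgeE _ x0) mx /(vgeE _ x0); ilia. Qed.

(** If [x + y] had larger valuation than [x], so would x = (x + y) - y. All arguments by a dominant
    term go through this lemma. *)
Lemma val_add_dom x y : x != 0 -> vge (w x + 1) y -> x + y != 0 /\ w (x + y) = w x.
Proof.
move=> x0 xy.
have nx : ~ vge (w x + 1) x by move/(vgeE _ x0); ilia.
have n2 : ~ vge (w x + 1) (x + y).
  by move=> H; apply: nx; have := vgeB H xy; rewrite addrK.
have xy0 : x + y != 0 by apply/eqP => e; apply: n2; left.
split=> //; apply: val_eq => //; apply: vgeD; first by right.
by apply: vge_le xy; ilia.
Qed.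

Lemma vgeX x (n : nat) : vge 0 x -> vge 0 (x ^+ n).
Proof.
move=> x0; elim: n => [|n IHn]; first by right; rewrite expr0 val1.
by rewrite exprS -[0]addr0; apply: vgeM.
Qed.

End Valuation.

(** [has_degree] over an arbitrary index type; for places weighted by [pdeg] the two are
    convertible. *)
Definition hasdeg (I : Type) (d : I -> nat) (D : I -> int) (n : int) : Prop :=
  exists s : seq I, List.NoDup s /\ (forall P, D P != 0 -> List.In P s) /\
    n = \sum_(P <- s) D P * (d P)%:Z.

Section Degree.
Variables (I : Type) (d : I -> nat).
Implicit Types D E : I -> int.

Lemma hasdegE D n : hasdeg d D n <-> exists s : seq {classic I},
  [/\ uniq s, forall P : {classic I}, D P != 0 -> P \in s & n = \sum_(P <- s) D P * (d P)%:Z].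
Proof.
split=> -[s]; first case=> us [sD ->].
  by exists s; split=> // [|P /sD /(@InP {classic I})//]; apply/(@NoDupP {classic I}).
case=> us sD ->; exists s; split; first exact/(@NoDupP {classic I}).
by split=> // P /sD /(@InP {classic I}).
Qed.

Lemma sum_supp D (s t : seq {classic I}) : uniq s -> uniq t ->
  (forall P : {classic I}, D P != 0 -> P \in s) -> {subset s <= t} ->
  \sum_(P <- s) D P * (d P)%:Z = \sum_(P <- t) D P * (d P)%:Z.
Proof.
move=> us ut sD st; rewrite [RHS](bigID (mem s)) /= [X in _ + X]big1_seq ?addr0; last first.
  by move=> P /andP[Ps _]; have [->|/sD] := eqVneq (D P) 0; [rewrite mul0r | rewrite (negPf Ps)].
rewrite -[RHS]big_filter; apply: perm_big; apply: uniq_perm => //; first exact: filter_uniq.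
by move=> P; rewrite mem_filter; case: (boolP (P \in s)) => // /st.
Qed.

Lemma hasdeg_sum D n (s : seq {classic I}) : hasdeg d D n -> uniq s ->
  (forall P : {classic I}, D P != 0 -> P \in s) -> n = \sum_(P <- s) D P * (d P)%:Z.
Proof.
move=> /hasdegE[t [ut tD ->]] us sD.
rewrite (@sum_supp D t (undup (s ++ t))) ?undup_uniq //; last first.
  by move=> P Pt; rewrite mem_undup mem_cat Pt orbT.
by rewrite -(@sum_supp D s (undup (s ++ t))) ?undup_uniq // => P Ps; rewrite mem_undup mem_cat Ps.
Qed.

Lemma hasdeg_fun D n m : hasdeg d D n -> hasdeg d D m -> n = m.
Proof. by move=> Dn /hasdegE[s [us sD ->]]; apply: hasdeg_sum. Qed.

Lemma hasdeg_common D E n m : hasdeg d D n -> hasdeg d E m ->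
  exists s : seq {classic I}, [/\ uniq s, forall P : {classic I}, D P != 0 -> P \in s,
    forall P : {classic I}, E P != 0 -> P \in s, n = \sum_(P <- s) D P * (d P)%:Z &
    m = \sum_(P <- s) E P * (d P)%:Z].
Proof.
move=> Dn Em; have /hasdegE[s [us sD _]] := Dn; have /hasdegE[t [ut tE _]] := Em.
exists (undup (s ++ t)); rewrite undup_uniq.
have h1 : forall P : {classic I}, D P != 0 -> P \in undup (s ++ t).
  by move=> P /sD Ps; rewrite mem_undup mem_cat Ps.
have h2 : forall P : {classic I}, E P != 0 -> P \in undup (s ++ t).
  by move=> P /tE Ps; rewrite mem_undup mem_cat Ps orbT.
by split=> //; apply: hasdeg_sum => //; apply: undup_uniq.
Qed.

Lemma hasdegD D E n m : hasdeg d D n -> hasdeg d E m -> hasdeg d (fun P => D P + E P) (n + m).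
Proof.
move=> Dn Em; have [s [us sD sE -> ->]] := hasdeg_common Dn Em.
apply/hasdegE; exists s; split=> // [P DE|]; last first.
  by rewrite -big_split /=; apply: eq_bigr => P _; rewrite mulrDl.
have [D0|/sD //] := eqVneq (D P) 0; apply: sE.
by move: DE; rewrite D0 add0r.
Qed.

Lemma hasdegZ D n c : hasdeg d D n -> hasdeg d (fun P => c * D P) (c * n).
Proof.
case/hasdegE=> s [us sD ->]; apply/hasdegE; exists s; split=> // [P|].
  by rewrite mulf_eq0 negb_or => /andP[_ /sD].
by rewrite mulr_sumr; apply: eq_bigr => P _; rewrite mulrA.
Qed.

Lemma eq_hasdeg D E n : D =1 E -> hasdeg d D n -> hasdeg d E n.
Proof. by move/funext->. Qed.

Lemma hasdegB D E n m : hasdeg d D n -> hasdeg d E m -> hasdeg d (fun P => D P - E P) (n - m).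
Proof.
move=> Dn Em; rewrite -mulN1r; apply: eq_hasdeg (hasdegD Dn (hasdegZ (-1) Em)) => P /=.
by rewrite mulN1r.
Qed.

Definition point (i : I) : I -> int := fun j => if `[< j = i >] then 1 else 0.

Lemma pointE i : point i i = 1. Proof. by rewrite /point asboolT. Qed.
Lemma point_neq i j : j <> i -> point i j = 0. Proof. by move=> ji; rewrite /point asboolF. Qed.
Lemma point_ge0 i j : 0 <= point i j. Proof. by rewrite /point; case: ifP. Qed.

Lemma hasdeg_point i : hasdeg d (point i) (d i)%:Z.
Proof.
apply/hasdegE; exists [:: (i : {classic I})]; split=> // [P|].
  have [->|/point_neq ->] := pselect (P = i :> I); last by rewrite eqxx.
  by rewrite inE eqxx.
by rewrite big_seq1 pointE mul1r.
Qed.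

Lemma hasdeg_ge0 D n : (forall P, 0 <= D P) -> hasdeg d D n -> 0 <= n.
Proof.
by move=> D0 /hasdegE[s [us sD ->]]; apply: sumr_ge0 => P _; rewrite mulr_ge0.
Qed.

Lemma hasdeg_le D E n m : (forall P, D P <= E P) -> hasdeg d D n -> hasdeg d E m -> n <= m.
Proof.
move=> DE Dn Em; rewrite -subr_ge0; apply: (hasdeg_ge0 _ (hasdegB Em Dn)) => P.
by rewrite subr_ge0.
Qed.

Lemma hasdeg_eff_le D n i : (forall P, 0 <= D P) -> hasdeg d D n -> D i * (d i)%:Z <= n.
Proof.
move=> D0 Dn; apply: (hasdeg_le _ (hasdegZ (D i) (hasdeg_point i)) Dn) => P.
by have [->|/point_neq ->] := pselect (P = i); [rewrite pointE mulr1 | rewrite mulr0].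
Qed.

Lemma hasdeg_finsupp D (s : seq {classic I}) : (forall P : {classic I}, D P != 0 -> P \in s) ->
  exists n, hasdeg d D n.
Proof.
move=> sD; exists (\sum_(P <- undup s) D P * (d P)%:Z); apply/hasdegE; exists (undup s).
by split; rewrite ?undup_uniq // => P /sD; rewrite mem_undup.
Qed.

Lemma hasdeg_eff0 D : (forall i, 0 < d i)%N -> (forall P, 0 <= D P) -> hasdeg d D 0 ->
  D =1 (fun=> 0).
Proof.
move=> dp D0 D00 P; apply/eqP; rewrite eq_le D0 andbT.
have := hasdeg_eff_le P D0 D00; have := dp P; inia.
Qed.

End Degree.

Lemma card_predC1 T (P : T -> Prop) x : finp P -> P x ->
  finp (fun y => P y /\ y <> x) /\ cardP P = (cardP (fun y => P y /\ y <> x)).+1.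
Proof.
move=> [s [us sP]] Px; have xs := (sP x).1 Px.
have E (y : {classic T}) : P y /\ y <> x <-> y \in rem (x : {classic T}) s.
  rewrite mem_rem_uniq // inE; split=> [[/sP -> /eqP ->]//|/andP[/eqP yx /sP]] //.
split; first by exists (rem (x : {classic T}) s); rewrite rem_uniq.
rewrite (cardPE us sP) (cardPE _ E) ?rem_uniq // size_rem //.
by rewrite prednK //; case: (s) xs.
Qed.

(** Serves twice: for representatives of divisor classes, and for representatives of one
    Riemann-Roch space modulo another. *)
Lemma finp_exchange_reps T (P : T -> Prop) (e : T -> T -> Prop) :
  (forall x, e x x) -> (forall x y z, e x y -> e y z -> e x z) -> (forall x y, e x y -> e y x) ->
  finp P -> exists R : seq {classic T}, [/\ uniq R, forall x : {classic T}, x \in R -> P x,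
    forall x y : {classic T}, x \in R -> y \in R -> e x y -> x = y &
    forall x : {classic T}, P x -> exists2 y, y \in R & e x y].
Proof.
move=> e_refl e_trans e_sym [s [us sP]].
suff [R [uR RP Re cov]] : exists R : seq {classic T}, [/\ uniq R, {subset R <= s},
    forall x y : {classic T}, x \in R -> y \in R -> e x y -> x = y &
    forall x : {classic T}, x \in s -> exists2 y, y \in R & e x y].
  by exists R; split=> // x; [move/RP/sP | move/sP/cov].
elim: s {us sP P} => [|a s [R [uR RP Re cov]]]; first by exists [::].
have [[y yR ay]|n] := pselect (exists2 y, y \in R & e a y).
  exists R; split=> // [x /RP|x]; rewrite inE; first by move=> ->; rewrite orbT.
  by case/orP=> [/eqP->|/cov //]; exists y.
exists (a :: R); split=> [/=|x|x y|x].
- by rewrite uR andbT; apply/negP => aR; apply: n; exists a.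
- by rewrite !inE => /orP[->//|/RP ->]; rewrite orbT.
- rewrite !inE => /orP[/eqP->|xR] /orP[/eqP->|yR] // xy.
  + by case: n; exists y.
  + by case: n; exists x => //; apply: e_sym.
  + exact: Re.
rewrite inE => /orP[/eqP->|/cov[y yR xy]]; first by exists a; rewrite ?inE ?eqxx.
by exists y => //; rewrite inE yR orbT.
Qed.

(** * Divisor classes for a system of valuations *)

(* Abstract enough to cover both the places of [F] and, in the proof of
   Schmidt's theorem, pairs (place, sheet) of the quadratic constant extension. *)
Section ValuationSystem.
Variables (F : fieldType) (I : Type) (v : I -> F -> int) (d : I -> nat) (q : nat).
Hypothesis vM : forall P (x y : F), x != 0 -> y != 0 -> v P (x * y) = v P x + v P y.
Hypothesis vD : forall P (x y : F), x != 0 -> y != 0 -> x + y != 0 ->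
  Num.min (v P x) (v P y) <= v P (x + y).
Implicit Types (D E : I -> int) (P : I) (x y : F).

Definition LL D x : Prop := x = 0 \/ forall P, - D P <= v P x.

Lemma LL_vge D x : LL D x <-> forall P, vge (v P) (- D P) x.
Proof.
split=> [[->|Dx] P|Dx]; [by left | by right |].
have [->|x0] := eqVneq x 0; first by left.
by right=> P; apply/(vgeE _ _ x0).
Qed.

Lemma LL0 D : LL D 0. Proof. by left. Qed.

Lemma LLD D x y : LL D x -> LL D y -> LL D (x + y).
Proof.
move=> /LL_vge Dx /LL_vge Dy; apply/LL_vge => P.
exact: (vgeD (vD P)).
Qed.

Lemma LLB D x y : LL D x -> LL D y -> LL D (x - y).
Proof.
move=> /LL_vge Dx /LL_vge Dy; apply/LL_vge => P.
exact: (vgeB (vM P) (vD P)).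
Qed.

Lemma LLM D E x y : LL D x -> LL E y -> LL (fun P => D P + E P) (x * y).
Proof.
move=> /LL_vge Dx /LL_vge Dy; apply/LL_vge => P.
by rewrite opprD; apply: (vgeM (vM P)).
Qed.

Lemma LL_le D E x : (forall P, D P <= E P) -> LL D x -> LL E x.
Proof.
move=> DE [->|Dx]; [by left | right=> P].
by apply: le_trans (Dx P); rewrite lerN2.
Qed.

Lemma LL1 D : (forall P, 0 <= D P) -> LL D 1.
Proof. by move=> D0; right=> P; rewrite (val1 (vM P)) oppr_le0. Qed.

Lemma LL_shift D x y : x != 0 -> LL (fun P => D P + v P x) y <-> LL D (x * y).
Proof.
move=> x0; have [->|y0] := eqVneq y 0; first by rewrite mulr0; split; left.
split=> [[/eqP|Dy]|[/eqP|Dy]]; rewrite ?mulf_eq0 ?(negPf x0) ?(negPf y0) //; right=> P.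
  by rewrite vM //; have := Dy P; ilia.
by have := Dy P; rewrite vM //; ilia.
Qed.

Lemma card_LL_shift D x : x != 0 -> finp (LL D) ->
  finp (LL (fun P => D P + v P x)) /\ cardP (LL (fun P => D P + v P x)) = cardP (LL D).
Proof.
move=> x0 fD; have im y : LL (fun P => D P + v P x) y -> LL D (x * y) by move/LL_shift; apply.
have inj y z : LL (fun P => D P + v P x) y -> LL (fun P => D P + v P x) z ->
  x * y = x * z -> y = z by move=> _ _ /(mulfI x0).
have f1 := finp_inj im inj fD.
split=> //; apply: (card_bij im inj _ f1) => y Dy; exists (x^-1 * y); last by rewrite mulVKf.
by apply/LL_shift => //; rewrite mulVKf.
Qed.

Definition equiv D E : Prop := exists x : F, x != 0 /\ forall P, D P = E P + v P x.

Lemma equiv_refl D : equiv D D.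
Proof. by exists 1; split; rewrite ?oner_neq0 // => P; rewrite (val1 (vM P)) addr0. Qed.

Lemma equiv_sym D E : equiv D E -> equiv E D.
Proof.
case=> x [x0 DE]; exists x^-1; split; rewrite ?invr_neq0 // => P.
by rewrite (valV (vM P)) // DE addrK.
Qed.

Lemma equiv_trans D E G : equiv D E -> equiv E G -> equiv D G.
Proof.
case=> x [x0 DE] [y [y0 EG]]; exists (x * y); split; rewrite ?mulf_neq0 // => P.
by rewrite DE EG vM //; ilia.
Qed.

Lemma equivD D E G : equiv D E -> equiv (fun P => D P + G P) (fun P => E P + G P).
Proof. by case=> x [x0 DE]; exists x; split=> // P; rewrite DE; ilia. Qed.

Lemma equivB D E G : equiv D E -> equiv (fun P => D P - G P) (fun P => E P - G P).
Proof. by case=> x [x0 DE]; exists x; split=> // P; rewrite DE; ilia. Qed.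

Lemma card_LL_equiv D E : equiv D E -> finp (LL E) ->
  finp (LL D) /\ cardP (LL D) = cardP (LL E).
Proof. by case=> x [x0 /funext ->]; apply: card_LL_shift. Qed.

Definition eff D : Prop := forall P, 0 <= D P.

Lemma LL_eff_equiv D x : x != 0 -> LL D x -> eff (fun P => D P + v P x).
Proof. by move=> x0 [/eqP|Dx P]; [rewrite (negPf x0) | have := Dx P; ilia]. Qed.

Lemma LL_ex_eff D : finp (LL D) -> (1 < cardP (LL D))%N -> exists2 E, eff E & equiv E D.
Proof.
move=> fD /(card_gt1_ex 0 fD)[x Dx /eqP x0].
exists (fun P => D P + v P x); first exact: LL_eff_equiv.
by exists x.
Qed.

(** Only an upper bound on the residue field. The estimates below need no more, and no more is
    proved for the quadratic extension. *)
Hypothesis residues : forall P, exists s : seq F, (size s <= q ^ d P)%N /\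
  forall x, vge (v P) 0 x -> exists2 y, y \in s & vge (v P) 1 (x - y).
Hypothesis uniformizer : forall P, exists2 t : F, t != 0 & v P t = 1.

(** A power of the uniformizer moves L(D + P) into the local ring at P; two elements with the same
    residue then differ by an element of L(D). *)
Lemma LL_step D P : finp (LL D) -> finp (LL (fun Q => D Q + point P Q)) /\
  (cardP (LL (fun Q => (D Q + point P Q)%R)) <= q ^ d P * cardP (LL D))%N.
Proof.
move=> fD; have [s [ss sP]] := residues P; have [t t0 vt] := uniformizer P.
have vu : v P (t ^ (D P + 1)) = D P + 1 by rewrite (val_exprz (vM P)) // vt mulr1.
have u0 : t ^ (D P + 1) != 0 by apply: expfz_neq0.
set u := t ^ _ in vu u0.
have rP x : exists y, vge (v P) 0 (u * x) -> y \in s /\ vge (v P) 1 (u * x - y).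
  have [/sP[y ys xy]|n] := pselect (vge (v P) 0 (u * x)); [by exists y | by exists 0].
have [r {}rP] := boolp.choice rP.
have inO x : LL (fun Q => D Q + point P Q) x -> vge (v P) 0 (u * x).
  move/LL_vge/(_ P); rewrite pointE => Dx.
  rewrite -(subrr (D P + 1)).
  by apply: (vgeM (vM P)) => //; right; rewrite vu.
have [fV le] : finp (LL (fun Q => D Q + point P Q)) /\
    (cardP (LL (fun Q => (D Q + point P Q)%R)) <= cardP (fun y => y \in s) * cardP (LL D))%N.
  apply: (card_quotient_leq (r := r)) => //; first exact: finp_seq.
    by move=> x /inO /rP[].
  move=> x y Dx Dy rxy; have [_ h1] := rP x (inO x Dx); have [_ h2] := rP y (inO y Dy).
  have h3 : vge (v P) 1 (u * (x - y)).
    have := vgeB (vM P) (vD P) h1 h2; rewrite rxy (_ : _ - _ = u * (x - y)) //.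
    by rewrite mulrBr; ring.
  apply/LL_vge => Q; have [->|QP] := pselect (Q = P).
    have [->|z0] := eqVneq (x - y) 0; first by left.
    right; move: h3; rewrite vgeE ?mulf_neq0 // vM // vu; ilia.
  move/LL_vge: (LLB Dx Dy) => /(_ Q); by rewrite point_neq // addr0.
split=> //; apply: leq_trans le _; rewrite leq_mul2r; apply/orP; right.
apply: leq_trans ss; apply: leq_trans (_ : size (undup s) <= _)%N; last exact: size_undup.
by rewrite -card_seq ?undup_uniq // (eq_cardP (Q := fun y => y \in s)) // => y; rewrite mem_undup.
Qed.

Lemma card_LL_leq D E n : (forall P, D P <= E P) -> hasdeg d (fun P => E P - D P) n%:Z ->
  finp (LL D) -> finp (LL E) /\ (cardP (LL E) <= q ^ n * cardP (LL D))%N.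
Proof.
move=> DE /hasdegE[s [us sED nE]] fD.
(* The induction is on the total multiplicity of [E - D] and not on its degree, since the weights
   [d] are not yet assumed positive. *)
have [m] := ubnP (\sum_(P <- s) absz (E P - D P)%R)%N.
elim: m E n DE sED nE => // m IHm E n DE sED nE lem.
have [e|nz] := eqVneq (\sum_(P <- s) absz (E P - D P)%R)%N 0%N.
  have e0 P : E P = D P.
    apply/eqP; rewrite -subr_eq0; apply/negPn/negP => h; move: (sED _ h) => Ps.
    move/eqP: e; rewrite (bigD1_seq (P : {classic I})) //= addn_eq0 absz_eq0 => /andP[/eqP e].
    by rewrite e eqxx in h.
  have -> : E = D by apply: funext.
  have -> : n = 0%N.
    by apply/eqP; rewrite -eqz_nat nE big1 // => P _; rewrite e0 subrr mul0r.
  by rewrite expn0 mul1n.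
have [P Ps ED] : exists2 P, P \in s & E P != D P.
  apply: contrapT => h; case/negP: nz; apply/eqP; rewrite big1_seq // => P /andP[_ Ps].
  have [->|ne] := eqVneq (E P) (D P); first by rewrite subrr.
  by case: h; exists P.
pose E' Q : int := E Q - point P Q.
have DE' Q : D Q <= E' Q.
  rewrite /E'; have [->|QP] := pselect (Q = P :> I); last by rewrite point_neq // subr0.
  rewrite pointE; have := DE P; move/eqP: ED; ilia.
have EE' : E = fun Q => E' Q + point P Q by apply: funext => Q; rewrite /E' subrK.
have sE' (Q : {classic I}) : E' Q - D Q != 0 -> Q \in s.
  have [->//|QP] := pselect (Q = P :> I).
  by rewrite /E' point_neq // subr0; apply: sED.
have sumE' : \sum_(Q <- s) (E Q - D Q) * (d Q)%:Z =
    \sum_(Q <- s) (E' Q - D Q) * (d Q)%:Z + (d P)%:Z.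
  rewrite !(bigD1_seq P) //= /E' pointE.
  rewrite [in RHS](eq_bigr (fun Q => (E Q - D Q) * (d Q)%:Z)); first by ring.
  by move=> Q /eqP QP; rewrite point_neq ?subr0.
have n'0 : 0 <= \sum_(Q <- s) (E' Q - D Q) * (d Q)%:Z.
  by apply: sumr_ge0 => Q _; rewrite mulr_ge0 // subr_ge0.
have [||fE' leE'] := IHm E' (absz (\sum_(Q <- s) (E' Q - D Q) * (d Q)%:Z)) DE' sE'.
- by rewrite gez0_abs.
- rewrite -ltnS; apply: leq_trans lem; rewrite ltnS !(bigD1_seq P) //= /E' pointE.
  rewrite (eq_bigr (fun Q => absz (E Q - D Q))); last first.
    by move=> Q /eqP QP; rewrite point_neq ?subr0.
  rewrite -addSn leq_add2r; have := DE' P; rewrite /E' pointE; ilia.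
have [fE leE] := LL_step P fE'; rewrite EE'; split=> //.
apply: leq_trans leE _; apply: leq_trans (leq_mul (leqnn _) leE') _.
rewrite mulnA -expnD leq_mul2r; apply/orP; right; apply: eq_leq; congr (_ ^ _)%N.
by apply/eqP; rewrite -eqz_nat nE sumE' PoszD gez0_abs // addrC.
Qed.

Hypothesis finL0 : finp (LL (fun=> 0)).

Lemma posdeg D n : hasdeg d D n -> exists m, hasdeg d (fun P => Num.max 0 (D P)) m.
Proof.
case/hasdegE=> s [us sD _]; apply: (@hasdeg_finsupp _ _ _ s) => P h; apply: sD.
by apply: contra_neq h => ->.
Qed.

Lemma card_LL_eff D n : eff D -> hasdeg d D n%:Z ->
  finp (LL D) /\ (cardP (LL D) <= q ^ n * cardP (LL (fun=> 0)))%N.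
Proof.
move=> D0 Dn; apply: card_LL_leq => //.
by apply: eq_hasdeg Dn => P; rewrite subr0.
Qed.

Lemma finp_LL D n : hasdeg d D n -> finp (LL D).
Proof.
case/posdeg => m Dm.
have e0 : eff (fun P => Num.max 0 (D P)) by move=> P; rewrite le_max lexx.
have m0 := hasdeg_ge0 e0 Dm; rewrite -(gez0_abs m0) in Dm.
have [f _] := card_LL_eff e0 Dm.
by apply: finp_sub f => x; apply: LL_le => P; rewrite le_max lexx orbT.
Qed.

Lemma card_LL_gt0 D n : hasdeg d D n -> (0 < cardP (LL D))%N.
Proof. by move/finp_LL => f; apply: card_gt0 f (LL0 D). Qed.

Hypothesis d_gt0 : forall P, (0 < d P)%N.
Hypothesis principal : forall x, x != 0 -> hasdeg d (v ^~ x) 0.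

Lemma hasdeg_equiv D E n : equiv D E -> hasdeg d E n -> hasdeg d D n.
Proof.
case=> x [x0 DE] En; rewrite -[n]addr0.
by apply: eq_hasdeg (hasdegD En (principal x0)) => P; rewrite DE.
Qed.

Lemma card_LL_neg D n : hasdeg d D n -> n < 0 -> cardP (LL D) = 1%N.
Proof.
move=> Dn n0; apply/(card1P (finp_LL Dn) (LL0 D)) => x Dx.
apply/eqP/negPn/negP => x0.
have := hasdeg_ge0 (LL_eff_equiv x0 Dx) (hasdegD Dn (principal x0)).
by rewrite addr0; ilia.
Qed.

Lemma unitsP x : x != 0 -> LL (fun=> 0) x <-> forall P, v P x = 0.
Proof.
move=> x0; split=> [L0x P|vx]; last by right=> P; rewrite vx oppr0.
have e : eff (v ^~ x).
  by move=> Q; have := LL_eff_equiv x0 L0x Q; rewrite add0r.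
exact: (hasdeg_eff0 d_gt0 e (principal x0)).
Qed.

(** The map x -> D + div(x) sends the nonzero elements of L(D) onto the effective divisors of the
    class, and its fibres are the orbits of the nonzero elements of L(0), which are the functions
    with zero divisor. *)
Lemma class_card D n : hasdeg d D n ->
  finp (fun E => eff E /\ equiv E D) /\
  (cardP (fun E => eff E /\ equiv E D) * (cardP (LL (fun=> 0))).-1 = (cardP (LL D)).-1)%N.
Proof.
move=> Dn; have fD := finp_LL Dn.
have [fD0 ->] := card_predC1 fD (LL0 D); have [fL0 ->] := card_predC1 finL0 (LL0 _).
pose f x := fun P => D P + v P x.
have fP x : LL D x /\ x <> 0 -> eff (f x) /\ equiv (f x) D.
  by case=> Dx /eqP x0; split; [apply: LL_eff_equiv | exists x].
have surj E : eff E /\ equiv E D -> exists2 x, LL D x /\ x <> 0 & f x = E.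
  case=> effE [x [x0 ED]]; exists x; last by apply: funext => P; rewrite ED.
  by split; [right=> P; have := effE P; rewrite ED; ilia | exact/eqP].
have fQ := finp_image surj fD0; split=> //=.
rewrite (card_fiber_eq (f := f) fD0 fQ fP (c := cardP (fun x => LL (fun=> 0) x /\ x <> 0))) //.
move=> E /surj[x [Dx /eqP x0] <-]; symmetry.
apply: (card_bij (f := fun y => x * y)) => //.
- move=> y [L0y /eqP y0]; split; last first.
    by apply: funext => P; rewrite /f vM // ((unitsP y0).1 L0y) addr0.
  split; last by apply/eqP; rewrite mulf_neq0.
  by have := LLM Dx L0y; apply: LL_le => P; rewrite addr0.
- by move=> y z _ _ /(mulfI x0).
- move=> y [[Dy /eqP y0] fxy]; exists (x^-1 * y); last by rewrite mulVKf.
  have z0 : x^-1 * y != 0 by rewrite mulf_neq0 ?invr_neq0.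
  split; last exact/eqP.
  apply/unitsP => // P; rewrite vM ?invr_neq0 // (valV (vM P)) //.
  by have := congr1 (fun g => g P) fxy; rewrite /f; ilia.
Qed.

Definition Am (n : nat) : nat := cardP (fun D : I -> int => eff D /\ hasdeg d D n%:Z).

Hypothesis fin_eff : forall n : nat, finp (fun D : I -> int => eff D /\ hasdeg d D n%:Z).

(** [T] may contain divisors whose class has no effective member: they contribute 0 to the sum. This
    freedom is used later for representatives shifted by a fixed divisor. *)
Lemma Am_classes (n : nat) (T : seq {classic (I -> int)}) : uniq T ->
  (forall D : {classic (I -> int)}, D \in T -> hasdeg d D n%:Z) ->
  (forall D E : {classic (I -> int)}, D \in T -> E \in T -> equiv D E -> D = E) ->
  (forall D, eff D -> hasdeg d D n%:Z -> exists2 E : {classic (I -> int)}, E \in T & equiv D E) ->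
  (Am n * (cardP (LL (fun=> 0))).-1 = \sum_(D <- T) (cardP (LL D)).-1)%N.
Proof.
move=> uT Tn Tinj Tcov.
have fP (D : I -> int) : exists E : {classic (I -> int)},
    eff D /\ hasdeg d D n%:Z -> E \in T /\ equiv D E.
  have [[D0 Dn]|no] := pselect (eff D /\ hasdeg d D n%:Z); last by exists D.
  by have [E ET DE] := Tcov D D0 Dn; exists E.
have [f {}fP] := boolp.choice fP.
rewrite /Am (@card_fibers _ {classic (I -> int)} _ f T (fin_eff n) uT); last by move=> D /fP[].
rewrite big_distrl /= big_seq [RHS]big_seq; apply: eq_bigr => D DT.
rewrite -(class_card (Tn D DT)).2; congr (_ * _)%N; apply: eq_cardP => E.
split=> [[h fE]|[E0 ED]]; first by split; [exact: h.1 | rewrite -fE; exact: (fP E h).2].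
have h : eff E /\ hasdeg d E n%:Z by split=> //; apply: hasdeg_equiv ED (Tn D DT).
split=> //; have [fET EfE] := fP E h.
by apply: Tinj => //; apply: equiv_trans ED; apply: equiv_sym.
Qed.

Definition class_reps_eff (n : nat) (R : seq {classic (I -> int)}) : Prop :=
  [/\ uniq R, forall D : {classic (I -> int)}, D \in R -> eff D /\ hasdeg d D n%:Z,
    forall D E : {classic (I -> int)}, D \in R -> E \in R -> equiv D E -> D = E &
    forall D : {classic (I -> int)}, eff D /\ hasdeg d D n%:Z -> exists2 E, E \in R & equiv D E].

Lemma ex_class_reps n : exists R, class_reps_eff n R.
Proof.
by apply: finp_exchange_reps (fin_eff n); [exact: equiv_refl | exact: equiv_trans | exact: equiv_sym].
Qed.

(** [C] will be [g - 1] for the places of F, and [2 (g - 1)] for the pairs of the quadratic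
    extension. *)
Variable C : nat.
Hypothesis q_gt1 : (1 < q)%N.
Hypothesis riemann : forall D (n : nat), hasdeg d D (n + C)%N%:Z -> (q ^ n <= cardP (LL D))%N.

Lemma ex_eff D (n : nat) : hasdeg d D n%:Z -> (C < n)%N -> exists2 E, eff E & equiv E D.
Proof.
move=> Dn Cn; apply: LL_ex_eff; first exact: finp_LL Dn.
rewrite -(subnK Cn) -addSnnS in Dn.
by apply: leq_trans (riemann Dn); apply: leq_trans q_gt1 _; rewrite -{1}[q]expn1 leq_exp2l.
Qed.

(* Subtracting multiples of [P0] brings every class into a bounded degree range. *)
Lemma class_bound (P0 : I) : exists H, forall n R, class_reps_eff n R -> (size R <= H)%N.
Proof.
pose e := d P0; have e0 : (0 < e)%N by apply: d_gt0.
exists (\sum_(m < C.+1 + e) Am m)%N => n R [uR Rn Rinj _].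
have le_sum m : (m < C.+1 + e)%N -> (Am m <= \sum_(m < C.+1 + e) Am m)%N.
  by move=> lt; rewrite (bigD1 (Ordinal lt)) //= leq_addr.
have [lt|ge] := ltnP n (C.+1 + e).
  apply: leq_trans (le_sum n lt); rewrite -(@card_seq {classic (I -> int)} R) //.
  by apply: leq_card; [move=> D /Rn | apply: fin_eff].
pose j := ((n - C.+1) %/ e)%N; pose m := (C.+1 + (n - C.+1) %% e)%N.
have nE : n = (m + j * e)%N.
  by rewrite /m /j -addnA [(_ %% _ + _)%N]addnC -divn_eq subnKC //; apply: leq_trans ge; apply: leq_addr.
have lem : (m < C.+1 + e)%N by rewrite ltn_add2l ltn_pmod.
apply: leq_trans (le_sum m lem); rewrite -(@card_seq {classic (I -> int)} R) //.
have hE (D : {classic (I -> int)}) : exists E : I -> int, D \in R ->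
    [/\ eff E, hasdeg d E m%:Z & equiv E (fun P => D P - j%:Z * point P0 P)].
  have [DR|nDR] := boolP (D \in R); last by exists D.
  have Dm : hasdeg d (fun P => D P - j%:Z * point P0 P) m%:Z.
    have -> : m%:Z = n%:Z - j%:Z * e%:Z by rewrite nE PoszD PoszM addrK.
    exact: hasdegB (Rn D DR).2 (hasdegZ _ (hasdeg_point _ _)).
  have [|E E0 ED] := ex_eff Dm; first by rewrite /m ltnS leq_addr.
  by exists E => _; split=> //; apply: hasdeg_equiv ED Dm.
have [f fP] := boolp.choice hE.
apply: (leq_card_in (f := f)); [| |exact: finp_seq|exact: fin_eff].
  by move=> D /fP[].
move=> D E DR ER fDE; apply: Rinj => //.
have [_ _ h1] := fP D DR; have [_ _ h2] := fP E ER.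
have := equivD (fun P => j%:Z * point P0 P) (equiv_trans (equiv_sym h1) (eq_rect _ (fun X => equiv X _) h2 _ (esym fDE))).
by congr equiv; apply: funext => P; rewrite subrK.
Qed.

(** The number of classes with effective members is bounded independently of n, and each of them has
    fewer than |L(D)| <= q^n |L(0)| effective divisors. *)
Lemma Am_bound (P0 : I) : exists H, forall n, (Am n <= H * q ^ n)%N.
Proof.
have [H HP] := class_bound P0; set c := cardP (LL (fun=> 0)).
have c1 : (1 < c)%N.
  have [f1 e] := card_predC1 finL0 (LL0 _); rewrite /c e ltnS.
  apply: (card_gt0 (x := 1)) => //.
  by split; [apply: LL1 | apply/eqP; rewrite oner_neq0].
exists (H * c)%N => n; have [R RP] := ex_class_reps n; have leH := HP n R RP.
case: RP => uR Rn Rinj Rcov.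
have An : (Am n * c.-1 = \sum_(D <- R) (cardP (LL D)).-1)%N.
  apply: Am_classes => // [D /Rn[]//|D D0 Dn]; exact: Rcov.
apply: (@leq_trans (Am n * c.-1)%N); first by rewrite leq_pmulr // -subn1 subn_gt0.
rewrite An; apply: (@leq_trans (\sum_(D <- R) q ^ n * c)%N).
  rewrite big_seq [X in (_ <= X)%N]big_seq; apply: leq_sum => D /Rn[D0 Dn].
  by apply: leq_trans (leq_pred _) _; case: (card_LL_eff D0 Dn).
by rewrite big_const_seq count_predT iter_addn_0 mulnC -mulnA [(c * _)%N]mulnC leq_mul2r leH orbT.
Qed.

End ValuationSystem.

Lemma card_vec (T : eqType) (P : T -> Prop) n : finp P ->
  finp (fun s : seq T => size s = n /\ forall x, x \in s -> P x) /\
  (cardP (fun s : seq T => size s = n /\ forall x, x \in s -> P x) = cardP P ^ n)%N.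
Proof.
move=> fP; elim: n => [|n [fn IHn]].
  have E (s : {classic seq T}) :
      size (s : seq T) = 0%N /\ (forall x : T, x \in (s : seq T) -> P x) <-> s \in [:: [::] : {classic seq T}].
    rewrite inE; split=> [[/size0nil -> _]|/eqP ->] //; exact: eqxx.
  by split; [exists [:: [::] : {classic seq T}] | rewrite (cardPE _ E)].
have [fX cX] := finp_prod fP fn.
pose f (z : T * seq T) := z.1 :: z.2.
have im z : P z.1 /\ (size z.2 = n /\ forall x, x \in z.2 -> P x) ->
    size (f z) = n.+1 /\ forall x, x \in f z -> P x.
  case=> Pz [sz Pzs]; split=> [|x]; first by rewrite /= sz.
  by rewrite inE => /orP[/eqP->|/Pzs].
have surj s : size s = n.+1 /\ (forall x, x \in s -> P x) ->
    exists2 z, P z.1 /\ (size z.2 = n /\ forall x, x \in z.2 -> P x) & f z = s.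
  case: s => [|a s] [] //= [sn] Ps; exists (a, s) => //=.
  by split; [apply: Ps; rewrite inE eqxx | split=> // x xs; apply: Ps; rewrite inE xs orbT].
have inj y z : P y.1 /\ (size y.2 = n /\ forall x, x \in y.2 -> P x) ->
    P z.1 /\ (size z.2 = n /\ forall x, x \in z.2 -> P x) -> f y = f z -> y = z.
  by case: y z => y1 y2 [z1 z2] _ _ [-> ->].
by split; [apply: finp_image surj fX | rewrite -(card_bij im inj surj fX) cX IHn expnS].
Qed.

(** Bernoulli's inequality, in the form [A ^ M * (A + M) <= A.+1 ^ M * A], refutes the hypothesis at
    M = A B. *)
Lemma leq_of_expn_leq (A B : nat) : (0 < A)%N -> (forall M, A.+1 ^ M <= A ^ M * B)%N -> False.
Proof.
move=> A0 H.
have bern M : (A ^ M * (A + M) <= A.+1 ^ M * A)%N.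
  elim: M => [|M IHM]; first by rewrite addn0.
  by rewrite !expnS; move: (A ^ M)%N (A.+1 ^ M)%N IHM => a b; nia.
have := bern (A * B)%N; have := H (A * B)%N.
have : (0 < A ^ (A * B))%N by rewrite expn_gt0 A0.
by move: (A ^ _)%N (A.+1 ^ _)%N => a b; nia.
Qed.

(** * Linear algebra over the finite field of constants *)

Section Subfield.
Variables (F : fieldType) (K : {pred F}) (q : nat).
Hypothesis HK : is_Fq_subfield K q.

Lemma memK1 : 1 \in K. Proof. by case: HK => -[]. Qed.
Lemma memKB a b : a \in K -> b \in K -> a - b \in K.
Proof. by case: HK => -[_ KB _] _; apply: KB. Qed.
Lemma memK0 : 0 \in K. Proof. by rewrite -(subrr 1) memKB ?memK1. Qed.
Lemma memKN a : a \in K -> - a \in K.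
Proof. by move=> aK; rewrite -sub0r memKB ?memK0. Qed.
Lemma memKD a b : a \in K -> b \in K -> a + b \in K.
Proof. by move=> aK bK; rewrite -[b]opprK memKB ?memKN. Qed.
Lemma memKdiv a b : a \in K -> b \in K -> a / b \in K.
Proof. by case: HK => -[_ _ Kd] _; apply: Kd. Qed.
Lemma memKV a : a \in K -> a^-1 \in K.
Proof. by move=> aK; rewrite -div1r memKdiv ?memK1. Qed.
Lemma memKM a b : a \in K -> b \in K -> a * b \in K.
Proof. by move=> aK bK; rewrite -[b]invrK memKdiv ?memKV. Qed.
Lemma memK_sum (J : Type) (r : seq J) (Q : pred J) (f : J -> F) :
  (forall j, Q j -> f j \in K) -> \sum_(j <- r | Q j) f j \in K.
Proof. by move=> H; elim/big_rec: _ => [|j x /H]; [exact: memK0 | apply: memKD]. Qed.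

Lemma finK : finp (fun a => a \in K) /\ cardP (fun a => a \in K) = q.
Proof.
case: HK => _ [s [us [sK <-]]]; split.
  by apply: finp_sub (finp_seq s) => a /sK.
by rewrite -(card_seq us); apply: eq_cardP.
Qed.

Lemma q_gt1 : (1 < q)%N.
Proof.
case: HK => _ [s [us [sK <-]]].
apply: (@leq_trans (size [:: 0; 1 : F])) => //; apply: uniq_leq_size.
  by rewrite /= inE eq_sym oner_neq0.
by move=> a; rewrite !inE => /orP[]/eqP->; apply/sK; [exact: memK0 | exact: memK1].
Qed.

Lemma q_gt0 : (0 < q)%N. Proof. exact: ltnW q_gt1. Qed.

Definition lc (c b : seq F) : F := \sum_(i < size b) c`_i * b`_i.

Lemma nth_memK (c : seq F) : (forall a, a \in c -> a \in K) <-> (forall i, c`_i \in K).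
Proof.
split=> H => [i|a /(nthP 0)[i _ <-]]; last exact: H.
by have [ltc|gec] := ltnP i (size c); [apply/H/mem_nth | rewrite nth_default ?memK0].
Qed.

Lemma card_Kvec n : finp (fun c : seq F => size c = n /\ forall i, c`_i \in K) /\
  (cardP (fun c : seq F => size c = n /\ forall i, (c`_i)%R \in K) = q ^ n)%N.
Proof.
have [fK cK] := finK; have [f c] := card_vec n fK.
have e (s : seq F) : size s = n /\ (forall i, s`_i \in K) <-> size s = n /\ (forall a, a \in s -> a \in K).
  by split=> -[-> /nth_memK].
by split; [apply: finp_sub f => s /e | rewrite (eq_cardP e) c cK].
Qed.

(** Independence modulo [W] treats two notions at once: [W] is the maximal ideal of a place for
    [residue_basis], and zero for [LD_basis]. *)
Definition free_mod (W : F -> Prop) (b : seq F) : Prop :=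
  forall c : seq F, size c = size b -> (forall i, c`_i \in K) -> W (lc c b) -> forall i, c`_i = 0.

Definition spans_mod (V W : F -> Prop) (b : seq F) : Prop :=
  forall z, V z -> exists c : seq F,
    size c = size b /\ (forall i, c`_i \in K) /\ W (z - lc c b).

Definition subspace (V : F -> Prop) : Prop :=
  [/\ V 0, forall x y, V x -> V y -> V (x - y) & forall a x, a \in K -> V x -> V (a * x)].

Lemma subspaceD V x y : subspace V -> V x -> V y -> V (x + y).
Proof. by case=> V0 VB _ Vx Vy; rewrite -[y]opprK -[- y]sub0r; apply: (VB) => //; apply: VB. Qed.

Lemma lc_mem V (c b : seq F) : subspace V -> (forall i, c`_i \in K) ->
  (forall i, (i < size b)%N -> V b`_i) -> V (lc c b).
Proof.
move=> sV cK bV; have [V0 _ VZ] := sV; rewrite /lc.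
elim/big_rec: _ => [//|i x _ Vx]; apply: subspaceD => //.
by apply: VZ => //; apply: bV.
Qed.

Lemma lc_cons a c x b : lc (a :: c) (x :: b) = a * x + lc c b.
Proof. by rewrite /lc /= big_ord_recl. Qed.

Lemma lcB (c c' b : seq F) : size c = size b -> size c' = size b ->
  lc c b - lc c' b = lc [seq z.1 - z.2 | z <- zip c c'] b.
Proof.
move=> sc sc'; rewrite /lc -sumrB; apply: eq_bigr => i _.
have szz : size (zip c c') = size b by rewrite size_zip sc sc' minnn.
by rewrite (nth_map (0, 0)) ?szz // nth_zip ?sc ?sc' //= mulrBl.
Qed.

Lemma free_mod_inj W b c c' : free_mod W b -> size c = size b -> size c' = size b ->
  (forall i, c`_i \in K) -> (forall i, c'`_i \in K) -> W (lc c b - lc c' b) -> c = c'.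
Proof.
move=> fb sc sc' cK c'K; rewrite lcB // => Wcc.
have szz : size (zip c c') = size b by rewrite size_zip sc sc' minnn.
have h i : (i < size b)%N -> ([seq z.1 - z.2 | z <- zip c c'])`_i = c`_i - c'`_i.
  by move=> lti; rewrite (nth_map (0, 0)) ?szz // nth_zip ?sc ?sc'.
apply: (@eq_from_nth _ 0) => [|i]; rewrite sc ?sc' // => lti.
apply/eqP; rewrite -subr_eq0 -h //; apply/eqP; apply: fb; rewrite ?size_map // => j.
have [ltj|gej] := ltnP j (size b); first by rewrite h // memKB.
by rewrite nth_default ?memK0 // size_map szz.
Qed.

Lemma free_mod_card V W b (s : seq F) : subspace V -> subspace W ->
  (forall i, (i < size b)%N -> V b`_i) -> free_mod W b ->
  (forall z, V z -> exists2 y, y \in s & W (z - y)) -> (q ^ size b <= size s)%N.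
Proof.
move=> sV sW bV fb cov; have [fK cK] := card_Kvec (size b).
have hr z : exists y, V z -> y \in s /\ W (z - y).
  by have [/cov[y ys zy]|n] := pselect (V z); [exists y | exists 0].
have [r {}hr] := boolp.choice hr.
have im c : size c = size b /\ (forall i, c`_i \in K) -> r (lc c b) \in s.
  by case=> sc cK'; case: (hr (lc c b) (lc_mem sV cK' bV)).
have [_ WB _] := sW.
have inj c c' : size c = size b /\ (forall i, c`_i \in K) ->
    size c' = size b /\ (forall i, c'`_i \in K) -> r (lc c b) = r (lc c' b) -> c = c'.
  move=> [sc cKc] [sc' cKc'] rr; apply: (free_mod_inj fb) => //.
  have [_ h1] := hr _ (lc_mem sV cKc bV); have [_ h2] := hr _ (lc_mem sV cKc' bV).
  by have := WB _ _ h1 h2; rewrite rr opprB addrA subrK.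
have := @leq_card_in _ _ _ (fun y => y \in s) (fun c => r (lc c b)) im inj fK (finp_seq s).
rewrite cK => /leq_trans; apply.
have <- : cardP (fun y => y \in undup s) = cardP (fun y => y \in s).
  by apply: eq_cardP => y; rewrite mem_undup.
by rewrite card_seq ?undup_uniq // size_undup.
Qed.

(** A free family of maximal length spans, because a vector outside its span could be added to it.
    The hypothesis bounds the length through q^n > n. *)
Lemma ex_basis_mod V W (N : nat) : subspace V -> subspace W ->
  (forall b, (forall i, (i < size b)%N -> V b`_i) -> free_mod W b -> (q ^ size b <= N)%N) ->
  exists b, [/\ forall i, (i < size b)%N -> V b`_i, free_mod W b & spans_mod V W b].
Proof.
move=> sV sW bound.
pose Q n := `[< exists b, [/\ size b = n, forall i, (i < size b)%N -> V b`_i & free_mod W b] >].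
have exQ : exists n, Q n.
  by exists 0%N; apply/asboolP; exists [::]; split=> // c /size0nil -> _ _ i; rewrite nth_nil.
have leQ n : Q n -> (n <= N)%N.
  case/asboolP=> b [<- bV fb]; apply: leq_trans (bound b bV fb).
  by apply/ltnW/ltn_expl/q_gt1.
have [n /asboolP[b [sb bV fb]] nmax] := ex_maxnP exQ leQ.
exists b; split=> // z Vz; apply: contrapT => nspan.
suff: (n.+1 <= n)%N by rewrite ltnn.
apply: nmax; apply/asboolP; exists (z :: b); split; first by rewrite /= sb.
  by case=> [|i] //= lti; apply: bV.
case=> [//|a c] [sc] cK; rewrite lc_cons => Wac.
have cK' i : c`_i \in K by apply: (cK i.+1).
have aK : a \in K by apply: (cK 0%N).
have [a0|a0] := eqVneq a 0.
  move: Wac; rewrite a0 mul0r add0r => Wc.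
  by case=> [|i] //=; apply: fb.
case: nspan; exists [seq - a^-1 * x | x <- c]; split; first by rewrite size_map.
have nthc i : [seq - a^-1 * x | x <- c]`_i = - a^-1 * c`_i.
  have [lti|gei] := ltnP i (size c); first by rewrite (nth_map 0).
  by rewrite !nth_default ?size_map // mulr0.
split=> [i|]; first by rewrite nthc memKM ?memKN ?memKV.
have -> : lc [seq - a^-1 * x | x <- c] b = - a^-1 * lc c b.
  by rewrite /lc mulr_sumr; apply: eq_bigr => i _; rewrite nthc mulrA.
have [_ _ WZ] := sW; have := WZ a^-1 _ (memKV aK) Wac.
by rewrite mulrDr mulKf // mulNr opprK.
Qed.

Definition combos (b : seq F) : F -> Prop :=
  fun z => exists c, [/\ size c = size b, forall i, c`_i \in K & z = lc c b].

Lemma card_combos W b : subspace W -> free_mod W b ->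
  finp (combos b) /\ (cardP (combos b) = q ^ size b)%N.
Proof.
case=> W0 _ _ fb; have [fK cK] := card_Kvec (size b).
have im c : size c = size b /\ (forall i, c`_i \in K) -> combos b (lc c b).
  by case=> sc cK'; exists c.
have surj z : combos b z -> exists2 c, size c = size b /\ (forall i, c`_i \in K) & lc c b = z.
  by case=> c [sc cK' ->]; exists c.
split; first exact: finp_image surj fK.
rewrite -cK; symmetry; apply: card_bij im _ surj fK => c c' [sc cKc] [sc' cKc'] e.
by apply: (free_mod_inj fb) => //; rewrite e subrr.
Qed.

Lemma spans_mod_seq V W b : spans_mod V W b ->
  exists2 s : seq F, (size s <= q ^ size b)%N &
    forall z, V z -> exists2 y, y \in s & W (z - y).
Proof.
move=> sb; have [fK cK] := card_Kvec (size b).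
have surj z : combos b z -> exists2 c, size c = size b /\ (forall i, c`_i \in K) & lc c b = z.
  by case=> c [sc cK' ->]; exists c.
have le := leq_card_image surj fK; have [s [us sP]] := finp_image surj fK.
exists (s : seq F) => [|z /sb[c [sc [cK' Wz]]]].
  by rewrite -cK -(cardPE us sP).
exists (lc c b) => //; apply/InP/(@InP {classic F})/sP; by exists c.
Qed.

(** Steinitz exchange by counting: the q^|b| combinations of [b] are distinct modulo [W], and the
    combinations of [b'] represent at most q^|b'| cosets. *)
Lemma basis_mod_size V W b b' : subspace V -> subspace W ->
  (forall i, (i < size b)%N -> V b`_i) -> free_mod W b -> spans_mod V W b' ->
  (size b <= size b')%N.
Proof.
move=> sV sW bV fb /spans_mod_seq[s ss cov].
have := leq_trans (free_mod_card sV sW bV fb cov) ss.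
by rewrite leq_exp2l // q_gt1.
Qed.

End Subfield.

Lemma leq_exp_base (m n e : nat) : (m <= n)%N -> (m ^ e <= n ^ e)%N.
Proof. by case: e => [//|e]; rewrite leq_exp2r. Qed.

(** * The rational subfield K(x) *)

Section RationalSubfield.
Variables (F : fieldType) (K : {pred F}) (q : nat).
Hypothesis HK : is_Fq_subfield K q.

Definition Kpoly (p : {poly F}) : Prop := forall i, p`_i \in K.

Lemma KpolyP (p : {poly F}) : p \is a polyOver K <-> Kpoly p.
Proof.
split=> [/allP pK i|pK]; last by apply/allP => _ /(nthP 0)[i _ <-]; apply: pK.
have [lti|gei] := ltnP i (size p); first exact/pK/mem_nth.
by rewrite nth_default //; apply: memK0 HK.
Qed.

Lemma Kpoly0 : Kpoly 0. Proof. by move=> i; rewrite coef0 (memK0 HK). Qed.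
Lemma KpolyC a : a \in K -> Kpoly a%:P.
Proof. by move=> aK i; rewrite coefC; case: ifP => _ //; apply: (memK0 HK). Qed.
Lemma Kpoly1 : Kpoly 1. Proof. exact/KpolyC/(memK1 HK). Qed.
Lemma KpolyX : Kpoly 'X.
Proof. by move=> i; rewrite coefX; case: eqP; rewrite ?(memK0 HK) ?(memK1 HK). Qed.
Lemma KpolyD p r : Kpoly p -> Kpoly r -> Kpoly (p + r).
Proof. by move=> pK rK i; rewrite coefD (memKD HK). Qed.
Lemma KpolyB p r : Kpoly p -> Kpoly r -> Kpoly (p - r).
Proof. by move=> pK rK i; rewrite coefB (memKB HK). Qed.
Lemma KpolyM p r : Kpoly p -> Kpoly r -> Kpoly (p * r).
Proof. by move=> pK rK i; rewrite coefM; apply: (memK_sum HK) => j _; apply: (memKM HK). Qed.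
Lemma Kpoly_prod (J : Type) (s : seq J) (Q : pred J) (f : J -> {poly F}) :
  (forall j, Q j -> Kpoly (f j)) -> Kpoly (\prod_(j <- s | Q j) f j).
Proof. by move=> H; elim/big_rec: _ => [|j p /H]; [exact: Kpoly1 | apply: KpolyM]. Qed.
Lemma Kpoly_exp p n : Kpoly p -> Kpoly (p ^+ n).
Proof. by move=> pK; elim: n => [|n IHn]; [exact: Kpoly1 | rewrite exprS; apply: KpolyM]. Qed.

Lemma card_Kpoly d : finp (fun p => Kpoly p /\ (size p <= d)%N) /\
  (cardP (fun p => Kpoly p /\ (size p <= d)%N) = q ^ d)%N.
Proof.
have [fK cK] := card_Kvec HK d.
have im (c : seq F) : size c = d /\ (forall i, c`_i \in K) -> Kpoly (Poly c) /\ (size (Poly c) <= d)%N.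
  by case=> <- cK'; split; [move=> i; rewrite coef_Poly | apply: size_Poly].
have surj p : Kpoly p /\ (size p <= d)%N ->
    exists2 c : seq F, size c = d /\ (forall i, c`_i \in K) & Poly c = p.
  case=> pK sp; have h i : (mkseq (fun i => p`_i) d)`_i = p`_i.
    have [lti|gei] := ltnP i d; first by rewrite nth_mkseq.
    by rewrite !nth_default ?size_mkseq // (leq_trans sp).
  exists (mkseq (fun i => p`_i) d); last by apply/polyP => i; rewrite coef_Poly h.
  by rewrite size_mkseq; split=> // i; rewrite h.
split; first exact: finp_image surj fK.
rewrite -cK; symmetry; apply: card_bij im _ surj fK => c c' [sc _] [sc' _] /polyP e.
apply: (@eq_from_nth _ 0) => [|i _]; first by rewrite sc sc'.
by have := e i; rewrite !coef_Poly.
Qed.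

Variables (x : F) (b : seq F).
Hypothesis Hb : Kx_basis K x b.
Let N := size b.

(* The elements with polynomial coordinates of degree less than [d]. *)
Definition Sd (d : nat) (f : F) : Prop := exists p : nat -> {poly F},
  (forall k, Kpoly (p k) /\ (size (p k) <= d)%N) /\ f = \sum_(k < N) (p k).[x] * b`_k.

Lemma Sd_le d e f : (d <= e)%N -> Sd d f -> Sd e f.
Proof.
move=> de [p [pP ->]]; exists p; split=> // k; case: (pP k) => pk sp.
by split=> //; apply: leq_trans de.
Qed.

Lemma Sd0 d : Sd d 0.
Proof.
exists (fun=> 0); split=> [k|]; first by rewrite size_poly0; split=> //; apply: Kpoly0.
by rewrite big1 // => k _; rewrite horner0 mul0r.
Qed.

Lemma SdD d f f' : Sd d f -> Sd d f' -> Sd d (f + f').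
Proof.
move=> [p [pP ->]] [r [rP ->]]; exists (fun k => p k + r k); split=> [k|].
  case: (pP k) (rP k) => pk sp [rk sr]; split; first exact: KpolyD.
  by apply: leq_trans (size_polyD _ _) _; rewrite geq_max sp.
by rewrite -big_split /=; apply: eq_bigr => k _; rewrite hornerD mulrDl.
Qed.

Lemma Sd_sum d (J : Type) (r : seq J) (Q : pred J) (f : J -> F) :
  (forall j, Q j -> Sd d (f j)) -> Sd d (\sum_(j <- r | Q j) f j).
Proof. by move=> H; elim/big_rec: _ => [|j y /H]; [exact: Sd0 | apply: SdD]. Qed.

Lemma SdM d e h f : Kpoly h -> (size h <= e.+1)%N -> Sd d f -> Sd (d + e) (h.[x] * f).
Proof.
move=> hK sh [p [pP ->]]; exists (fun k => h * p k); split=> [k|].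
  case: (pP k) => pk sp; split; first exact: KpolyM.
  have [->|p0] := eqVneq (p k) 0; first by rewrite mulr0 size_poly0.
  have [->|h0] := eqVneq h 0; first by rewrite mul0r size_poly0.
  by rewrite size_mul // addnC -subn1 leq_subLR add1n -addnS leq_add.
by rewrite mulr_sumr; apply: eq_bigr => k _; rewrite hornerM mulrA.
Qed.

Lemma card_Sd d : finp (Sd d) /\ (cardP (Sd d) <= q ^ (N * d))%N.
Proof.
have [fp cp] := card_Kpoly d; have [fv cv] := card_vec N fp.
pose g (s : seq {poly F}) := \sum_(k < N) (s`_k).[x] * b`_k.
have surj f : Sd d f -> exists2 s : seq {poly F},
    size s = N /\ (forall p, p \in s -> Kpoly p /\ (size p <= d)%N) & g s = f.
  case=> p [pP ->]; exists (mkseq p N); first by rewrite size_mkseq; split=> // r /mapP[k _ ->].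
  by apply: eq_bigr => k _; rewrite nth_mkseq.
split; first exact: finp_image surj fv.
by apply: leq_trans (leq_card_image surj fv) _; rewrite cv cp -expnM mulnC.
Qed.

Lemma Sd_denom f : exists h d, [/\ Kpoly h, h.[x] != 0 & Sd d (h.[x] * f)].
Proof.
have [c [sc [cK ->]]] := Hb.1 f.
have pr k : exists pr : {poly F} * {poly F},
    [/\ Kpoly pr.1, Kpoly pr.2, pr.2.[x] != 0 & c`_k * pr.2.[x] = pr.1.[x]].
  by have [p [r [/KpolyP pK /KpolyP rK rx e]]] := cK k; exists (p, r).
have [f2 f2P] := boolp.choice pr.
pose h := \prod_(k < N) (f2 k).2.
pose P (k : 'I_N) := (f2 k).1 * \prod_(j < N | j != k) (f2 j).2.
exists h, (\sum_(k < N) size (P k))%N; split.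
- by apply: Kpoly_prod => k _; case: (f2P k).
- by rewrite horner_prod prodf_seq_neq0; apply/allP => k _ /=; case: (f2P k).
rewrite mulr_sumr; apply: Sd_sum => k _.
exists (fun j => if j == k :> nat then P k else 0); split=> [j|].
  case: ifP => _; last by rewrite size_poly0; split=> //; apply: Kpoly0.
  split; last by rewrite (bigD1 k) //= leq_addr.
  apply: KpolyM; first by case: (f2P k).
  by apply: Kpoly_prod => i _; case: (f2P i).
rewrite (bigD1 k) //= eqxx [X in _ = _ + X]big1 ?addr0; last first.
  by move=> j jk; rewrite ifN // horner0 mul0r.
rewrite mulrA; congr (_ * _); case: (f2P k) => _ _ _ e.
by rewrite /h (bigD1 k) //= /P !hornerM -e; ring.
Qed.

Lemma Sd_denom_seq (s : seq F) :
  exists h d, [/\ Kpoly h, h.[x] != 0 & forall f, f \in s -> Sd d (h.[x] * f)].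
Proof.
elim: s => [|f s [h [d [hK hx hS]]]].
  by exists 1, 0%N; rewrite hornerC oner_neq0; split=> //; apply: Kpoly1.
have [h' [d' [hK' hx' hS']]] := Sd_denom f.
exists (h * h'), (d + size h' + (d' + size h))%N; split; first exact: KpolyM.
  by rewrite hornerM mulf_neq0.
move=> y; rewrite inE hornerM => /orP[/eqP->|ys].
  by rewrite -mulrA; apply: Sd_le (SdM hK (leqnSn _) hS'); rewrite leq_addl.
rewrite [h.[x] * _]mulrC -mulrA; apply: Sd_le (SdM hK' (leqnSn _) (hS y ys)).
by rewrite leq_addr.
Qed.

(** A height for [u]: multiplication by [u], cleared of the denominator [h], raises degrees in [x]
    by at most [R]. The number N R later takes the place of [F : K(u)]. *)
Definition mult_bound (u : F) (h : {poly F}) (R : nat) : Prop :=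
  [/\ Kpoly h, h.[x] != 0, (size h <= R.+1)%N & forall d f, Sd d f -> Sd (d + R) (h.[x] * (u * f))].

Lemma ex_mult_bound u : exists h R, mult_bound u h R.
Proof.
have [h [e [hK hx hS]]] := Sd_denom_seq [seq u * y | y <- b].
exists h, (e + size h)%N; split=> //; first by apply: leqW; apply: leq_addl.
move=> d f [p [pP ->]]; rewrite !mulr_sumr; apply: Sd_sum => k _.
have [pk sp] := pP k.
rewrite (_ : _ * _ = (p k).[x] * (h.[x] * (u * b`_k))); last by ring.
apply: (@Sd_le (e + d)); first by lia.
apply: SdM => //; first exact: leqW.
by apply/hS/map_f/mem_nth.
Qed.

(** Height 1 for [x] itself; this is what bounds the degree of its pole divisor by [size b]. *)
Lemma mult_bound_x : mult_bound x 1 1.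
Proof.
split; rewrite ?hornerC ?oner_neq0 ?size_poly1 //; first exact: Kpoly1.
move=> d f fS; rewrite mul1r -{1}[x]hornerX.
by apply: SdM => //; [exact: KpolyX | rewrite size_polyX].
Qed.

Lemma mult_bound_exp u h R d f M j : mult_bound u h R -> Sd d f -> (j <= M)%N ->
  Sd (d + M * R) (h.[x] ^+ M * (u ^+ j * f)).
Proof.
move=> [hK hx sh hS] fS; elim: M j => [|M IHM] j.
  by rewrite leqn0 => /eqP->; rewrite !expr0 !mul1r mul0n addn0.
rewrite leq_eqVlt => /orP[/eqP->|].
  rewrite mulSn addnCA addnC !exprS.
  rewrite (_ : _ * _ = h.[x] * (u * (h.[x] ^+ M * (u ^+ M * f)))); last by ring.
  exact/hS/IHM.
rewrite ltnS => /IHM fM; rewrite exprS -mulrA mulSn addnCA addnC.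
exact: SdM.
Qed.

(* A counting substitute for [F : K(u)] being finite: the sums of u^j t_j with
   j < M and t_j in T are distinct and have bounded height, so |T|^M is at most
   a constant times q^(N R M). *)
Lemma growth_bound u h R (T : seq F) : mult_bound u h R -> uniq T ->
  (forall (M : nat) (a : nat -> F),
    (forall j, (j < M)%N -> exists t t', [/\ t \in T, t' \in T & a j = t - t']) ->
    \sum_(j < M) u ^+ j * a j = 0 -> forall j, (j < M)%N -> a j = 0) ->
  (size T <= q ^ (N * R))%N.
Proof.
move=> mb uT indep; have [hT [e [hTK hTx hTS]]] := Sd_denom_seq T.
rewrite leqNgt; apply/negP => big.
have A0 : (0 < q ^ (N * R))%N by rewrite expn_gt0 (q_gt0 HK).
apply: (@leq_of_expn_leq _ (q ^ (N * e)) A0) => M.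
apply: (@leq_trans (size T ^ M)%N); first exact: leq_exp_base.
have [fv cv] := card_vec M (finp_seq T); rewrite (card_seq uT) in cv.
rewrite -cv -expnM -expnD; have [fS cS] := card_Sd (e + M * R).
have -> : (N * R * M + N * e = N * (e + M * R))%N by ring.
apply: leq_trans cS.
pose g (s : seq F) := h.[x] ^+ M * (hT.[x] * \sum_(j < M) u ^+ j * s`_j).
apply: (leq_card_in (f := g)) => // [s [sM sT]|s s' [sM sT] [sM' sT'] e'].
  rewrite /g !mulr_sumr; apply: Sd_sum => j _.
  rewrite (_ : _ * _ = h.[x] ^+ M * (u ^+ j * (hT.[x] * s`_j))); last by ring.
  apply: mult_bound_exp mb _ (ltnW (ltn_ord j)); apply: hTS.
  by apply/sT/mem_nth; rewrite sM.
have [_ hx _ _] := mb.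
have {e'} e0 : \sum_(j < M) u ^+ j * (s`_j - s'`_j) = 0.
  move/(mulfI (expf_neq0 M hx))/(mulfI hTx)/eqP: e'; rewrite -subr_eq0 -sumrB => /eqP e0.
  by rewrite -[RHS]e0; apply: eq_bigr => j _; rewrite mulrBr.
apply: (@eq_from_nth _ 0) => [|j]; rewrite sM ?sM' // => ltj.
apply/eqP; rewrite -subr_eq0; apply/eqP; apply: (indep M (fun j => s`_j - s'`_j)) => // i lti.
by exists s`_i, s'`_i; split=> //; [apply/sT/mem_nth; rewrite sM | apply/sT'/mem_nth; rewrite sM'].
Qed.

End RationalSubfield.

Lemma fun_not_inj_fin T (P : T -> Prop) (f : nat -> T) : finp P -> (forall n, P (f n)) ->
  exists i j, (i < j)%N /\ f i = f j.
Proof.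
move=> fP Pf; apply: contrapT => n.
have inj : injective f.
  move=> i j; case: (ltngtP i j) => // lt e; case: n; first by exists i, j.
  by exists j, i.
suff: ((cardP P).+1 <= cardP P)%N by rewrite ltnn.
rewrite -{1}(size_iota 0 (cardP P).+1) -card_seq ?iota_uniq //.
by apply: (leq_card_in (f := f)) => // [x y _ _ /inj //|]; apply: finp_seq.
Qed.

Lemma finp_bounded T (P : T -> Prop) (B : nat) :
  (forall s : seq {classic T}, uniq s -> (forall x : {classic T}, x \in s -> P x) -> (size s <= B)%N) ->
  finp P.
Proof.
move=> bnd.
pose Q n := `[< exists s : seq {classic T},
  [/\ uniq s, forall x : {classic T}, x \in s -> P x & size s = n] >].
have exQ : exists n, Q n by exists 0%N; apply/asboolP; exists [::].
have leQ n : Q n -> (n <= B)%N by case/asboolP=> s [us sP <-]; apply: bnd.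
have [n /asboolP[s [us sP sn]] nmax] := ex_maxnP exQ leQ.
exists s; split=> // x; split=> [Px|/sP //]; apply/negPn/negP => nx.
suff: (n.+1 <= n)%N by rewrite ltnn.
apply: nmax; apply/asboolP; exists (x :: s); split=> [/=|y|/=]; last by rewrite sn.
  by rewrite nx.
by rewrite inE => /orP[/eqP->|/sP].
Qed.

(** * Places, Riemann's inequality and principal divisors *)

Section FunctionField.
Variables (F : fieldType) (K : {pred F}) (q g : nat).
Hypothesis HK : is_Fq_subfield K q.
Implicit Types (P : place K) (D E : divisor K).
Local Notation v := (@vP F K).
Local Notation d := (@pdeg F K).

Lemma plM P (x y : F) : x != 0 -> y != 0 -> v P (x * y) = v P x + v P y.
Proof. by case: (proj2_sig P) => _ H _ _ _; apply: H. Qed.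

Lemma plD P (x y : F) : x != 0 -> y != 0 -> x + y != 0 -> Num.min (v P x) (v P y) <= v P (x + y).
Proof. by case: (proj2_sig P) => _ _ H _ _; apply: H. Qed.

Lemma pl_unif P : exists2 t : F, t != 0 & v P t = 1.
Proof. by case: (proj2_sig P) => _ _ _ [t [t0 vt]] _; exists t. Qed.

Lemma plK P a : a \in K -> a != 0 -> v P a = 0.
Proof. by case: (proj2_sig P) => _ _ _ _ H; apply: H. Qed.

Lemma vgeK P a : a \in K -> vge (v P) 0 a.
Proof.
move=> aK; have [->|a0] := eqVneq a 0; first exact: vge0.
by right; rewrite plK.
Qed.

Lemma vgeKM P m a x : a \in K -> vge (v P) m x -> vge (v P) m (a * x).
Proof. by move=> aK xm; rewrite -[m]add0r; apply: (vgeM (plM P)) => //; apply: vgeK. Qed.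

Lemma subspace_vge P m : subspace K (vge (v P) m).
Proof.
split; first exact: vge0.
  by move=> x y; apply: (vgeB (plM P) (plD P)).
by move=> a x; apply: vgeKM.
Qed.

Lemma in_mPE P z : in_mP P z <-> vge (v P) 1 z.
Proof. by split=> -[->|h]; [left | right; lia | left | right; lia]. Qed.

Lemma vge_Kpoly P z (p : {poly F}) : vge (v P) 0 z -> Kpoly K p -> vge (v P) 0 p.[z].
Proof.
move=> z0 pK; rewrite horner_coef; apply: (vge_sum (plD P)) => i _.
by apply: vgeKM => //; apply: (vgeX (plM P)).
Qed.

Lemma subspace_LL D : subspace K (LL v D).
Proof.
split; [exact: LL0 | by move=> x y; apply: (LLB plM plD) | ].
move=> a x aK /LL_vge Dx; apply/LL_vge => P; exact: vgeKM.
Qed.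

Lemma subspace0 : subspace K (fun z => z = 0).
Proof. by split=> [//|x y -> ->|a x _ ->]; rewrite ?subr0 ?mulr0. Qed.

Variables (x : F) (b : seq F).
Hypothesis Hb : Kx_basis K x b.

(** Finiteness of the residue field. With [u] a uniformizer and all nonzero a_j units, the sum of
    the u^j a_j has the valuation of its first nonzero term, so it cannot vanish and [growth_bound]
    applies. *)
Lemma residue_bounded P : exists B, forall T : seq F, uniq T ->
  (forall t, t \in T -> vge (v P) 0 t) ->
  (forall t t', t \in T -> t' \in T -> vge (v P) 1 (t - t') -> t = t') -> (size T <= B)%N.
Proof.
have [u u0 vu] := pl_unif P; have [h [R mb]] := ex_mult_bound HK Hb u.
exists (q ^ (size b * R))%N => T uT T0 Tinc; apply: (growth_bound HK Hb mb uT) => M a aT sum0.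
have av j : (j < M)%N -> vge (v P) 0 (a j) /\ (vge (v P) 1 (a j) -> a j = 0).
  case/aT=> t [t' [tT t'T ->]]; split; first by apply: (vgeB (plM P) (plD P)); apply: T0.
  by move/(Tinc _ _ tT t'T) ->; rewrite subrr.
suff H k : (k <= M)%N -> forall j, (j < k)%N -> a j = 0 by apply: H.
elim: k => [//|k IHk] ltk j; rewrite ltnS leq_eqVlt => /orP[/eqP->|]; last exact/IHk/ltnW.
apply/eqP/negPn/negP => ak0; have [ak nak] := av k ltk.
have vak : v P (a k) = 0.
  by apply: val_eq => // /nak /eqP; rewrite (negPf ak0).
have uk0 : u ^+ k * a k != 0 by rewrite mulf_neq0 ?expf_neq0.
have vuk : v P (u ^+ k * a k) = k%:Z.
  by rewrite plM ?expf_neq0 // (valX (plM P)) // vu vak; lia.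
move: sum0; rewrite (bigD1 (Ordinal ltk)) //=.
set S := \sum_(i < M | _) _.
have vS : vge (v P) (v P (u ^+ k * a k) + 1) S.
  apply: (vge_sum (plD P)) => i /eqP ik; rewrite vuk.
  have [lti|gei] := ltnP i k; first by rewrite (IHk (ltnW ltk) i lti) mulr0; apply: vge0.
  have lt : (k < i)%N.
    by rewrite ltn_neqAle gei andbT; apply/eqP => e; apply: ik; apply: val_inj.
  rewrite -[k%:Z + 1]addr0; apply: (vgeM (plM P)); last by case: (av i (ltn_ord i)).
  by right; rewrite (valX (plM P)) // vu; lia.
by case: (val_add_dom (plM P) (plD P) uk0 vS) => /eqP.
Qed.

(** Excludes the default value of [pdeg]: a residue basis exists because the residue field is
    finite, and all residue bases have the same length. *)
Lemma pdegP P : exists bs, size bs = d P /\ residue_basis P bs.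
Proof.
have [B HB] := residue_bounded P.
pose V := vge (v P) 0; pose W := vge (v P) 1.
have rbE bs : residue_basis P bs <->
    [/\ forall i, (i < size bs)%N -> V bs`_i, free_mod K W bs & spans_mod K V W bs].
  split.
    case=> h1 [h2 h3]; split; first exact: h1.
      by move=> c sc cK /in_mPE Wc; apply: h2.
    by move=> z /h3[c [sc [cK /in_mPE Wc]]]; exists c.
  case=> h1 h2 h3; split; first exact: h1.
  split; first by move=> c sc cK /in_mPE Wc; apply: h2.
  by move=> z /h3[c [sc [cK Wc]]]; exists c; split=> //; split=> //; apply/in_mPE.
have [|bs [h1 h2 h3]] := @ex_basis_mod _ _ _ HK V W B (subspace_vge P 0) (subspace_vge P 1).
  move=> bs bV fb; have [fc cc] := card_combos HK (subspace_vge P 1) fb.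
  rewrite -cc; case: fc => s [us sP]; rewrite (cardPE us sP).
  have sPP (t : F) : t \in (s : seq F) <-> combos K bs t.
    split=> [/InP/(@InP {classic F})/sP//|/sP/(@InP {classic F}) ?]; exact/InP.
  apply: HB; first by apply/NoDupP; apply/(@NoDupP {classic F}).
    by move=> t /sPP[c [sc cK ->]]; apply: lc_mem (subspace_vge P 0) cK bV.
  move=> t t' /sPP[c [sc cK ->]] /sPP[c' [sc' cK' ->]] Wt.
  by rewrite (free_mod_inj HK fb sc sc' cK cK' Wt).
suff -> : d P = size bs by exists bs; split=> //; apply/rbE.
apply: theP; first by exists bs; split=> //; apply/rbE.
move=> n [bs' [<- /rbE[h1' h2' h3']]]; apply/eqP; rewrite eqn_leq.
by apply/andP; split;
  apply: (basis_mod_size HK (subspace_vge P 0) (subspace_vge P 1)); eassumption.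
Qed.

Lemma residues P : exists s : seq F, (size s <= q ^ d P)%N /\
  forall z, vge (v P) 0 z -> exists2 y, y \in s & vge (v P) 1 (z - y).
Proof.
have [bs [<- [_ [_ h3]]]] := pdegP P.
have [|s s1 s2] := @spans_mod_seq _ _ _ HK (vge (v P) 0) (vge (v P) 1) bs; last by exists s.
by move=> z /h3[c [sc [cK /in_mPE Wc]]]; exists c.
Qed.

Lemma pdeg_gt0 P : (0 < d P)%N.
Proof.
have [bs [<- [_ [_ h3]]]] := pdegP P.
case: bs h3 => // /(_ 1)[|c [/size0nil -> [_]]]; first by right; rewrite (val1 (plM P)).
by rewrite big_ord0 subr0 => -[/eqP|]; rewrite ?oner_eq0 // (val1 (plM P)).
Qed.

(** Links the default-valued [ddim] to a count. Finiteness is a hypothesis, since that of L(0) is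
    derived only later and by means of this section. *)
Lemma ddim_card D : finp (LL v D) -> cardP (LL v D) = (q ^ ddim D)%N.
Proof.
move=> fD; pose W := fun z : F => z = 0.
have cW : cardP W = 1%N.
  have fW : finp W.
    by exists [:: (0 : {classic F})]; split=> // z; rewrite inE; split=> [->|/eqP //]; apply: eqxx.
  by apply/(card1P fW (x := 0)).
have lE bs : LD_basis D bs <-> [/\ forall i, (i < size bs)%N -> LL v D bs`_i,
    free_mod K W bs & spans_mod K (LL v D) W bs].
  split.
    case=> h1 [h2 h3]; split=> // z /h3[c [sc [cK zE]]].
    by exists c; split=> //; split=> //; rewrite zE; apply: subrr.
  case=> h1 h2 h3; split=> //; split=> // z /h3[c [sc [cK /eqP]]].
  by rewrite subr_eq0 => /eqP zE; exists c.
have cb bs : (forall i, (i < size bs)%N -> LL v D bs`_i) -> free_mod K W bs ->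
    (q ^ size bs <= cardP (LL v D))%N.
  move=> bD fb; have [_ <-] := card_combos HK subspace0 fb.
  apply: leq_card fD => z [c [sc cK ->]]; exact: lc_mem (subspace_LL D) cK bD.
have [bs [h1 h2 h3]] := ex_basis_mod HK (subspace_LL D) subspace0 cb.
have -> : ddim D = size bs.
  apply: theP; first by exists bs; split=> //; apply/lE.
  move=> n [bs' [<- /lE[h1' h2' h3']]]; apply/eqP; rewrite eqn_leq.
  by apply/andP; split; apply: (basis_mod_size HK (subspace_LL D) subspace0); eassumption.
have [_ <-] := card_combos HK subspace0 h2; apply: eq_cardP => z; split; last first.
  by case=> c [sc cK ->]; apply: lc_mem (subspace_LL D) cK h1.
case/h3=> c [sc [cK /eqP]]; rewrite subr_eq0 => /eqP zE.
by exists c.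
Qed.

Lemma ddim_gt0_fin D : (0 < ddim D)%N -> finp (LL v D).
Proof.
rewrite /ddim /the; case: excluded_middle_informative => [ex _|//].
case: ex => n [bs [_ [_ [_ h3]]]].
have [fK _] := card_Kvec HK (size bs).
apply: (finp_image (f := fun c => lc c bs) _ fK) => z /h3[c [sc [cK ->]]].
by exists c.
Qed.

Lemma ddegE D n : hasdeg d D n -> ddeg D = n.
Proof. by move=> Dn; apply: theP => // m Dm; apply: (hasdeg_fun Dm Dn). Qed.

Hypothesis Hfull : full_constant_field K.
Hypothesis Hg : is_genus K g.
Hypothesis g_gt0 : (1 < g)%N.

(** Without places every divisor has degree 0, and equality in the definition of the genus would
    read 1 - dim(D) = g > 1. *)
Lemma ex_place : exists P : place K, True.
Proof.
apply: contrapT => noP; case: Hg => _ [D [[n Dn] e]].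
have n0 : n = 0.
  case: Dn => s [_ [_ ->]]; by rewrite big1 // => P _; case: noP; exists P.
move: e; rewrite (ddegE Dn) n0; lia.
Qed.

(* [ddim D] is [0] when L(D) has no finite basis, so Riemann's inequality for a
   large multiple of a place forces L(0) to be finite. *)
Lemma L0_K : forall z, LL v (fun=> 0) z <-> z \in K.
Proof.
have [P _] := ex_place.
have Dn : hasdeg d (fun Q => g%:Z * point P Q) (g%:Z * (d P)%:Z).
  exact: hasdegZ (hasdeg_point _ _).
have dim0 : (0 < ddim (fun Q => g%:Z * point P Q : int))%N.
  have := Hg.1 _ (ex_intro _ _ Dn); rewrite (ddegE Dn).
  have := pdeg_gt0 P; move: (ddim _) => m; nia.
have f0 : finp (LL v (fun=> 0)).
  by apply: finp_sub (ddim_gt0_fin dim0) => z; apply: LL_le => Q; rewrite mulr_ge0 ?point_ge0.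
move=> z; split=> [Lz|zK]; last first.
  have [->|z0] := eqVneq z 0; first exact: LL0.
  by right=> Q; rewrite plK // oppr0.
(* L(0) is a finite ring, so two powers of [z] coincide; then [z] is algebraic over K and hence
   constant. *)
have [i [j [ij e]]] : exists i j, (i < j)%N /\ z ^+ i = z ^+ j.
  apply: (fun_not_inj_fin f0) => n; elim: n => [|n IHn]; first by rewrite expr0; apply: (LL1 plM).
  by rewrite exprS; have := LLM plM Lz IHn; apply: LL_le => Q; rewrite addr0.
apply: Hfull; exists ('X^j - 'X^i); split.
- apply/(KpolyP HK); apply: (KpolyB HK); apply: (Kpoly_exp HK); exact: KpolyX HK.
- rewrite -size_poly_gt0 size_polyDl size_polyXn ?size_polyN ?size_polyXn //.
- by rewrite rootE !hornerE -e subrr.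
Qed.

Lemma card_L0 : finp (LL v (fun=> 0)) /\ cardP (LL v (fun=> 0)) = q.
Proof.
have [fK cK] := finK HK; split; first by apply: finp_sub fK => z /L0_K.
by rewrite -cK; apply: eq_cardP => z; apply: L0_K.
Qed.

Definition finLL := finp_LL plM plD residues pl_unif card_L0.1.

Lemma genus_le D n : hasdeg d D n -> n + 1 - g%:Z <= (ddim D)%:Z.
Proof.
move=> Dn; have := Hg.1 _ (ex_intro _ _ Dn); rewrite (ddegE Dn).
by move: (ddim D) => m; lia.
Qed.

Lemma riemannF D (n : nat) : hasdeg d D (n + g.-1)%N%:Z -> (q ^ n <= cardP (LL v D))%N.
Proof.
move=> Dn; rewrite (ddim_card (finLL Dn)) leq_exp2l ?(q_gt1 HK) //.
have := genus_le Dn; move: (ddim D) => m; lia.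
Qed.

(** From a divisor attaining the genus upwards, the dimension grows by at most the degree, while
    Riemann's inequality makes it grow by at least as much. *)
Lemma genus_eq : exists (D0 : divisor K) d0, hasdeg d D0 d0 /\
  forall D n, (forall P, D0 P <= D P) -> hasdeg d D n -> (ddim D)%:Z = n + 1 - g%:Z.
Proof.
case: Hg => _ [D0 [[d0 D0d] e0]]; rewrite (ddegE D0d) in e0.
exists D0, d0; split=> // D n DD Dn; apply/eqP; rewrite eq_le genus_le // andbT.
have le := hasdeg_le DD D0d Dn; have dd := hasdegB Dn D0d.
have e : n - d0 = `|n - d0|%N%:Z by rewrite gez0_abs // subr_ge0.
rewrite e in dd.
have [_] := card_LL_leq plM plD residues pl_unif DD dd (finLL D0d).
rewrite (ddim_card (finLL Dn)) (ddim_card (finLL D0d)) -expnD leq_exp2l ?(q_gt1 HK) //.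
by move: (ddim _) (ddim _) e0 => m m'; lia.
Qed.

End FunctionField.

(** * Pole divisors, principal divisors, and finiteness of the set of effective divisors of given
    degree *)

Section Principal.
Variables (F : fieldType) (K : {pred F}) (q g : nat).
Hypothesis HK : is_Fq_subfield K q.
Hypothesis Hfull : full_constant_field K.
Hypothesis HF : function_field K.
Hypothesis Hg : is_genus K g.
Hypothesis g_gt0 : (1 < g)%N.
Variables (x : F) (b : seq F).
Hypothesis Hb : Kx_basis K x b.
Implicit Types (P : place K) (D E : divisor K).
Local Notation v := (@vP F K).
Local Notation d := (@pdeg F K).
Local Notation finLL := (finLL HK Hb Hfull Hg g_gt0).

Definition polar (u : F) : divisor K := fun P => Num.max 0 (- v P u).

Lemma polar_ge0 u P : 0 <= polar u P. Proof. by rewrite le_max lexx. Qed.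

(* Beyond the divisor [D0] attaining the genus, dimensions grow exactly with the
   degree; representatives of L(D0 + G) modulo L(D0), for G a finite part of the
   polar divisor of [u], are independent over K[u] by their leading terms. *)
Lemma polar_sum_bound u h R (S : seq {classic (place K)}) : u != 0 ->
  mult_bound K x b u h R -> uniq S ->
  \sum_(P <- S) polar u P * (d P)%:Z <= (size b * R)%N%:Z.
Proof.
move=> u0 mb uS; set n := \sum_(P <- S) _.
have n0 : 0 <= n by apply: sumr_ge0 => P _; rewrite mulr_ge0 ?polar_ge0.
have nE : n = `|n|%N%:Z by rewrite gez0_abs.
pose G P : int := if (P : {classic (place K)}) \in S then polar u P else 0.
have G0 P : 0 <= G P by rewrite /G; case: ifP => _; rewrite ?polar_ge0.
have Gn : hasdeg d G n.
  apply/hasdegE; exists S; split=> // [P|]; first by rewrite /G; case: ifP => // _; rewrite eqxx.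
  by rewrite /n big_seq [RHS]big_seq; apply: eq_bigr => P PS; rewrite /G PS.
have [D0 [d0 [D0d H0]]] := genus_eq HK Hb Hfull Hg g_gt0.
pose D1 : divisor K := fun P => D0 P + G P.
have D1d : hasdeg d D1 (d0 + n) := hasdegD D0d Gn.
have dim0 := H0 D0 d0 (fun P => lexx _) D0d.
have D01 P : D0 P <= D1 P by rewrite /D1 lerDl.
have dim1 := H0 D1 (d0 + n) D01 D1d.
have c0 := ddim_card HK (finLL D0d); have c1 := ddim_card HK (finLL D1d).
have LB (D : divisor K) y z : LL v D y -> LL v D z -> LL v D (y - z) by apply: (LLB (@plM F K) (@plD F K)).
have LD (D : divisor K) y z : LL v D y -> LL v D z -> LL v D (y + z) by apply: (LLD (@plD F K)).
have [||| T [uT TD Tinj Tcov]] := @finp_exchange_reps F (LL v D1) (fun y z => LL v D0 (y - z)) _ _ _ (finLL D1d).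
- by move=> y; rewrite subrr; apply: LL0.
- by move=> y z t yz zt; rewrite -(subrK z y) -addrA; apply: LD.
- by move=> y z yz; rewrite -opprB -sub0r; apply: LB => //; apply: LL0.
have uT' : uniq (T : seq F) by apply/NoDupP; apply/(@NoDupP {classic F}).
have memT (t : F) : t \in (T : seq F) <-> (t : {classic F}) \in T.
  by split=> [/InP|/(@InP {classic F})] tT; [apply/(@InP {classic F}) | apply/InP].
have sizeT : (q ^ `|n| <= size T)%N.
  have cov t : exists y, LL v D1 t -> y \in (T : seq F) /\ LL v D0 (t - y).
    have [/Tcov[y yT ty]|no] := pselect (LL v D1 t); [by exists y => _; split=> //; apply/memT | by exists 0].
  have [r rP] := boolp.choice cov.
  have [||_] := @card_quotient_leq _ _ (LL v D1) (LL v D0) (fun y => y \in (T : seq F)) r (finp_seq _) (finLL D0d).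
  - by move=> t /rP[].
  - move=> y z Dy Dz ryz; have [_ h1] := rP y Dy; have [_ h2] := rP z Dz.
    by have := LB _ _ _ h1 h2; rewrite ryz opprB addrA subrK.
  rewrite card_seq // c0 c1.
  have -> : ddim D1 = (`|n| + ddim D0)%N.
    by apply/eqP; rewrite -eqz_nat PoszD dim0 dim1 -nE; apply/eqP; ring.
  by rewrite expnD leq_pmul2r // expn_gt0 (q_gt0 HK).
suff le : (size T <= q ^ (size b * R))%N.
  by move: (leq_trans sizeT le); rewrite leq_exp2l ?(q_gt1 HK) // nE lez_nat.
apply: (growth_bound HK Hb mb uT') => M a aT.
have aD j : (j < M)%N -> LL v D1 (a j) /\ (LL v D0 (a j) -> a j = 0).
  case/aT=> t [t' [/memT tT /memT t'T ->]]; split; first by apply: LB; apply: TD.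
  by move/(Tinj _ _ tT t'T) ->; rewrite subrr.
elim: M a aT aD => [//|M IHM] a aT aD; rewrite big_ord_recr /= => sum0.
have aM0 : a M = 0.
  have [aM1 aM0] := aD M (ltnSn M); apply: aM0; apply/LL_vge => P.
  have h1 : vge (v P) (- D1 P) (a M) by move/LL_vge: aM1; apply.
  case PS: ((P : {classic (place K)}) \in S); last first.
    by move: h1; rewrite /D1 /G PS addr0.
  have [vu|vu] := lerP 0 (v P u).
    move: h1; rewrite /D1 /G PS /polar; move: vu; case: (v P u) => // k _.
    by rewrite max_l ?addr0 // oppr_le0.
  have GE : G P = - v P u by rewrite /G PS /polar max_r // oppr_ge0 ltW.
  (* At a pole of [u], a term with j < M has valuation at least (j + 1) v(u) - D0 >= M v(u) - D0.
     The vanishing sum forces the same bound on u^M a_M, so a_M satisfies the condition of L(D0) at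
     [P]. *)
  have h2 : vge (v P) (M%:Z * v P u - D0 P) (u ^+ M * a M).
    have -> : u ^+ M * a M = - \sum_(j < M) u ^+ j * a j.
      by apply/eqP; rewrite -addr_eq0 addrC sum0.
    apply/(vgeN (plM P)); apply: (vge_sum (plD P)) => j _.
    have h3 : vge (v P) (- D1 P) (a j).
      by have [/LL_vge + _] := aD j (leqW (ltn_ord j)); apply.
    have h4 : vge (v P) (j%:Z * v P u) (u ^+ j) by right; rewrite (valX (plM P)).
    apply: vge_le (vgeM (plM P) h4 h3); rewrite /D1 GE.
    by have := ltn_ord j; move: (nat_of_ord j) vu => i; move: (v P u) (D0 P) => w e; nia.
  have [->|a0] := eqVneq (a M) 0; first exact: vge0.
  right; move/vgeE: h2; rewrite mulf_neq0 ?expf_neq0 // => /(_ isT).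
  by rewrite plM ?expf_neq0 // (valX (plM P)) //; lia.
move=> j; rewrite ltnS leq_eqVlt => /orP[/eqP->//|ltj].
apply: IHM ltj => [i lti|i lti|]; [exact/aT/leqW | exact/aD/leqW |].
by move: sum0; rewrite aM0 mulr0 addr0.
Qed.

(** Each pole contributes at least 1 to the sum bounded by [polar_sum_bound]. *)
Lemma finp_poles u : u != 0 -> finp (fun P => v P u < 0).
Proof.
move=> u0; have [h [R mb]] := ex_mult_bound HK Hb u.
apply: (@finp_bounded _ _ (size b * R)) => S uS SP.
rewrite -lez_nat; apply: le_trans (polar_sum_bound u0 mb uS).
have -> : (size S)%:Z = \sum_(P <- S) 1 by rewrite big_const_seq count_predT iter_addr_0 natz.
rewrite big_seq [X in _ <= X]big_seq; apply: ler_sum => P /SP vu.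
rewrite /polar max_r; last by rewrite oppr_ge0 ltW.
by have := pdeg_gt0 HK Hb P; move: (d P) (v P u) vu => e w; nia.
Qed.

Lemma hasdeg_supp (D : divisor K) : finp (fun P => D P != 0) -> exists n, hasdeg d D n.
Proof. by case=> s [us sP]; apply: (@hasdeg_finsupp _ _ _ s) => P /sP. Qed.

Lemma finp_or T (A B : T -> Prop) : finp A -> finp B -> finp (fun y => A y \/ B y).
Proof.
case=> s [us sA] [t [ut tB]].
apply: (@finp_sub _ _ (fun y : {classic T} => y \in s ++ t)); last exact: finp_seq.
by move=> y [/sA|/tB] yin; rewrite mem_cat yin ?orbT.
Qed.

Lemma finp_div u : u != 0 -> finp (fun P => v P u != 0).
Proof.
move=> u0; apply: finp_sub (finp_or (finp_poles u0) (finp_poles (invr_neq0 u0))) => P.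
by rewrite (valV (plM P)) //; move: (v P u) => w; lia.
Qed.

(* L(M div u) has [q] elements for every M, against Riemann's inequality if the
   degree were positive. *)
Lemma principal_le0 u n : u != 0 -> hasdeg d (v ^~ u) n -> n <= 0.
Proof.
move=> u0 un; rewrite leNgt; apply/negP => n0.
(* With M n >= g + 1 Riemann's inequality yields dimension at least 2, whereas the space has exactly
   [q] elements. *)
pose M := g.+1; have uM0 : u ^+ M != 0 by rewrite expf_neq0.
have Mn : hasdeg d (fun P => 0 + v P (u ^+ M)) (M%:Z * n).
  by apply: eq_hasdeg (hasdegZ M%:Z un) => P /=; rewrite add0r (valX (plM P)).
have [_] := card_LL_shift (@plM F K) uM0 (card_L0 HK Hb Hfull Hg g_gt0).1.
rewrite (card_L0 HK Hb Hfull Hg g_gt0).2 => cq.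
have e : M%:Z * n = (absz (M%:Z * n - g.-1%:Z)%R + g.-1)%N%:Z.
  by rewrite PoszD gez0_abs; [ring | move: g_gt0; rewrite /M; nia].
rewrite e in Mn; have := riemannF HK Hb Hfull Hg g_gt0 Mn; rewrite cq.
rewrite -{2}[q]expn1 leq_exp2l ?(q_gt1 HK) //; move: g_gt0; rewrite /M; nia.
Qed.

(** The divisors of [u] and of its inverse are opposite and both have degree at most 0. *)
Lemma principalF u : u != 0 -> hasdeg d (v ^~ u) 0.
Proof.
move=> u0; have [n un] := hasdeg_supp (finp_div u0).
have n_le := principal_le0 u0 un.
have uVn : hasdeg d (v ^~ u^-1) (-1 * n).
  by apply: eq_hasdeg (hasdegZ (-1) un) => P /=; rewrite mulN1r (valV (plM P)).
have := principal_le0 (invr_neq0 u0) uVn => n_ge.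
by have <- : n = 0 by lia.
Qed.

(** The given [x] need not be the element supplied by [function_field]. If it were algebraic it
    would lie in K, so F would be finite and all its elements algebraic. *)
Lemma Kx_transcendental : ~ algebraic_over K x.
Proof.
move=> algx; have xK : x \in K by apply: Hfull.
have pK p : Kpoly K p -> p.[x] \in K.
  move=> pK; rewrite horner_coef; apply: (memK_sum HK) => i _; apply: (memKM HK) => //.
  by elim: (nat_of_ord i) => [|n IHn]; rewrite ?expr0 ?(memK1 HK) // exprS (memKM HK).
have finF : finp (fun _ : F => True).
  have [fK _] := card_Kvec HK (size b).
  apply: (finp_image (f := fun c => lc c b) _ fK) => z _.
  have [c [sc [cK ->]]] := Hb.1 z; exists c => //; split=> // i.
  have [p [r [/(KpolyP HK) pp /(KpolyP HK) rp rx e]]] := cK i.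
  by rewrite -(mulfK rx c`_i) e (memKdiv HK) ?pK.
case: HF => y [nalg _]; apply: nalg.
have [i [j [ij e]]] := fun_not_inj_fin (f := fun n => y ^+ n) finF (fun=> I).
exists ('X^j - 'X^i); split.
- apply/(KpolyP HK); apply: (KpolyB HK); apply: (Kpoly_exp HK); exact: KpolyX HK.
- by rewrite -size_poly_gt0 size_polyDl size_polyXn ?size_polyN ?size_polyXn.
- by rewrite rootE !hornerE e subrr.
Qed.

Lemma Kpoly_eval_neq0 p : Kpoly K p -> p != 0 -> p.[x] != 0.
Proof.
move=> pK p0; apply/eqP => px; apply: Kx_transcendental.
by exists p; split=> //; [apply/(KpolyP HK) | apply/rootP].
Qed.

(** At a place of degree at most n that is not a pole of [x], the q^(n+1) polynomials of degree at
    most n have at most q^n residues, so some nonzero one vanishes there. There are finitely many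
    such polynomials, each with finitely many zeros. *)
Lemma finp_places (n : nat) : finp (fun P => (d P <= n)%N).
Proof.
have [fp cp] := card_Kpoly HK n.+1.
have x0 : x != 0.
  by rewrite -[x]hornerX; apply: Kpoly_eval_neq0; [exact: KpolyX HK | rewrite polyX_eq0].
pose Q p P := Kpoly K p /\ (size p <= n.+1)%N /\ p != 0 /\ v P p.[x] != 0.
suff cov P : (d P <= n)%N -> v P x < 0 \/ exists p, Q p P.
  apply: (finp_sub cov); apply: finp_or; first exact: finp_poles.
  have [s [us sP]] := fp.
  have fQ p : exists t : seq {classic (place K)}, forall P : {classic (place K)}, Q p P -> P \in t.
    have [[pK p0]|no] := pselect (Kpoly K p /\ p != 0); last first.
      by exists [::] => P [pK [_ [p0 _]]]; case: no.
    have [t [_ tP]] := finp_div (Kpoly_eval_neq0 pK p0).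
    by exists t => P [_ [_ [_ ?]]]; apply/tP.
  have [t tP] := boolp.choice fQ.
  apply: (@finp_sub _ _ (fun P : {classic (place K)} =>
    P \in flatten (map (t : {classic {poly F}} -> seq {classic (place K)}) s))); last exact: finp_seq.
  move=> P [p pP]; apply/flattenP; exists (t p); last exact: tP.
  by apply: (@map_f {classic {poly F}}); apply/sP; case: pP => pK [sp _].
move=> dPn; have [vx|vx] := ltP (v P x) 0; [by left | right].
have [s [ss sP]] := residues HK Hb P.
have hr p : exists y, Kpoly K p -> y \in s /\ vge (v P) 1 (p.[x] - y).
  have [pK|no] := pselect (Kpoly K p); last by exists 0.
  have px : vge (v P) 0 p.[x] by apply: vge_Kpoly pK; right.
  by have [y ys py] := sP _ px; exists y.
have [r rP] := boolp.choice hr.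
have [p [p' [[pK sp] [pK' sp'] rpp pp]]] : exists p p', [/\ Kpoly K p /\ (size p <= n.+1)%N,
    Kpoly K p' /\ (size p' <= n.+1)%N, r p = r p' & p <> p'].
  apply: contrapT => no; suff: (q ^ n.+1 <= q ^ n)%N by rewrite leq_exp2l ?(q_gt1 HK) // ltnn.
  rewrite -cp; apply: leq_trans (_ : (size s <= _)%N); last first.
    by apply: leq_trans ss _; rewrite leq_exp2l ?(q_gt1 HK).
  apply: leq_trans (_ : (size (undup s) <= _)%N); last exact: size_undup.
  rewrite -card_seq ?undup_uniq //; apply: (leq_card_in (f := r)) => //.
  - by move=> p [/rP[rs _] _]; rewrite mem_undup.
  - by move=> p p' hp hp' e; apply: contrapT => ne; apply: no; exists p, p'.
  - exact: finp_seq.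
exists (p - p'); split; first exact: KpolyB HK _ _ pK pK'.
have pp0 : p - p' != 0 by rewrite subr_eq0; apply/eqP.
split; first by apply: leq_trans (size_polyD _ _) _; rewrite size_polyN geq_max sp.
split=> //; have [_ h1] := rP p pK; have [_ h2] := rP p' pK'.
have := vgeB (plM P) (plD P) h1 h2; rewrite rpp opprB addrA subrK -hornerN -hornerD.
rewrite vgeE; last by apply: Kpoly_eval_neq0 => //; apply: (KpolyB HK).
by move: (v P _) => w; lia.
Qed.

(** An effective divisor of degree n is determined by its multiplicities, all at most n, at the
    finitely many places of degree at most n. *)
Lemma finp_eff (n : nat) : finp (fun D : divisor K => eff D /\ hasdeg d D n%:Z).
Proof.
have [L [uL LP]] := finp_places n.
have [fv _] := card_vec (size L) (finp_seq (iota 0 n.+1)).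
have bnd D P : eff D -> hasdeg d D n%:Z -> D P != 0 -> D P <= n%:Z /\ (d P <= n)%N.
  move=> D0 Dn DP; have := hasdeg_eff_le P D0 Dn; have := D0 P.
  by have := pdeg_gt0 HK Hb P; move: (D P) (d P) DP => a e; nia.
apply: (@finp_inj _ _ _ _ (fun D : divisor K => [seq absz (D P) | P : {classic (place K)} <- L]) _ _ fv).
  move=> D [D0 Dn]; rewrite size_map; split=> // k /mapP[P _ ->]; rewrite mem_iota /= add0n ltnS.
  have [->//|DP] := eqVneq (D P) 0.
  by have [] := bnd D P D0 Dn DP; have := D0 P; move: (D P) => a; lia.
move=> D E [D0 Dn] [E0 En] /eq_in_map e; apply: funext => P.
have [PL|nPL] := boolP ((P : {classic (place K)}) \in L).
  by have := e P PL; have := D0 P; have := E0 P; move: (D P) (E P) => a c; lia.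
have z (G : divisor K) : eff G -> hasdeg d G n%:Z -> G P = 0.
  move=> G0 Gn; apply/eqP/negPn/negP => GP; case/negP: nPL; apply/LP.
  by case: (bnd G P G0 Gn GP).
by rewrite !z.
Qed.

End Principal.

(** * Riemann-Roch spaces in the hyperelliptic case *)

Section Hyperelliptic.
Variables (F : fieldType) (K : {pred F}) (q g : nat).
Hypothesis HK : is_Fq_subfield K q.
Hypothesis Hfull : full_constant_field K.
Hypothesis HF : function_field K.
Hypothesis Hg : is_genus K g.
Hypothesis g_gt0 : (1 < g)%N.
Variables (x : F) (b : seq F).
Hypothesis Hb : Kx_basis K x b.
Hypothesis Hb2 : size b = 2.
Implicit Types (P : place K) (D E : divisor K).
Local Notation v := (@vP F K).
Local Notation d := (@pdeg F K).
Local Notation finLL := (finLL HK Hb Hfull Hg g_gt0).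
Local Notation G := (@polar F K x).
Local Notation evalN0 := (Kpoly_eval_neq0 HK Hfull HF Hb).

Lemma hyp_x_neq0 : x != 0.
Proof. by rewrite -[x]hornerX; apply: evalN0; [exact: KpolyX HK | rewrite polyX_eq0]. Qed.
Local Notation x0 := hyp_x_neq0.

Lemma ex_deg_polar (u : F) : u != 0 -> exists n, hasdeg d (@polar F K u) n%:Z.
Proof.
move=> u0; have [|n un] := @hasdeg_supp _ K (@polar F K u).
  apply: finp_sub (finp_poles HK Hfull Hg g_gt0 Hb u0) => P; rewrite /polar.
  by move: (v P u) => w; lia.
have n0 := hasdeg_ge0 (polar_ge0 u) un.
by exists `|n|%N; rewrite gez0_abs.
Qed.

(** If F were K(x), the relation b_1 b_0 - b_0 b_1 = 0 would force b_0 = b_1 = 0, and then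
    coefficients 1, 1 would contradict independence. *)
Lemma ex_irrational : exists z, ~ in_Kx K x z.
Proof.
apply: contrapT => no; have all f : in_Kx K x f by apply: contrapT => nf; apply: no; exists f.
have h0 : b`_1 = 0 /\ - b`_0 = 0.
  have e : \sum_(i < size b) [:: b`_1; - b`_0]`_i * b`_i = 0.
    by rewrite Hb2 !big_ord_recl big_ord0 /=; ring.
  have H := Hb.2 [:: b`_1; - b`_0] (esym Hb2) (fun=> all _) e.
  by split; [exact: (H 0%N) | exact: (H 1%N)].
have e : \sum_(i < size b) [:: 1; 1 : F]`_i * b`_i = 0.
  rewrite Hb2 !big_ord_recl big_ord0 /= h0.1; move/eqP: h0.2; rewrite oppr_eq0 => /eqP ->.
  by rewrite !mulr0 !addr0.
have := Hb.2 [:: 1; 1] (esym Hb2) (fun=> all _) e 0%N => /eqP.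
by rewrite oner_eq0.
Qed.

Lemma LL_poly (M : nat) (p : {poly F}) : Kpoly K p -> (size p <= M.+1)%N ->
  LL v (fun P => M%:Z * G P) p.[x].
Proof.
move=> pK sp; apply/LL_vge => P; rewrite horner_coef; apply: (vge_sum (plD P)) => i _.
apply: vgeKM => //; right; rewrite (valX (plM P)) ?x0 //.
have := leq_trans (ltn_ord i) sp; rewrite ltnS /polar.
by move: (nat_of_ord i) (v P x) => j w; nia.
Qed.

(** Distinct pairs p, r give distinct elements p(x) + r(x) z: a coincidence would exhibit [z] as a
    quotient in K(x). *)
Lemma card_irrational z D (M : nat) n : ~ in_Kx K x z -> eff D -> LL v D z ->
  hasdeg d (fun P => M%:Z * G P + D P) n ->
  (2 * M.+1 <= ddim (fun P => M%:Z * G P + D P : int)%R)%N.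
Proof.
move=> nz D0 Dz Dn; rewrite -(leq_exp2l _ _ (q_gt1 HK)) -(ddim_card HK (finLL Dn)).
have [fp cp] := card_Kpoly HK M.+1; have [fX cX] := finp_prod fp fp.
rewrite mul2n -addnn expnD -cp -cX.
apply: (leq_card_in (f := fun pr => pr.1.[x] + pr.2.[x] * z)) (finLL Dn) => //.
- move=> [p r] /= [[pK sp] [rK sr]]; apply: (LLD (@plD F K)).
    by apply: LL_le (LL_poly pK sp) => P; rewrite lerDl.
  exact: (LLM (@plM F K)) (LL_poly rK sr) Dz.
move=> [p r] [p' r'] /= [[pK sp] [rK sr]] [[pK' sp'] [rK' sr']] e.
have e1 : z * (r - r').[x] = (p' - p).[x].
  rewrite !hornerE; move: e; move: p.[x] p'.[x] r.[x] r'.[x] => a a' c c' e.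
  apply/eqP; rewrite -subr_eq0 -(subrr (a + c * z)) {2}e; apply/eqP; ring.
have rr : r = r'.
  apply: contrapT => /eqP; rewrite -subr_eq0 => rr0; apply: nz.
  exists (p' - p), (r - r'); split; [exact/(KpolyP HK)/(KpolyB HK) | exact/(KpolyP HK)/(KpolyB HK) | | by []].
  by apply: evalN0 => //; apply: (KpolyB HK).
move: e1; rewrite rr subrr horner0 mulr0 => /esym/eqP; have [->//|pp] := eqVneq p p'.
rewrite (negPf (evalN0 _ _)) //; first exact: KpolyB HK _ _ pK' pK.
by rewrite subr_eq0 eq_sym.
Qed.

Lemma ddim_eff_le D (n : nat) : eff D -> hasdeg d D n%:Z -> (ddim D <= n.+1)%N.
Proof.
move=> D0 Dn.
have [fD] := card_LL_eff (@plM F K) (@plD F K) (residues HK Hb) (@pl_unif F K)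
  (card_L0 HK Hb Hfull Hg g_gt0).1 D0 Dn.
rewrite (ddim_card HK fD) (card_L0 HK Hb Hfull Hg g_gt0).2 -expnSr.
by rewrite leq_exp2l // (q_gt1 HK).
Qed.

(** Degree at most 2 comes from the height of [x]. Conversely, for an irrational [z] with m poles
    and n the degree of G, the space L(m G + poles of z) has dimension at least 2 (m + 1) and at
    most m n + m + 1, so n >= 2. *)
Lemma deg_polar_x : hasdeg d G 2.
Proof.
have [n Gn] := ex_deg_polar x0.
have le2 : (n <= 2)%N.
  have /hasdegE[s [us sG e]] := Gn.
  have := polar_sum_bound HK Hfull Hg g_gt0 Hb x0 (mult_bound_x HK x b) us.
  by rewrite -e Hb2 muln1 lez_nat.
have [z nz] := ex_irrational.
have z0 : z != 0.
  apply/eqP => z0; apply: nz; rewrite z0; exists 0, 1; rewrite mul0r horner0 hornerC oner_neq0.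
  by split=> //; apply/(KpolyP HK); [exact: Kpoly0 HK | exact: Kpoly1 HK].
have [m Zm] := ex_deg_polar z0.
have Dn : hasdeg d (fun P => m%:Z * G P + @polar F K z P) (m * n + m)%N%:Z.
  by rewrite PoszD PoszM; apply: hasdegD Zm; apply: hasdegZ.
have Zz : LL v (@polar F K z) z by right=> P; rewrite /polar; move: (v P z) => w; lia.
have := card_irrational nz (polar_ge0 z) Zz Dn.
have e0 : eff (fun P => m%:Z * G P + @polar F K z P).
  by move=> P; have := polar_ge0 z P; have := polar_ge0 x P; move: (G P) (@polar F K z P) => a c; nia.
have := ddim_eff_le e0 Dn; move: (ddim _) => D h1 h2.
by have -> : 2 = n%:Z by nia.
Qed.

(* Castelnuovo's inequality for the compositum of [K(x)] and [K(z)]. *)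
Lemma LL_rational D (n : nat) z : eff D -> hasdeg d D n%:Z -> (n <= g)%N -> LL v D z ->
  in_Kx K x z.
Proof.
move=> D0 Dn ng Dz; apply: contrapT => nz.
have [D1 [d1 [D1d H1]]] := genus_eq HK Hb Hfull Hg g_gt0.
(* Large enough for L(M G - D1) to contain some u != 0; then M G + D + div(u) >= D1, where the
   dimension is known exactly. *)
pose M := (`|d1| + g)%N.
have MGd : hasdeg d (fun P => M%:Z * G P) (M%:Z * 2) by apply: hasdegZ deg_polar_x.
have MG1 := hasdegB MGd D1d.
have dimpos : (0 < ddim (fun P => M%:Z * G P - D1 P : int)%R)%N.
  have := genus_le Hg g_gt0 MG1; move: (ddim _) => k; rewrite /M; lia.
have [|u Lu /eqP u0] := card_gt1_ex 0 (finLL MG1).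
  by rewrite (ddim_card HK (finLL MG1)) -(expn0 q) ltn_exp2l ?(q_gt1 HK).
have En : hasdeg d (fun P => M%:Z * G P + D P) (M%:Z * 2 + n%:Z) := hasdegD MGd Dn.
have := card_irrational nz D0 Dz En.
have E1n : hasdeg d (fun P => M%:Z * G P + D P + v P u) (M%:Z * 2 + n%:Z).
  by rewrite -[X in hasdeg _ _ X]addr0; apply: hasdegD En (principalF HK Hfull Hg g_gt0 Hb u0).
have dim1 := H1 _ _ _ E1n.
have -> : ddim (fun P => M%:Z * G P + D P : int) = ddim (fun P => M%:Z * G P + D P + v P u : int).
  apply/eqP; rewrite -(eqn_exp2l _ _ (q_gt1 HK)) -(ddim_card HK (finLL En)) -(ddim_card HK (finLL E1n)).
  by have [_ ->] := card_LL_shift (@plM F K) u0 (finLL En).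
(* The exact dimension 2 M + n + 1 - g is at most 2 M + 1 because n <= g, against the lower bound 2
   (M + 1). *)
have := dim1 _; move: (ddim _) => k H; suff : k%:Z = M%:Z * 2 + n%:Z + 1 - g%:Z by lia.
apply: H => P; case: Lu => [/eqP|/(_ P)]; first by rewrite (negPf u0).
by have := D0 P; move: (D P) (G P) (D1 P) (v P u) => a c e w; lia.
Qed.

(** At a pole of [x] the leading term dominates, nonzero constants having valuation 0. *)
Lemma val_poly_pole P (p : {poly F}) : Kpoly K p -> p != 0 -> v P x < 0 ->
  v P p.[x] = (size p).-1%:Z * v P x.
Proof.
move=> pK p0 vx; rewrite horner_coef.
have sp : (0 < size p)%N by rewrite size_poly_gt0.
rewrite -(prednK sp) big_ord_recr /= addrC.
have lp0 : p`_(size p).-1 != 0 by rewrite -/(lead_coef p) lead_coef_eq0.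
have t0 : p`_(size p).-1 * x ^+ (size p).-1 != 0 by rewrite mulf_neq0 ?expf_neq0 ?x0.
have vt : v P (p`_(size p).-1 * x ^+ (size p).-1) = (size p).-1%:Z * v P x.
  by rewrite plM ?expf_neq0 ?x0 // plK // add0r (valX (plM P)) ?x0.
rewrite -[RHS]vt; case: (val_add_dom (plM P) (plD P) t0 (y := \sum_(i < (size p).-1) p`_i * x ^+ i)) => //.
apply: (vge_sum (plD P)) => i _; apply: vgeKM => //; right.
rewrite vt (valX (plM P)) ?x0 //; have := ltn_ord i.
move: (nat_of_ord i) => j; move: (v P x) vx => w vx ltj; clear - vx ltj; move: (size p).-1 ltj => k ltj; nia.
Qed.

Lemma ex_pole : exists P, v P x < 0.
Proof.
apply: contrapT => no; have /hasdegE[s [_ _ /eqP]] := deg_polar_x.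
rewrite big1 // => P _; rewrite /polar max_l ?mul0r // oppr_le0 leNgt; apply/negP => vx.
by apply: no; exists P.
Qed.

(** At each place [G] is the maximum of 0 and - v(x), so the condition for D - G is the conjunction
    of two conditions for D. *)
Lemma LL_subG D f : LL v (fun P => D P - G P) f <-> LL v D f /\ LL v D (x * f).
Proof.
have [->|f0] := eqVneq f 0; first by rewrite mulr0; split=> [_|_]; [split | ]; left.
have E (D' : divisor K) y : y != 0 -> LL v D' y <-> forall P, - D' P <= v P y.
  by move=> y0; split=> [[/eqP|//]|]; [rewrite (negPf y0) | right].
rewrite !E ?mulf_neq0 ?x0 //; split=> [H|[H1 H2] P].
  by split=> P; have := H P; rewrite ?plM ?x0 // /polar; move: (v P x) => w; lia.
by have := H1 P; have := H2 P; rewrite plM ?x0 // /polar; move: (v P x) => w; lia.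
Qed.

(* L(D) = L(D - G) + K x^J, with J the largest exponent such that x^J is in L(D). *)
Lemma card_LL_subG D (n : nat) : eff D -> hasdeg d D n%:Z -> (n <= g)%N ->
  (cardP (LL v D) = q * cardP (LL v (fun P => (D P - G P)%R)))%N.
Proof.
move=> D0 Dn ng; have [P0 vP0] := ex_pole.
have xX j : x ^+ j != 0 by rewrite expf_neq0 ?x0.
have LLX j : LL v D (x ^+ j) <-> forall P, v P x < 0 -> - D P <= j%:Z * v P x.
  split=> [[/eqP|H P _]|H]; first by rewrite (negPf (xX j)).
    by have := H P; rewrite (valX (plM P)) ?x0.
  right=> P; rewrite (valX (plM P)) ?x0 //; have := H P; have := D0 P.
  by move: (v P x) (D P) => w a; case: ltP; nia.
pose Q j := `[< LL v D (x ^+ j) >].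
have exQ : exists j, Q j by exists 0%N; apply/asboolP; rewrite expr0; apply: (LL1 (@plM F K)).
have leQ j : Q j -> (j <= `|D P0|)%N.
  by move/asboolP/LLX/(_ P0 vP0); have := D0 P0; move: (D P0) (v P0 x) vP0 => a w; nia.
have [J /asboolP xJ Jmax] := ex_maxnP exQ leQ.
have nJ : ~ LL v D (x ^+ J.+1).
  by move=> h; have := Jmax J.+1; rewrite ltnn => /(_ (asboolT h)).
have key f : LL v D f -> exists2 c, c \in K & LL v (fun P => D P - G P) (f - c * x ^+ J).
  move=> Df; have [p [r [/(KpolyP HK) pK /(KpolyP HK) rK rx e]]] := LL_rational D0 Dn ng Df.
  have r0 : r != 0 by apply: contra_neq rx => ->; rewrite horner0.
  have [f0|f0] := eqVneq f 0.
    by exists 0; rewrite ?(memK0 HK) // f0 mul0r subr0; left.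
  have p0 : p != 0.
    by apply/eqP => p0; move/eqP: e; rewrite p0 horner0 mulf_eq0 (negPf f0) (negPf rx).
  have vf (h : {poly F}) y P : Kpoly K h -> h != 0 -> y != 0 -> y * r.[x] = h.[x] -> v P x < 0 ->
      v P y + (size r).-1%:Z * v P x = (size h).-1%:Z * v P x.
    by move=> hK h0 y0 eh vx; rewrite -val_poly_pole // -plM // eh val_poly_pole.
  (* This says deg p - deg r <= J. At the poles of [x], f has the valuation of x^(deg p - deg r); if
     the exponent exceeded [J], that power would lie in L(D) and contradict the maximality of
     [J]. *)
  have sz : (size p <= (size r).-1 + J.+1)%N.
    rewrite leqNgt; apply/negP => lt.
    have /Jmax : Q (size p - size r)%N.
      apply/asboolP/LLX => P vx; have := vf p f P pK p0 f0 e vx.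
      case: Df => [/eqP|/(_ P)]; first by rewrite (negPf f0).
      have sr : (0 < size r)%N by rewrite size_poly_gt0.
      move: (v P f) (v P x) (D P) vx sr lt => w y a; move: (size p) (size r) => m k.
      by move=> vx sr lt h1 h2; have -> : (m - k)%N%:Z * y = m.-1%:Z * y - k.-1%:Z * y; nia.
    have sr : (0 < size r)%N by rewrite size_poly_gt0.
    by move: (size p) (size r) lt sr => m k; lia.
  (* Chosen to cancel the coefficient of degree deg r + J in [p], the highest one possible. The
     difference f - c x^J then has room for one more factor [x] at the poles. *)
  pose c := p`_((size r).-1 + J) / lead_coef r.
  have cK : c \in K by apply: (memKdiv HK); [exact: pK | exact: rK].
  exists c => //; pose p' := p - c%:P * r * 'X^J.
  have p'K : Kpoly K p'.
    apply: (KpolyB HK) => //; apply: (KpolyM HK); last exact/(Kpoly_exp HK)/(KpolyX HK).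
    by apply: (KpolyM HK) => //; apply: (KpolyC HK).
  have e' : (f - c * x ^+ J) * r.[x] = p'.[x].
    by rewrite /p' !hornerE mulrBl e; ring.
  have sp' : (size p' <= (size r).-1 + J)%N.
    apply/leq_sizeP => j lej; rewrite /p' coefB coefMXn.
    rewrite ltnNge (leq_trans (leq_addl _ _) lej) /= coefCM.
    move: lej; rewrite leq_eqVlt => /orP[/eqP <-|ltj].
      by rewrite addnK -/(lead_coef r) divfK ?subrr // lead_coef_eq0.
    rewrite nth_default; last by apply: leq_trans sz _; rewrite addnS.
    rewrite [r`__]nth_default ?mulr0 ?subr0 //.
    by move: ltj; rewrite -ltn_subRL; case: (size r) => [//|k] /=; lia.
  have Df' : LL v D (f - c * x ^+ J).
    apply: (LLB (@plM F K) (@plD F K)) => //.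
    have [_ _ H] := subspace_LL D; exact: H.
  apply/LL_subG; split=> //.
  have [f'0|f'0] := eqVneq (f - c * x ^+ J) 0; first by rewrite f'0 mulr0; left.
  have p'0 : p' != 0.
    by apply/eqP => h; move/eqP: e'; rewrite h horner0 mulf_eq0 (negPf f'0) (negPf rx).
  right=> P; rewrite plM ?x0 //.
  have [vx|vx] := ltP (v P x) 0; last first.
    case: Df' => [/eqP|/(_ P)]; first by rewrite (negPf f'0).
    by move: (v P _) (v P x) vx => w y; lia.
  have := vf p' _ P p'K p'0 f'0 e' vx; move/LLX/(_ P vx): xJ.
  have : (0 < size p')%N by rewrite size_poly_gt0.
  move: (v P _) (v P x) (D P) sp' vx => w y a; move: (size p') (size r) => m k; nia.
have fW : finp (LL v (fun P => D P - G P)) := finLL (hasdegB Dn deg_polar_x).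
have [fK cK] := finK HK; have [fX cX] := finp_prod fK fW.
rewrite -cK -cX; symmetry.
have [_ _ DZ] := subspace_LL D.
apply: (card_bij (f := fun z : F * F => z.2 + z.1 * x ^+ J)) fX.
- move=> [c w] /= [cK' /LL_subG[Dw _]]; apply: (LLD (@plD F K)) => //; exact: DZ.
- move=> [c w] [c' w'] /= [cK' Ww] [cK'' Ww'] e.
  (* Otherwise x^J would lie in L(D - G), hence x^(J+1) in L(D), against the choice of [J]. *)
  have cc : c = c'.
    apply/eqP; rewrite -subr_eq0; apply/negPn/negP => c0; apply: nJ.
    have e1 : (c - c') * x ^+ J = w' - w.
      by apply/eqP; rewrite -subr_eq0 -(subrr (w + c * x ^+ J)) {2}e; apply/eqP; ring.
    have : LL v (fun P => D P - G P) ((c - c') * x ^+ J) by rewrite e1; apply: (LLB (@plM F K) (@plD F K)).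
    case/LL_subG=> _ /(DZ (c - c')^-1); rewrite mulrCA mulKf // -exprS; apply.
    by rewrite (memKV HK) // (memKB HK).
  by move: e; rewrite cc => /addIr ->.
- move=> f /key[c cK' Wf]; exists (c, f - c * x ^+ J) => //=.
  by rewrite subrK.
Qed.

End Hyperelliptic.

(** * Quadratic constant extensions *)

(* [quad H] is R[a] with a^2 = a - nu, the pair (u, w) standing for u + w a. *)
Definition quad (R : fieldType) (nu : R) of (forall a : R, a ^+ 2 - a + nu != 0) : Type := (R * R)%type.

Section QuadraticExtension.
Variables (R : fieldType) (nu : R) (H : forall a : R, a ^+ 2 - a + nu != 0).
Local Notation L := (quad H).

HB.instance Definition _ := GRing.Zmodule.copy L (R * R)%type.

Definition qmul (y z : L) : L := (y.1 * z.1 - nu * (y.2 * z.2), y.1 * z.2 + y.2 * z.1 + y.2 * z.2).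
Definition qone : L := (1, 0).
(** The product of u + w a and its conjugate u + w (1 - a). *)
Definition qnorm (z : L) : R := z.1 ^+ 2 + z.1 * z.2 + nu * z.2 ^+ 2.
Definition qinv (z : L) : L := ((z.1 + z.2) / qnorm z, - z.2 / qnorm z).

(** For w != 0, a zero norm would make - u / w a root of the irreducible polynomial. *)
Lemma qnorm_eq0 (z : L) : (qnorm z == 0) = (z == 0).
Proof.
apply/eqP/eqP => [|->]; last by rewrite /qnorm /=; ring.
case: z => u w; rewrite /qnorm /=; have [->|w0] := eqVneq w 0.
  by move/eqP; rewrite expr0n /= !mulr0 !addr0 expf_eq0 /= => /eqP ->.
move=> e; have /eqP[] := H (- u / w).
by apply: (mulfI (expf_neq0 2 w0)); rewrite mulr0 -e; field.
Qed.

Fact qmulA : associative qmul.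
Proof. by case=> a a' [c c'] [e e']; congr (_, _); rewrite /=; ring. Qed.
Fact qmulC : commutative qmul.
Proof. by case=> a a' [c c']; congr (_, _); rewrite /=; ring. Qed.
Fact qmul1 : left_id qone qmul.
Proof. by case=> a a'; congr (_, _); rewrite /=; ring. Qed.
Fact qmulD : left_distributive qmul +%R.
Proof. by case=> a a' [c c'] [e e']; congr (_, _); rewrite /=; ring. Qed.
Fact qone_neq0 : qone != 0.
Proof. by rewrite xpair_eqE oner_eq0. Qed.

HB.instance Definition _ := GRing.Zmodule_isComNzRing.Build L qmulA qmulC qmul1 qmulD qone_neq0.

Fact qmulV (z : L) : z != 0 -> qmul (qinv z) z = qone.
Proof.
rewrite -qnorm_eq0 /qmul /qinv /qone; case: z => a a'; rewrite /qnorm /= => N0.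
by congr (_, _); field.
Qed.
Fact qinv0 : qinv 0 = 0.
Proof. by congr (_, _); rewrite /= ?addr0 ?oppr0 mul0r. Qed.

HB.instance Definition _ := GRing.ComNzRing_isField.Build L qmulV qinv0.

Definition qin (a : R) : L := (a, 0).
Definition qgen : L := (0, 1).

Lemma qinM a c : qin (a * c) = qin a * qin c.
Proof. by congr (_, _); rewrite /=; ring. Qed.
Lemma qinX a n : qin (a ^+ n) = qin a ^+ n.
Proof. by elim: n => [|n IHn]; rewrite ?expr0 // !exprS qinM IHn. Qed.
Lemma qinD a c : qin (a + c) = qin a + qin c.
Proof. by congr (_, _); rewrite /= ?addr0. Qed.
Lemma qin_inj : injective qin. Proof. by move=> a c []. Qed.
Lemma qin_nat n : qin n%:R = n%:R.
Proof. by elim: n => // n IHn; rewrite -!natr1 qinD IHn. Qed.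
Lemma qgenE : qgen ^+ 2 + qin nu = qgen.
Proof. by congr (_, _); rewrite /=; ring. Qed.

End QuadraticExtension.

(* Otherwise the root [al] in the quadratic extension is fixed by x -> x^(q^2),
   giving X^|k| - X more than |k| roots. *)
Lemma finField_quadratic_root (k : finFieldType) (nu : k) (q e : nat) :
  #|k| = (q ^ (e * 2))%N -> nu ^+ q = nu -> exists a : k, a ^+ 2 - a + nu = 0.
Proof.
move=> ck nuq; apply: contrapT => no.
have H (a : k) : a ^+ 2 - a + nu != 0 by apply/eqP => h; apply: no; exists a.
pose al : quad H := qgen H.
(* The number [q] is a power of the characteristic because |k| is a power of [q]; hence y -> y^q is
   additive on the extension. *)
have qp : [pchar (quad H)].-nat q.
  pose p := pdiv #|[set: k]|.
  have pp : prime p by rewrite /p pdiv_prime // cardsT finNzRing_gt1.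
  have ab : p.-abelem%g [set: k] := finField_is_abelem k.
  have pnk : p.-nat #|k| by rewrite -cardsT; apply: abelem_pgroup ab.
  have [n cp] := p_natP pnk; have pk := card_finPcharP cp pp.
  have pL : p \in [pchar (quad H)].
    by apply/andP; split=> //; rewrite -qin_nat (pcharf0 pk).
  rewrite (eq_pnat _ (pcharf_eq pL)).
  move: pnk; rewrite ck pnatX => /orP[//|/eqP e0]; move: (finNzRing_gt1 k).
  by rewrite ck e0 expn0.
have fr (y z : quad H) : (y + z) ^+ q = y ^+ q + z ^+ q by apply: GRing.exprDn_pchar.
have nuL : (qin H nu) ^+ q = qin H nu by rewrite -qinX nuq.
have al2 : al ^+ 2 + qin H nu = al := qgenE H.
have be2 : (al ^+ q) ^+ 2 + qin H nu = al ^+ q.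
  by rewrite -{2}al2 fr nuL -!exprM mulnC.
have alqq : al ^+ (q ^ 2) = al.
  rewrite -mulnn exprM; have [e1|ne] := eqVneq (al ^+ q) al; first by rewrite !e1.
  (* If al^q differs from [al] it is the other root of X^2 - X + nu, and the roots sum to 1. Raising
     this to the power q shows that al^(q^2) = al. *)
  have s1 : al ^+ q + al = 1.
    have : (al ^+ q - al) * (al ^+ q + al - 1) = 0.
      rewrite (_ : _ * _ = ((al ^+ q) ^+ 2 + qin H nu - al ^+ q) - (al ^+ 2 + qin H nu - al)); last by ring.
      by rewrite be2 al2 !subrr.
    by move/eqP; rewrite mulf_eq0 !subr_eq0 (negPf ne) => /eqP.
  have : (al ^+ q + al) ^+ q = 1 by rewrite s1 expr1n.
  by rewrite fr -s1 addrC => /addrI.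
have alQ : al ^+ #|k| = al.
  rewrite ck mulnC expnM; elim: (e) => [|n IHn]; first by rewrite expn0 expr1.
  by rewrite expnS exprM alqq.
pose p : {poly quad H} := 'X^#|k| - 'X.
have sp : size p = #|k|.+1.
  by rewrite size_polyDl size_polyXn // size_polyN size_polyX ltnS finNzRing_gt1.
have := @max_poly_roots _ p (al :: [seq qin H a | a <- enum k]).
rewrite /= sp size_map -cardE ltnn => no_roots; suff: false by []; apply: no_roots.
- by rewrite -size_poly_gt0 sp.
- rewrite rootE !hornerE alQ subrr eqxx /=; apply/allP => _ /mapP[a _ ->].
  by rewrite rootE !hornerE -qinX expf_card subrr.
rewrite map_inj_uniq ?enum_uniq ?andbT; last exact: qin_inj.
by apply/mapP => -[a _ []] _ /eqP; rewrite oner_eq0.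
Qed.

(* Instantiated both with the local ring of a place and with [K] itself (and zero
   maximal ideal), to use the library's theory of finite fields. *)
Record locfin (F : fieldType) := LocFin {
  loc_ring : F -> Prop;
  loc_max : F -> Prop;
  loc_reps : seq F;
  loc_ring1 : loc_ring 1;
  loc_ringB : forall y z, loc_ring y -> loc_ring z -> loc_ring (y - z);
  loc_ringM : forall y z, loc_ring y -> loc_ring z -> loc_ring (y * z);
  loc_maxB : forall y z, loc_max y -> loc_max z -> loc_max (y - z);
  loc_maxM : forall y z, loc_max y -> loc_ring z -> loc_max (y * z);
  loc_max1 : ~ loc_max 1;
  loc_max0 : loc_max 0;
  loc_ringV : forall y, loc_ring y -> ~ loc_max y -> loc_ring y^-1;
  loc_reps_ring : forall y, y \in loc_reps -> loc_ring y;
  loc_reps_inj : forall y z, y \in loc_reps -> z \in loc_reps -> loc_max (y - z) -> y = z;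
  loc_reps_cov : forall y, loc_ring y -> exists2 z, z \in loc_reps & loc_max (y - z) }.

Definition resfield (F : fieldType) (A : locfin F) : Type := seq_sub (loc_reps A).

(** * The field structure on a finite set of representatives of a local ring *)

Section ResidueField.
Variables (F : fieldType) (A : locfin F).
Local Notation k := (resfield A).
Local Notation O := (loc_ring A).
Local Notation m := (loc_max A).

HB.instance Definition _ := Finite.copy k (seq_sub (loc_reps A)).

Fact res_subproof y : exists z : k, O y -> m (y - ssval z).
Proof.
have [z0 z0s _] := loc_reps_cov (loc_ring1 A).
have [Oy|nO] := pselect (O y); last by exists (SeqSub z0s).
by have [z zs yz] := loc_reps_cov Oy; exists (SeqSub zs).
Qed.
Definition res (y : F) : k := projT1 (boolp.choice res_subproof) y.

Lemma resP y : O y -> m (y - ssval (res y)).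
Proof. by rewrite /res; case: boolp.choice => f /=; apply. Qed.

Lemma maxN y : m y -> m (- y).
Proof. by move=> my; rewrite -sub0r; apply: loc_maxB (loc_max0 A) my. Qed.
Lemma maxD y z : m y -> m z -> m (y + z).
Proof. by move=> my mz; rewrite -[z]opprK; apply: loc_maxB my (maxN mz). Qed.
Lemma ring_val (a : k) : O (ssval a). Proof. exact: loc_reps_ring (ssvalP a). Qed.
Lemma ring0 : O 0.
Proof. by rewrite -(subrr 1); apply: loc_ringB; apply: loc_ring1. Qed.
Lemma ringN y : O y -> O (- y).
Proof. by move=> Oy; rewrite -sub0r; apply: loc_ringB Oy; apply: ring0. Qed.
Lemma ringD y z : O y -> O z -> O (y + z).
Proof. by move=> Oy Oz; rewrite -[z]opprK; apply: loc_ringB => //; apply: ringN. Qed.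

Lemma res_eq y z : O y -> O z -> res y = res z <-> m (y - z).
Proof.
move=> Oy Oz; split=> [e|myz].
  rewrite -(subrK (ssval (res y)) y) -addrA; apply: maxD; first exact: resP.
  by rewrite e -opprB; apply: maxN; apply: resP.
apply: val_inj; apply: (loc_reps_inj (ssvalP _) (ssvalP _)).
have -> : ssval (res y) - ssval (res z) = (y - z) - (y - ssval (res y)) + (z - ssval (res z)) by ring.
by apply: maxD; [apply: loc_maxB => //; apply: resP | apply: resP].
Qed.

Lemma resK (a : k) : res (ssval a) = a.
Proof.
apply: val_inj; apply: (loc_reps_inj (ssvalP _) (ssvalP _)).
by rewrite -opprB; apply: maxN; apply: resP; apply: ring_val.
Qed.

Definition kadd (a c : k) : k := res (ssval a + ssval c).
Definition kopp (a : k) : k := res (- ssval a).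
Definition kmul (a c : k) : k := res (ssval a * ssval c).
Definition kinv (a : k) : k := if a == res 0 then a else res (ssval a)^-1.

Lemma kaddE y z : O y -> O z -> kadd (res y) (res z) = res (y + z).
Proof.
move=> Oy Oz; apply/res_eq; [by apply: ringD; apply: ring_val | exact: ringD |].
rewrite (_ : _ - _ = - ((y - ssval (res y)) + (z - ssval (res z)))); last by ring.
by apply/maxN/maxD; apply: resP.
Qed.
Lemma koppE y : O y -> kopp (res y) = res (- y).
Proof.
move=> Oy; apply/res_eq; [by apply: ringN; apply: ring_val | exact: ringN |].
rewrite (_ : _ - _ = y - ssval (res y)); last by ring.
exact: resP.
Qed.
Lemma kmulE y z : O y -> O z -> kmul (res y) (res z) = res (y * z).
Proof.
move=> Oy Oz; apply/res_eq; [by apply: loc_ringM; apply: ring_val | exact: loc_ringM |].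
rewrite (_ : _ - _ = - ((y - ssval (res y)) * z + (z - ssval (res z)) * ssval (res y))); last by ring.
by apply/maxN/maxD; apply: loc_maxM => //; try apply: resP => //; apply: ring_val.
Qed.

(** Replaces a residue class by the class of an arbitrary ring element, so that each field law on
    [k] reduces to the one in F. *)
Local Ltac lift a := rewrite -(resK a); move: (ssval a) (ring_val a) => {}a ?.
Local Ltac ringmem := by repeat first [assumption | apply: ringD | apply: ringN | apply: loc_ringM
  | apply: ring0 | apply: loc_ring1].

Fact kaddA : associative kadd.
Proof. by move=> a c e; lift a; lift c; lift e; rewrite !kaddE ?addrA //; ringmem. Qed.
Fact kaddC : commutative kadd.
Proof. by move=> a c; rewrite /kadd addrC. Qed.
Fact kadd0 : left_id (res 0) kadd.
Proof. by move=> a; lift a; rewrite kaddE ?add0r //; ringmem. Qed.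
Fact kaddN : left_inverse (res 0) kopp kadd.
Proof. by move=> a; lift a; rewrite koppE // kaddE ?addNr //; ringmem. Qed.

HB.instance Definition _ := GRing.isZmodule.Build k kaddA kaddC kadd0 kaddN.

Fact kmulA : associative kmul.
Proof. by move=> a c e; lift a; lift c; lift e; rewrite !kmulE ?mulrA //; ringmem. Qed.
Fact kmulC : commutative kmul.
Proof. by move=> a c; rewrite /kmul mulrC. Qed.
Fact kmul1 : left_id (res 1) kmul.
Proof. by move=> a; lift a; rewrite kmulE ?mul1r //; ringmem. Qed.
Fact kmulD : left_distributive kmul +%R.
Proof.
move=> a c e; change (kmul (kadd a c) e = kadd (kmul a e) (kmul c e)).
by lift a; lift c; lift e; rewrite !(kaddE, kmulE) ?mulrDl //; ringmem.
Qed.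
Fact k1_neq0 : res 1 != 0.
Proof.
apply/eqP => /(res_eq (loc_ring1 A) ring0); rewrite subr0; exact: loc_max1.
Qed.

HB.instance Definition _ := GRing.Zmodule_isComNzRing.Build k kmulA kmulC kmul1 kmulD k1_neq0.

Fact kmulV (a : k) : a != 0 -> kmul (kinv a) a = 1.
Proof.
move=> a0; rewrite /kinv ifN //; have nm : ~ m (ssval a).
  move=> ma; move/eqP: a0; apply; rewrite -[a]resK; apply/res_eq; rewrite ?subr0 //.
    exact: ring_val.
  exact: ring0.
rewrite -[X in kmul _ X]resK kmulE ?mulVf //; last exact: ring_val.
  by apply/eqP => h; apply: nm; rewrite h; apply: loc_max0.
by apply: loc_ringV => //; apply: ring_val.
Qed.
Fact kinv0 : kinv 0 = 0.
Proof. by rewrite /kinv eqxx. Qed.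

HB.instance Definition _ := GRing.ComNzRing_isField.Build k kmulV kinv0.

Lemma resD y z : O y -> O z -> res (y + z) = res y + res z.
Proof. by move=> Oy Oz; rewrite -kaddE. Qed.
Lemma resM y z : O y -> O z -> res (y * z) = res y * res z.
Proof. by move=> Oy Oz; rewrite -kmulE. Qed.
Lemma resN y : O y -> res (- y) = - res y.
Proof. by move=> Oy; rewrite -koppE. Qed.
Lemma ringX y n : O y -> O (y ^+ n).
Proof.
move=> Oy; elim: n => [|n IHn]; rewrite ?expr0 ?exprS; first exact: loc_ring1.
exact: loc_ringM.
Qed.
Lemma resX y n : O y -> res (y ^+ n) = res y ^+ n.
Proof.
move=> Oy; elim: n => [|n IHn]; rewrite ?expr0 // !exprS resM // ?IHn //.
exact: ringX.
Qed.

End ResidueField.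

(** * Extending a valuation to the quadratic extension when its polynomial has a root in the
    completion *)

Section SplitValuation.
Variables (F : fieldType) (nu : F) (H : forall a : F, a ^+ 2 - a + nu != 0) (w : F -> int).
Hypothesis wM : forall y z : F, y != 0 -> z != 0 -> w (y * z) = w y + w z.
Hypothesis wD : forall y z : F, y != 0 -> z != 0 -> y + z != 0 -> Num.min (w y) (w z) <= w (y + z).
Local Notation L := (quad H).
Implicit Types z y : L.

(** A root in the completion, given by approximations: [r n] is a root to precision n + 1, and
    consecutive terms agree to that precision. *)
Definition root_seq (r : nat -> F) : Prop := forall n,
  [/\ vge w 0 (r n), vge w (n.+1)%:Z (r n ^+ 2 - r n + nu) & vge w (n.+1)%:Z (r n.+1 - r n)].

Lemma ex_vge (a : F) : exists c : nat, vge w (- c%:Z) a.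
Proof. by exists `|w a|%N; right; lia. Qed.

Lemma root_seqC r : root_seq r -> root_seq (fun n => 1 - r n).
Proof.
move=> rP n; have [h0 h1 h2] := rP n; split.
- by apply: (vgeB wM wD) => //; right; rewrite (val1 wM).
- by rewrite (_ : _ + _ = r n ^+ 2 - r n + nu); last by ring.
- by rewrite (_ : _ - _ = - (r n.+1 - r n)); [apply/(vgeN wM) | ring].
Qed.

Section Sequence.
Variable r : nat -> F.
Hypothesis rP : root_seq r.

Definition ev n z : F := z.1 + r n * z.2.

Lemma ev_step z c n k : vge w (- c) z.2 -> vge w ((n.+1)%:Z - c) (ev (n + k) z - ev n z).
Proof.
move=> zc; elim: k => [|k IHk]; first by rewrite addn0 subrr; apply: vge0.
rewrite addnS (_ : _ - _ = (r (n + k).+1 - r (n + k)) * z.2 + (ev (n + k) z - ev n z)); last first.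
  by rewrite /ev; ring.
apply: (vgeD wD) => //; have [_ _ h] := rP (n + k).
by apply: vge_le (vgeM wM h zc); lia.
Qed.

(** The two conjugate evaluations multiply to the norm up to the defect of [r n] as a root, which
    tends to 0. *)
Lemma ev_norm z n : ev n z * (z.1 + (1 - r n) * z.2) =
  qnorm z - (r n ^+ 2 - r n + nu) * z.2 ^+ 2.
Proof. by rewrite /ev /qnorm; ring. Qed.

(** Either some value is larger than the error of approximation, and later terms keep its valuation;
    or the evaluations tend to 0, and the norm of [z], being nearly a multiple of them, would
    vanish. *)
Lemma ev_stable z : z != 0 -> exists m, exists n0, forall n, (n0 <= n)%N -> ev n z != 0 /\ w (ev n z) = m.
Proof.
move=> z0; have [c [h1 h2]] : exists c : nat, vge w (- c%:Z) z.1 /\ vge w (- c%:Z) z.2.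
  have [c1 h1] := ex_vge z.1; have [c2 h2] := ex_vge z.2; exists (c1 + c2)%N.
  by split; [apply: vge_le h1; lia | apply: vge_le h2; lia].
have [[n0 [e0 lt]]|no] := pselect (exists n, ev n z != 0 /\ w (ev n z) < (n.+1)%:Z - c%:Z).
  exists (w (ev n0 z)), n0 => n le; rewrite -(subnKC le).
  have h := ev_step n0 (n - n0) h2.
  rewrite -(subrK (ev n0 z) (ev (n0 + _) z)) addrC; apply: (val_add_dom wM wD e0).
  by apply: vge_le h; lia.
have big n : vge w ((n.+1)%:Z - c%:Z) (ev n z).
  have [->|e0] := eqVneq (ev n z) 0; first exact: vge0.
  by right; rewrite leNgt; apply/negP => lt; apply: no; exists n.
have N0 : qnorm z != 0 by rewrite qnorm_eq0.
have [m wm] : exists m, w (qnorm z) = m by exists (w (qnorm z)).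
(* Large enough for both terms of the norm, whose denominators cost at most 2 c, to have valuation
   above [m]. *)
have [n nE] : exists n, n = (`|m| + 3 * c)%N by exists (`|m| + 3 * c)%N.
have [hr hmu _] := rP n.
have : vge w (m + 1) (qnorm z).
  have -> : qnorm z = ev n z * (z.1 + (1 - r n) * z.2) + (r n ^+ 2 - r n + nu) * z.2 ^+ 2.
    by rewrite ev_norm subrK.
  apply: (vgeD wD).
    apply: (@vge_le _ _ _ ((n.+1)%:Z - c%:Z + - c%:Z)); first by lia.
    apply: (vgeM wM) => //; apply: (vgeD wD) => //; rewrite -[- c%:Z]add0r.
    apply: (vgeM wM) => //; apply: (vgeB wM wD) => //; by right; rewrite (val1 wM).
  apply: (@vge_le _ _ _ ((n.+1)%:Z + (- c%:Z + - c%:Z))); first by lia.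
  by apply: (vgeM wM) => //; rewrite expr2; apply: (vgeM wM).
by move/(vgeE _ _ N0); rewrite wm; lia.
Qed.

(** The valuation of the image of [z] in the completion, under the embedding that sends the
    generator to the limit of [r]. *)
Definition wq z : int := the 0 (fun m => exists n0, forall n, (n0 <= n)%N -> ev n z != 0 /\ w (ev n z) = m).

Lemma wqE z m n0 : (forall n, (n0 <= n)%N -> ev n z != 0 /\ w (ev n z) = m) -> wq z = m.
Proof.
move=> h; apply: theP; first by exists n0.
move=> m' [n1 h']; have [_ <-] := h (maxn n0 n1) (leq_maxl _ _).
by have [_ ->] := h' (maxn n0 n1) (leq_maxr _ _).
Qed.

Lemma wqP z : z != 0 -> exists n0, forall n, (n0 <= n)%N -> ev n z != 0 /\ w (ev n z) = wq z.
Proof. by move=> z0; have [m [n0 h]] := ev_stable z0; exists n0; rewrite (wqE h). Qed.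

(** Evaluation at [r n] is multiplicative only up to (r_n^2 - r_n + nu) y_2 z_2, so n is taken
    beyond the point where this error is dominated by the product. *)
Lemma wqM y z : y != 0 -> z != 0 -> wq (y * z) = wq y + wq z.
Proof.
move=> y0 z0; have [n1 h1] := wqP y0; have [n2 h2] := wqP z0.
have [c1 g1] := ex_vge y.2; have [c2 g2] := ex_vge z.2.
have [a aE] : exists a, wq y + wq z = a by exists (wq y + wq z).
have [n0 n0E] : exists n0, n0 = (n1 + n2 + `|a| + c1 + c2)%N by exists (n1 + n2 + `|a| + c1 + c2)%N.
apply: (wqE (n0 := n0)) => n le.
have [ey <-] := h1 n ltac:(lia); have [ez <-] := h2 n ltac:(lia).
have -> : ev n (y * z) = ev n y * ev n z + (- ((r n ^+ 2 - r n + nu) * (y.2 * z.2))).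
  have -> : y * z = (y.1 * z.1 - nu * (y.2 * z.2), y.1 * z.2 + y.2 * z.1 + y.2 * z.2) by [].
  by rewrite /ev /=; ring.
have e0 : ev n y * ev n z != 0 by rewrite mulf_neq0.
rewrite -wM //; apply: (val_add_dom wM wD e0); apply/(vgeN wM).
have [_ hmu _] := rP n.
apply: (@vge_le _ _ _ ((n.+1)%:Z + (- c1%:Z + - c2%:Z))); last by do 2! [apply: (vgeM wM) => //].
rewrite wM //; have [_ ->] := h1 n ltac:(lia); have [_ ->] := h2 n ltac:(lia).
by rewrite aE; lia.
Qed.

Lemma evD n y z : ev n (y + z) = ev n y + ev n z.
Proof. by rewrite /ev /=; ring. Qed.

Lemma wqD y z : y != 0 -> z != 0 -> y + z != 0 -> Num.min (wq y) (wq z) <= wq (y + z).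
Proof.
move=> y0 z0 yz0; have [n1 h1] := wqP y0; have [n2 h2] := wqP z0; have [n3 h3] := wqP yz0.
have [e1 <-] := h1 (n1 + n2 + n3)%N ltac:(lia); have [e2 <-] := h2 (n1 + n2 + n3)%N ltac:(lia).
have [e3 <-] := h3 (n1 + n2 + n3)%N ltac:(lia).
by rewrite evD in e3 *; apply: wD.
Qed.

Lemma wq_in a : a != 0 -> wq (qin H a) = w a.
Proof. by move=> a0; apply: (wqE (n0 := 0)) => n _; rewrite /ev /= mulr0 addr0. Qed.

Lemma vge_ev m z n : vge w 0 (r n) -> vge w m z.1 -> vge w m z.2 -> vge w m (ev n z).
Proof.
by move=> r0 h1 h2; apply: (vgeD wD) => //; rewrite -[m]add0r; apply: (vgeM wM).
Qed.

Lemma vge_wq m z : vge w m z.1 -> vge w m z.2 -> vge wq m z.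
Proof.
move=> h1 h2; have [->|z0] := eqVneq z 0; first exact: vge0.
have [n0 h] := wqP z0; right; have [e0 <-] := h n0 (leqnn _); apply/(vgeE _ _ e0).
by have [h0 _ _] := rP n0; apply: vge_ev.
Qed.

Lemma vge_wq_ev m z : vge wq m z -> exists n0, forall n, (n0 <= n)%N -> vge w m (ev n z).
Proof.
have [->|z0] := eqVneq z 0; first by exists 0%N => n _; left; rewrite /ev /= mulr0 addr0.
move/(vgeE _ _ z0) => h; have [n0 hn] := wqP z0; exists n0 => n le; right.
by have [_ ->] := hn n le.
Qed.

Lemma vge_ev_wq m z n0 : (forall n, (n0 <= n)%N -> vge w m (ev n z)) -> vge wq m z.
Proof.
move=> h; have [->|z0] := eqVneq z 0; first exact: vge0.
have [n1 hn] := wqP z0; right; have [e0 <-] := hn _ (leq_maxr n0 n1).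
by apply/(vgeE _ _ e0)/h/leq_maxl.
Qed.

(** The residue field does not grow: every integral [z] is congruent to its evaluation in F at a
    sufficiently late index. *)
Lemma wq_residues (s : seq F) :
  (forall a, vge w 0 a -> exists2 c, c \in s & vge w 1 (a - c)) ->
  exists s' : seq L, (size s' <= size s)%N /\
    forall z, vge wq 0 z -> exists2 y, y \in s' & vge wq 1 (z - y).
Proof.
move=> cov.
have hr z : exists c, vge wq 0 z -> c \in s /\ vge wq 1 (z - qin H c).
  have [z0|no] := pselect (vge wq 0 z); last by exists 0.
  have [n1 h1] := vge_wq_ev z0; have [c2 h2] := ex_vge z.2.
  have [n0 n0E] : exists n0, n0 = (n1 + c2)%N by exists (n1 + c2)%N.
  have [c cs hc] := cov _ (h1 n0 ltac:(lia)).
  exists c => _; split=> //; apply: (@vge_ev_wq _ _ n0) => n le.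
  have -> : ev n (z - qin H c) = (ev n0 z - c) + (ev (n0 + (n - n0)) z - ev n0 z).
    by rewrite subnKC // /ev /= subr0; ring.
  apply: (vgeD wD) => //; apply: vge_le (ev_step n0 (n - n0) h2); lia.
exists (map (qin H) s); rewrite size_map; split=> // z z0.
have [c hc] := hr z; have [cs hz] := hc z0.
by exists (qin H c) => //; apply: map_f.
Qed.

End Sequence.

Lemma wq_norm r z : root_seq r -> z != 0 ->
  wq r z + wq (fun n => 1 - r n) z = w (qnorm z).
Proof.
move=> rP z0; have [n1 h1] := wqP rP z0; have [n2 h2] := wqP (root_seqC rP) z0.
have N0 : qnorm z != 0 by rewrite qnorm_eq0.
have [c g] := ex_vge z.2.
have [m mE] : exists m, w (qnorm z) = m by exists (w (qnorm z)).
have [n nE] : exists n, n = (n1 + n2 + `|m| + c + c)%N by exists (n1 + n2 + `|m| + c + c)%N.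
have [e1 <-] := h1 n ltac:(lia); have [e2 <-] := h2 n ltac:(lia).
have dom : vge w (w (qnorm z) + 1) (- ((r n ^+ 2 - r n + nu) * z.2 ^+ 2)).
  have [_ hmu _] := rP n; apply/(vgeN wM).
  apply: (@vge_le _ _ _ ((n.+1)%:Z + (- c%:Z + - c%:Z))); first by rewrite mE; lia.
  by apply: (vgeM wM) => //; rewrite expr2; apply: (vgeM wM).
by have [_ <-] := val_add_dom wM wD N0 dom; rewrite -wM // -ev_norm.
Qed.

(* The two extensions together detect integrality of both coordinates, because
   (2a - 1)^2 = 1 - 4 nu is a unit. *)
Lemma wq_integral r z : root_seq r -> 1 - 4%:R * nu != 0 -> w (1 - 4%:R * nu) = 0 ->
  vge (wq r) 0 z -> vge (wq (fun n => 1 - r n)) 0 z -> vge w 0 z.1 /\ vge w 0 z.2.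
Proof.
move=> rP d0 wd /(vge_wq_ev rP)[n1 h1] /(vge_wq_ev (root_seqC rP))[n2 h2].
have {h1} e1 := h1 (n1 + n2)%N (leq_addr _ _); have {h2} e2 := h2 (n1 + n2)%N (leq_addl _ _).
move: (n1 + n2)%N e1 e2 => n e1 e2; have [hr hmu _] := rP n.
have h4 : vge w 0 4%:R.
  have h1 : vge w 0 1 by right; rewrite (val1 wM).
  by rewrite (_ : 4%:R = 1 + 1 + 1 + 1); [do 3! [apply: (vgeD wD) => //] | ring].
have sq : (2%:R * r n - 1) ^+ 2 = (1 - 4%:R * nu) + 4%:R * (r n ^+ 2 - r n + nu) by ring.
have [s0 ws] : (2%:R * r n - 1) ^+ 2 != 0 /\ w ((2%:R * r n - 1) ^+ 2) = 0.
  rewrite sq -wd; apply: (val_add_dom wM wD d0); rewrite wd.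
  by apply: (@vge_le _ _ _ (0 + (n.+1)%:Z)); [lia | apply: (vgeM wM)].
have t0 : 2%:R * r n - 1 != 0 by move: s0; rewrite expf_eq0.
have wt : w (2%:R * r n - 1) = 0 by move: ws; rewrite (valX wM) //; lia.
have hz2 : vge w 0 z.2.
  have -> : z.2 = (2%:R * r n - 1)^-1 * (ev r n z - ev (fun n => 1 - r n) n z).
    by rewrite (_ : ev r n z - _ = (2%:R * r n - 1) * z.2) ?mulKf // /ev; ring.
  rewrite -[0]addr0; apply: (vgeM wM); first by right; rewrite (valV wM) // wt oppr0.
  exact: (vgeB wM wD).
split=> //; have -> : z.1 = ev r n z - r n * z.2 by rewrite /ev addrK.
by apply: (vgeB wM wD) => //; rewrite -[0]addr0; apply: (vgeM wM).
Qed.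

Definition newton (a : F) : F := a - (a ^+ 2 - a + nu) / (2%:R * a - 1).

(** The derivative 2 a - 1 is a unit because its square is 1 - 4 nu plus four times the value at
    [a]. After a Newton step the value is the square of the correction; of this quadratic gain one
    unit of precision per step is kept. *)
Lemma hensel a0 : 1 - 4%:R * nu != 0 -> w (1 - 4%:R * nu) = 0 ->
  vge w 0 a0 -> vge w 1 (a0 ^+ 2 - a0 + nu) ->
  root_seq (fun n => iter n newton a0).
Proof.
move=> d0 wd ha0 hmu0; set f := newton.
have h1 : vge w 0 1 by right; rewrite (val1 wM).
have h4 : vge w 0 4%:R.
  by rewrite (_ : 4%:R = 1 + 1 + 1 + 1); [do 3! [apply: (vgeD wD) => //] | ring].
have step a (n : nat) : vge w 0 a -> vge w (n.+1)%:Z (a ^+ 2 - a + nu) ->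
    [/\ vge w (n.+1)%:Z (f a - a), vge w 0 (f a) & vge w (n.+2)%:Z (f a ^+ 2 - f a + nu)].
  move=> ha hmu; have sq : (2%:R * a - 1) ^+ 2 = (1 - 4%:R * nu) + 4%:R * (a ^+ 2 - a + nu) by ring.
  have [s0 ws] : (2%:R * a - 1) ^+ 2 != 0 /\ w ((2%:R * a - 1) ^+ 2) = 0.
    rewrite sq -wd; apply: (val_add_dom wM wD d0); rewrite wd.
    by apply: (@vge_le _ _ _ (0 + (n.+1)%:Z)); [lia | apply: (vgeM wM)].
  have t0 : 2%:R * a - 1 != 0 by move: s0; rewrite expf_eq0.
  have wt : w (2%:R * a - 1) = 0 by move: ws; rewrite (valX wM) //; lia.
  have hd : vge w (n.+1)%:Z ((a ^+ 2 - a + nu) / (2%:R * a - 1)).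
    rewrite -[(n.+1)%:Z]addr0; apply: (vgeM wM) => //.
    by right; rewrite (valV wM) // wt oppr0.
  have hfa : f a - a = - ((a ^+ 2 - a + nu) / (2%:R * a - 1)) by rewrite /f /newton; ring.
  split; first by rewrite hfa; apply/(vgeN wM).
    by rewrite /f /newton; apply: (vgeB wM wD) => //; apply: vge_le hd; lia.
  have -> : f a ^+ 2 - f a + nu = ((a ^+ 2 - a + nu) / (2%:R * a - 1)) ^+ 2.
    by rewrite /f /newton; field.
  rewrite expr2; apply: (@vge_le _ _ _ ((n.+1)%:Z + (n.+1)%:Z)); first by lia.
  exact: (vgeM wM).
have inv n : vge w 0 (iter n f a0) /\ vge w (n.+1)%:Z ((iter n f a0) ^+ 2 - iter n f a0 + nu).
  by elim: n => [|n [IH1 IH2]] //; have [_ h2 h3] := step _ n IH1 IH2.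
by move=> n; have [i1 i2] := inv n; have [s1 _ _] := step _ n i1 i2.
Qed.

End SplitValuation.

(** * Schmidt's theorem *)

Section EvenDegrees.
Variables (F : fieldType) (K : {pred F}) (q g : nat).
Hypothesis HK : is_Fq_subfield K q.
Hypothesis Hfull : full_constant_field K.
Hypothesis HF : function_field K.
Hypothesis Hg : is_genus K g.
Hypothesis g_gt0 : (1 < g)%N.
Variables (x : F) (b : seq F).
Hypothesis Hb : Kx_basis K x b.
Hypothesis Hb2 : size b = 2.
Implicit Types (P : place K) (D E : divisor K).
Local Notation v := (@vP F K).
Local Notation d := (@pdeg F K).
Local Notation finLL := (finLL HK Hb Hfull Hg g_gt0).
Local Notation G := (@polar F K x).

(* a -> a - a^2 takes the same value at 0 and 1, so it misses some value. *)
Lemma ex_irreducible : exists2 nu : F, nu \in K & forall a : F, a ^+ 2 - a + nu != 0.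
Proof.
have [fK cK] := finK HK.
suff [nu nuK H] : exists2 nu, nu \in K & forall a, a \in K -> a ^+ 2 - a + nu != 0.
  exists nu => // a; apply/eqP => e; suff /H : a \in K by rewrite e eqxx.
  apply: Hfull; exists ('X^2 - 'X + nu%:P); split.
  - apply/(KpolyP HK)/(KpolyD HK); last exact: KpolyC HK _ nuK.
    by apply: (KpolyB HK); [apply: (Kpoly_exp HK) |]; apply: KpolyX HK.
  - rewrite -size_poly_gt0 -addrA size_polyDl size_polyXn // (leq_ltn_trans (size_polyD _ _)) //.
    by rewrite size_polyN size_polyX gtn_max size_polyC; case: (nu == 0).
  - by rewrite rootE !hornerE e.
apply: contrapT => no; have [f1 e1] := card_predC1 fK (memK1 HK).
have : (cardP (fun a => a \in K) <= cardP (fun a => a \in K /\ a <> 1%R))%N.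
  apply: (leq_card_image (f := fun a => a - a ^+ 2)) f1 => nu nuK.
  have [a aK e] : exists2 a, a \in K & a - a ^+ 2 = nu.
    apply: contrapT => no'; apply: no; exists nu => // a aK; apply/eqP => e; apply: no'.
    by exists a => //; apply/eqP; rewrite -subr_eq0 -oppr_eq0 -[X in _ == X]e; apply/eqP; ring.
  have [a1|a1] := eqVneq a 1; last by exists a => //; split=> //; apply/eqP.
  exists 0; first by split; [exact: memK0 HK | apply/eqP; rewrite eq_sym oner_neq0].
  by rewrite -e a1; ring.
by rewrite e1 ltnn.
Qed.

Variable nu : F.
Hypothesis nuK : nu \in K.
Hypothesis H : forall a : F, a ^+ 2 - a + nu != 0.

(** A zero discriminant would give the double root 1/2, or 1 = 0 in characteristic 2. *)
Lemma disc_neq0 : 1 - 4%:R * nu != 0.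
Proof.
apply/eqP => e; have [two0|two0] := eqVneq (2%:R : F) 0.
  have four : 4%:R = 2%:R * 2%:R :> F by ring.
  by move/eqP: e; rewrite four two0 !mul0r subr0 oner_eq0.
move/eqP: (H 2%:R^-1); apply; apply: (mulfI (mulf_neq0 two0 two0)); rewrite mulr0.
rewrite -[RHS]oppr0 -e; field; exact: two0.
Qed.

Lemma memK_nat n : n%:R \in K.
Proof. by elim: n => [|n IHn]; rewrite ?(memK0 HK) // -natr1 (memKD HK) ?(memK1 HK). Qed.

Lemma disc_val P : v P (1 - 4%:R * nu) = 0.
Proof.
by apply: plK disc_neq0; apply: (memKB HK); [exact: memK1 HK | apply: (memKM HK); rewrite ?memK_nat].
Qed.

(** Fermat's identity in K, viewed as a [locfin] with zero maximal ideal. *)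
Lemma frob_const : nu ^+ q = nu.
Proof.
have [_ [s [us [sK sq]]]] := HK.
have h1 (y z : F) : y = 0 -> z = 0 -> y - z = 0 by move=> -> ->; rewrite subr0.
have h2 (y z : F) : y = 0 -> z \in K -> y * z = 0 by move=> -> _; rewrite mul0r.
have h3 : ~ (1 : F) = 0 by move/eqP; rewrite oner_eq0.
have h4 (y : F) : y \in K -> ~ y = 0 -> y^-1 \in K by move=> yK _; apply: (memKV HK).
have h5 (y : F) : y \in s -> y \in K by move/sK.
have h6 (y z : F) : y \in s -> z \in s -> y - z = 0 -> y = z by move=> _ _ /eqP; rewrite subr_eq0 => /eqP.
have h7 (y : F) : y \in K -> exists2 z, z \in s & y - z = 0 by move=> /sK ys; exists y; rewrite ?subrr.
pose A := @LocFin F (fun y => y \in K) (fun y => y = 0) s (memK1 HK) (memKB HK) (memKM HK)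
  h1 h2 h3 erefl h4 h5 h6 h7.
have nuXK n : nu ^+ n \in K.
  by elim: n => [|n IHn]; rewrite ?expr0 ?(memK1 HK) // exprS; apply: (memKM HK).
have cA : #|{: resfield A}| = q by rewrite (card_seq_sub us).
have := expf_card (res A nu); rewrite cA -(@resX _ A) // => /(@res_eq _ A).
by move=> e; apply/eqP; rewrite -subr_eq0; apply/eqP/e => //; apply: nuXK.
Qed.

Hypothesis even_deg : forall P, ~~ odd (d P).

(** The residue field has q^(d P) elements, an even power of [q], so it contains the roots of a
    quadratic polynomial over K. *)
Lemma place_root P : exists a, vge (v P) 0 a /\ vge (v P) 1 (a ^+ 2 - a + nu).
Proof.
have [bs [sb [h1 [h2 h3]]]] := pdegP HK Hb P.
have fb : free_mod K (vge (v P) 1) bs by move=> c sc cK /in_mPE Wc; apply: h2.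
have [fc cc] := card_combos HK (subspace_vge P 1) fb.
have [s0 [us0 sP]] := fc; pose s : seq F := s0.
have us : uniq s by apply/NoDupP/(@NoDupP {classic F}).
have mem_s (y : F) : y \in s <-> combos K bs y.
  by split=> [/InP/(@InP {classic F})/sP//|/sP/(@InP {classic F}) ?]; apply/InP.
have ss : size s = (q ^ d P)%N by rewrite -sb -cc (cardPE us0 sP).
have wM := plM P; have wD := plD P.
have o1 : vge (v P) 0 1 by right; rewrite (val1 wM).
have g1 (y z : F) : vge (v P) 0 y -> vge (v P) 0 z -> vge (v P) 0 (y - z) := @vgeB _ _ wM wD _ y z.
have g2 (y z : F) : vge (v P) 0 y -> vge (v P) 0 z -> vge (v P) 0 (y * z).
  by move=> hy hz; rewrite -[0]addr0; apply: vgeM.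
have g3 (y z : F) : vge (v P) 1 y -> vge (v P) 1 z -> vge (v P) 1 (y - z) := @vgeB _ _ wM wD _ y z.
have g4 (y z : F) : vge (v P) 1 y -> vge (v P) 0 z -> vge (v P) 1 (y * z).
  by move=> hy hz; rewrite -[1]addr0; apply: vgeM.
have g5 : ~ vge (v P) 1 1 by case=> [/eqP|]; rewrite ?oner_eq0 // (val1 wM).
have g6 (y : F) : vge (v P) 0 y -> ~ vge (v P) 1 y -> vge (v P) 0 y^-1.
  move=> hy ny; have y0 : y != 0 by apply/eqP => y0; apply: ny; left.
  by right; rewrite (valV wM) // (val_eq y0 hy ny) oppr0.
have g7 (y : F) : y \in s -> vge (v P) 0 y.
  by case/mem_s=> c [sc cK ->]; apply: lc_mem (subspace_vge P 0) cK h1.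
have g8 (y z : F) : y \in s -> z \in s -> vge (v P) 1 (y - z) -> y = z.
  move=> /mem_s[c [sc cK ->]] /mem_s[c' [sc' cK' ->]] Wyz.
  by rewrite (free_mod_inj HK fb sc sc' cK cK' Wyz).
have g9 (y : F) : vge (v P) 0 y -> exists2 z, z \in s & vge (v P) 1 (y - z).
  case/h3=> c [sc [cK /in_mPE Wc]]; exists (lc c bs) => //.
  by apply/mem_s; exists c.
pose A := @LocFin F (vge (v P) 0) (vge (v P) 1) s o1 g1 g2 g3 g4 g5 (vge0 _ _) g6 g7 g8 g9.
have nuO : vge (v P) 0 nu := vgeK P nuK.
have cA : #|{: resfield A}| = (q ^ ((d P)./2 * 2))%N.
  by rewrite (card_seq_sub us) ss muln2 halfK (negPf (even_deg P)) subn0.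
have nuq : res A nu ^+ q = res A nu by rewrite -(@resX _ A) // frob_const.
have [a ea] := finField_quadratic_root cA nuq.
pose a0 := ssval a; have Oa : vge (v P) 0 a0 := @ring_val _ A a.
exists a0; split=> //.
have Oa2 : vge (v P) 0 (a0 ^+ 2) by rewrite expr2; apply: (g2 _ _).
have /(@res_eq _ A _ _ _ (@ring0 _ A)).1 : res A (a0 ^+ 2 - a0 + nu) = res A 0.
  rewrite (@resD _ A) //; last exact: (g1 _ _).
  by rewrite (@resD _ A) ?(@resN _ A) ?(@resX _ A) ?(@resK _ A) //; apply: (@ringN _ A).
rewrite subr0; apply.
by apply: (@ringD _ A) => //; apply: (g1 _ _).
Qed.

Lemma ex_roots : exists r : place K -> nat -> F, forall P, root_seq nu (v P) (r P).
Proof.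
have [a0 h] := boolp.choice place_root.
exists (fun P n => iter n (newton nu) (a0 P)) => P; have [h1 h2] := h P.
apply: hensel => //; [exact: plM | exact: plD | exact: disc_neq0 | exact: disc_val].
Qed.

Local Notation L := (quad H).
Variable r : place K -> nat -> F.
Hypothesis rP : forall P, root_seq nu (v P) (r P).

(** The two conjugate roots [r] and [1 - r] above a place of F provide its two sheets. *)
Definition split_root (i : place K * bool) (n : nat) : F :=
  if i.2 then 1 - r i.1 n else r i.1 n.
Definition split_val (i : place K * bool) (z : L) : int := wq (v i.1) (split_root i) z.
Definition split_deg (i : place K * bool) : nat := d i.1.
Local Notation v' := split_val.
Local Notation d' := split_deg.

Lemma split_rootP i : root_seq nu (v i.1) (split_root i).
Proof. by case: i => P [] /=; [apply: root_seqC (rP P); [exact: plM | exact: plD] | exact: rP]. Qed.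

Lemma splitM i (y z : L) : y != 0 -> z != 0 -> v' i (y * z) = v' i y + v' i z.
Proof. exact: (wqM (plM i.1) (plD i.1) (split_rootP i)). Qed.

Lemma splitD i (y z : L) : y != 0 -> z != 0 -> y + z != 0 -> Num.min (v' i y) (v' i z) <= v' i (y + z).
Proof. exact: (wqD (plM i.1) (plD i.1) (split_rootP i)). Qed.

Lemma split_residues i : exists s : seq L, (size s <= q ^ d' i)%N /\
  forall z, vge (v' i) 0 z -> exists2 y, y \in s & vge (v' i) 1 (z - y).
Proof.
have [s [ss sP]] := residues HK Hb i.1.
have [s' [ss' s'P]] := wq_residues H (plM i.1) (plD i.1) (split_rootP i) sP.
by exists s'; split=> //; apply: leq_trans ss' ss.
Qed.

Lemma split_unif i : exists2 t : L, t != 0 & v' i t = 1.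
Proof.
have [t t0 vt] := pl_unif i.1; exists (qin H t); last by rewrite /v' wq_in.
by apply: contra_neq t0 => -[].
Qed.

Lemma split_norm P z : z != 0 -> v' (P, false) z + v' (P, true) z = v P (qnorm z).
Proof. exact: (wq_norm (plM P) (plD P) (rP P)). Qed.

(** Integrality on both sheets at every place makes both coordinates elements of L(0), a finite
    set. *)
Lemma split_finL0 : finp (LL v' (fun=> 0)).
Proof.
have [f0 _] := card_L0 HK Hb Hfull Hg g_gt0; have [fX _] := finp_prod f0 f0.
apply: finp_sub fX => z /LL_vge Lz.
have h P : vge (v P) 0 z.1 /\ vge (v P) 0 z.2.
  apply: (wq_integral (plM P) (plD P) (rP P) disc_neq0 (disc_val P)).
    by have := Lz (P, false); rewrite oppr0.
  by have := Lz (P, true); rewrite oppr0.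
by split; apply/LL_vge => P; rewrite oppr0; case: (h P).
Qed.

Lemma split_LL D (y z : F) : LL v D y -> LL v D z -> LL v' (fun i => D i.1) (y, z).
Proof.
move=> /LL_vge hy /LL_vge hz; apply/LL_vge => i.
exact: (vge_wq (plM i.1) (plD i.1) (split_rootP i)).
Qed.

Definition on_sheet (c : bool) (D : divisor K) : place K * bool -> int :=
  fun i => if i.2 == c then D i.1 else 0.

Lemma hasdeg_on_sheet c D n : hasdeg d D n -> hasdeg d' (on_sheet c D) n.
Proof.
case/hasdegE=> s [us sD ->]; apply/hasdegE.
exists (map (fun P : {classic (place K)} => (P, c) : {classic (place K * bool)}) s); split.
- by rewrite map_inj_uniq // => P Q [].
- move=> [P e]; rewrite /on_sheet /=; have [->|] := eqVneq e c; last by rewrite eqxx.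
  by move/sD => Ps; apply/mapP; exists P.
- by rewrite big_map; apply: eq_bigr => P _; rewrite /on_sheet eqxx.
Qed.

Lemma hasdeg_sheets (D0 D1 : divisor K) m0 m1 : hasdeg d D0 m0 -> hasdeg d D1 m1 ->
  hasdeg d' (fun i => if i.2 then D1 i.1 else D0 i.1) (m0 + m1).
Proof.
move=> h0 h1; have := hasdegD (hasdeg_on_sheet false h0) (hasdeg_on_sheet true h1).
by apply: eq_hasdeg => -[P []]; rewrite /on_sheet /= ?addr0 ?add0r.
Qed.

Lemma hasdeg_split (D' : place K * bool -> int) n : hasdeg d' D' n ->
  exists m0 m1, [/\ hasdeg d (fun P => D' (P, false)) m0, hasdeg d (fun P => D' (P, true)) m1 & n = m0 + m1].
Proof.
move=> D'n; have /hasdegE[s [us sD _]] := D'n.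
have fin c : exists m, hasdeg d (fun P => D' (P, c)) m.
  apply: (@hasdeg_finsupp _ _ _ (map (fun i : {classic (place K * bool)} => i.1 : {classic (place K)}) s)).
  by move=> P /sD Ps; apply/mapP; exists (P, c).
have [m0 h0] := fin false; have [m1 h1] := fin true; exists m0, m1; split=> //.
apply: hasdeg_fun D'n _; apply: eq_hasdeg (hasdeg_sheets h0 h1).
by case=> P [].
Qed.

(** The valuations on the two sheets add up to that of the norm, so the degree is that of a
    principal divisor of F. Away from the poles of the coordinates and the support of the norm, both
    are nonnegative with sum 0, so the support is finite. *)
Lemma split_principal z : z != 0 -> hasdeg d' (v' ^~ z) 0.
Proof.
move=> z0; have N0 : qnorm z != 0 by rewrite qnorm_eq0.
have supp (a : F) : finp (fun P => ~ vge (v P) 0 a).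
  have [->|a0] := eqVneq a 0; first by exists [::]; split=> // P; split=> // -[]; left.
  by apply: finp_sub (finp_poles HK Hfull Hg g_gt0 Hb a0) => P h; rewrite ltNge; apply/negP => h'; apply: h; right.
have fsupp c : finp (fun P => v' (P, c) z != 0).
  apply: finp_sub (finp_or (finp_or (supp z.1) (supp z.2)) (finp_div HK Hfull Hg g_gt0 Hb N0)) => P nz.
  apply: contrapT => /not_orP[/not_orP[/contrapT h1 /contrapT h2] /negP/negPn/eqP hN].
  have ge e : 0 <= v' (P, e) z.
    by apply/(vgeE _ _ z0); apply: (vge_wq (plM P) (plD P) (split_rootP (P, e))).
  have := split_norm P z0; rewrite hN; have := ge false; have := ge true; move: nz; case: c; lia.
have [m0 h0] := hasdeg_supp (fsupp false); have [m1 h1] := hasdeg_supp (fsupp true).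
have := hasdegD h0 h1; have e : (fun P => v' (P, false) z + v' (P, true) z) = v ^~ (qnorm z).
  by apply: funext => P; apply: split_norm.
rewrite e => /hasdeg_fun /(_ (principalF HK Hfull Hg g_gt0 Hb N0)) <-.
by apply: eq_hasdeg (hasdeg_sheets h0 h1) => -[P []].
Qed.

Lemma finp_eff_le (n : nat) :
  finp (fun D : divisor K => exists2 k : nat, (k <= n)%N & eff D /\ hasdeg d D k%:Z).
Proof.
have fe := finp_eff HK Hfull HF Hg g_gt0 Hb.
elim: n => [|n IHn]; first by apply: finp_sub (fe 0%N) => D [k]; rewrite leqn0 => /eqP->.
apply: finp_sub (finp_or IHn (fe n.+1)) => D [k]; rewrite leq_eqVlt => /orP[/eqP->|lt] h.
  by right.
by left; exists k.
Qed.

Lemma split_fin_eff (n : nat) :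
  finp (fun D' : place K * bool -> int => eff D' /\ hasdeg d' D' n%:Z).
Proof.
have [fX _] := finp_prod (finp_eff_le n) (finp_eff_le n).
pose f (D' : place K * bool -> int) : divisor K * divisor K :=
  (fun P => D' (P, false), fun P => D' (P, true)).
apply: (@finp_inj _ _ _ _ f _ _ fX) => [D' [e0 /hasdeg_split[m0 [m1 [h0 h1 e]]]]|D' E' _ _ fDE].
  have e00 : eff (f D').1 by move=> P; apply: e0.
  have e01 : eff (f D').2 by move=> P; apply: e0.
  have n0 := hasdeg_ge0 e00 h0; have n1 := hasdeg_ge0 e01 h1.
  by split; [exists `|m0|%N | exists `|m1|%N]; rewrite ?gez0_abs //; lia.
apply: funext => -[P []].
  by have := congr1 (fun z => z.2 P) fDE.
by have := congr1 (fun z => z.1 P) fDE.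
Qed.

(** The divisor is enlarged to one equal to [D] on both sheets, where pairs from L(D) embed and
    Riemann's inequality for F applies twice. Going back down to [D'] costs at most the difference
    of the degrees. *)
Lemma split_riemann (D' : place K * bool -> int) (n : nat) : hasdeg d' D' (n + 2 * g.-1)%N%:Z -> (q ^ n <= cardP (LL v' D'))%N.
Proof.
move=> D'n; have [m0 [m1 [h0 h1 _]]] := hasdeg_split D'n.
pose D : divisor K := fun P => Num.max (D' (P, false)) (D' (P, true)).
have [m Dm] : exists m, hasdeg d D m.
  have [s [us hs ht _ _]] := hasdeg_common h0 h1.
  apply: (@hasdeg_finsupp _ _ _ s) => P; have [e|/hs //] := eqVneq (D' (P, false)) 0.
  by have [e'|/ht //] := eqVneq (D' (P, true)) 0; rewrite /D e e' eqxx.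
have Em := hasdeg_sheets Dm Dm; have Ediff := hasdegB Em D'n.
have DE i : D' i <= (fun i : place K * bool => if i.2 then D i.1 else D i.1) i.
  by case: i => P []; rewrite /D /= le_max lexx ?orbT.
have m_ge := hasdeg_le DE D'n Em.
have fin' := finp_LL splitM splitD split_residues split_unif split_finL0.
have eE : m + m - (n + 2 * g.-1)%N%:Z = (absz (m + m - (n + 2 * g.-1)%N%:Z)%R)%:Z.
  by rewrite gez0_abs // subr_ge0.
rewrite eE in Ediff.
have [fE leE] := card_LL_leq splitM splitD split_residues split_unif DE Ediff (fin' _ _ D'n).
have [k mE] : exists k : nat, m = (k + g.-1)%N%:Z by exists (absz (m - g.-1%:Z)%R); lia.
have Lk : (q ^ k <= cardP (LL v D))%N.
  by apply: (riemannF HK Hb Hfull Hg g_gt0); rewrite -mE.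
have [fX cX] := finp_prod (finLL Dm) (finLL Dm).
have le2 : (q ^ (k + k) <= cardP (LL v' (fun i : place K * bool => if i.2 then D i.1 else D i.1)))%N.
  rewrite expnD; apply: leq_trans (leq_mul Lk Lk) _; rewrite -cX.
  apply: (leq_card_in (f := fun z : F * F => z : L)) fX fE => // z [z1 z2].
  have := split_LL z1 z2; rewrite -surjective_pairing.
  by congr LL; apply: funext => i; case: (i.2).
have := leq_trans le2 leE.
have -> : (absz (m + m - (n + 2 * g.-1)%N%:Z)%R) = (k + k - n)%N by rewrite mE; lia.
have nk : (n <= k + k)%N by move: m_ge; rewrite mE; lia.
by rewrite -{1}(subnK nk) expnD leq_pmul2l // expn_gt0 (q_gt0 HK).
Qed.

(** The class of k G alone suffices: it has (q^l - 1)/(q - 1) >= q^(l-1) effective divisors, with l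
    >= 2 k - g + 1. *)
Lemma Am_lower (k : nat) : (g <= k)%N -> (q ^ (2 * k - g) <= Am d (2 * k))%N.
Proof.
move=> gk; have deg2 := deg_polar_x HK Hfull HF Hg g_gt0 Hb Hb2.
have Dk : hasdeg d (fun P => k%:Z * G P) (2 * k)%N%:Z.
  by rewrite (_ : (2 * k)%N%:Z = k%:Z * 2) //; [apply: hasdegZ | lia].
have Dk' : hasdeg d (fun P => k%:Z * G P) ((2 * k - g).+1 + g.-1)%N%:Z.
  by rewrite (_ : ((2 * k - g).+1 + g.-1 = 2 * k)%N) //; lia.
have cL := riemannF HK Hb Hfull Hg g_gt0 Dk'.
have [f0 c0] := card_L0 HK Hb Hfull Hg g_gt0.
have pr := principalF HK Hfull Hg g_gt0 Hb.
have [fC] := class_card (@plM F K) (@plD F K) (residues HK Hb) (@pl_unif F K) f0 (pdeg_gt0 HK Hb) pr Dk.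
rewrite c0 => eC.
have leC : (cardP (fun E => eff E /\ equiv v E (fun P => (k%:Z * G P)%R)) <= Am d (2 * k))%N.
  apply: leq_card => [E [E0 ED]|]; last exact: (finp_eff HK Hfull HF Hg g_gt0 Hb).
  by split=> //; apply: hasdeg_equiv ED Dk.
apply: leq_trans leC; move: eC cL; rewrite expnS; have := q_gt1 HK.
have : (0 < q ^ (2 * k - g))%N by rewrite expn_gt0 (q_gt0 HK).
move: (cardP _) (cardP _) (q ^ _)%N => c l Q; clear; move: q => n; nia.
Qed.

Lemma even_deg_absurd : False.
Proof.
have [P0 _] := ex_place Hg g_gt0.
have [B HB] := Am_bound splitM splitD split_residues split_unif split_finL0
  (fun i => pdeg_gt0 HK Hb i.1) split_principal split_fin_eff (q_gt1 HK) split_riemann (P0, false).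
(* Splitting n as 2 (g + i) + 2 (g + m - i) with 0 <= i <= m gives m + 1 disjoint families, each of
   at least q^(2 (g + m)) divisors. The value of [m] makes (m + 1) q^(2 (g + m)) exceed B q^n. *)
pose m := (B * q ^ (2 * g))%N; pose n := (2 * (2 * g + m))%N.
have := HB n; apply/negP; rewrite -ltnNge.
pose dg (D' : place K * bool -> int) : nat := absz (ddeg (fun P => D' (P, false))).
pose s := [seq (2 * (g + i))%N | i <- iota 0 m.+1].
pose Y (D' : place K * bool -> int) := (eff D' /\ hasdeg d' D' n%:Z) /\ dg D' \in s.
have fY : finp Y by apply: finp_sub (split_fin_eff n) => D' [].
apply: leq_trans (_ : (cardP Y <= _)%N); last by apply: leq_card (split_fin_eff n) => D' [].
have us : uniq (s : seq {classic nat}).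
  apply/(@NoDupP {classic nat})/(@NoDupP nat); rewrite map_inj_uniq ?iota_uniq //.
  by move=> i j; lia.
rewrite (@card_fibers _ nat Y dg s fY us); last first.
  by move=> D' [_ /(@InP nat) h]; apply/(@InP {classic nat}).
apply: (@leq_trans (\sum_(y <- (s : seq {classic nat})) q ^ (2 * (g + m)))%N).
  rewrite big_const_seq count_predT iter_addn_0 size_map size_iota.
  have -> : (q ^ n = q ^ (2 * (g + m)) * q ^ (2 * g))%N by rewrite -expnD; congr (_ ^ _)%N; rewrite /n; lia.
  by rewrite mulnCA ltn_pmul2l ?expn_gt0 ?(q_gt0 HK).
rewrite big_seq [X in (_ <= X)%N]big_seq; apply: leq_sum => y /(@InP {classic nat})/(@InP nat) ys.
have /mapP[i] := ys; rewrite mem_iota add0n ltnS => /andP[_ im] yE.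
have fe := finp_eff HK Hfull HF Hg g_gt0 Hb.
have [fX cX] := finp_prod (fe (2 * (g + i))%N) (fe (2 * (g + (m - i)))%N).
have -> : (q ^ (2 * (g + m)) = q ^ (2 * (g + i) - g) * q ^ (2 * (g + (m - i)) - g))%N.
  by rewrite -expnD; congr (_ ^ _)%N; lia.
apply: leq_trans (leq_mul (Am_lower (leq_addr _ _)) (Am_lower (leq_addr _ _))) _.
rewrite /Am -cX.
pose f (z : divisor K * divisor K) : place K * bool -> int := fun i => if i.2 then z.2 i.1 else z.1 i.1.
apply: (leq_card_in (f := f)) fX _.
- move=> [D0 D1] /= [[e0 h0] [e1 h1]]; have dgE : dg (f (D0, D1)) = y.
    by rewrite /dg (ddegE (n := (2 * (g + i))%N%:Z)) // yE.
  split=> //; split; last by rewrite dgE.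
  split; first by case=> P []; [apply: e1 | apply: e0].
  rewrite (_ : n%:Z = (2 * (g + i))%N%:Z + (2 * (g + (m - i)))%N%:Z); first exact: hasdeg_sheets.
  by rewrite /n; lia.
- move=> [D0 D1] [E0 E1] _ _ e; congr (_, _); apply: funext => P.
    by have := congr1 (fun h => h (P, false)) e.
  by have := congr1 (fun h => h (P, true)) e.
by apply: finp_sub fY => D' [].
Qed.

End EvenDegrees.

(** * Counting classes *)

Section ClassCount.
Variables (F : fieldType) (K : {pred F}) (q g : nat).
Hypothesis HK : is_Fq_subfield K q.
Hypothesis Hfull : full_constant_field K.
Hypothesis HF : function_field K.
Hypothesis Hg : is_genus K g.
Hypothesis g_gt0 : (1 < g)%N.
Variables (x : F) (b : seq F).
Hypothesis Hb : Kx_basis K x b.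
Hypothesis Hb2 : size b = 2.
Implicit Types (P : place K) (D E : divisor K).
Local Notation v := (@vP F K).
Local Notation d := (@pdeg F K).
Local Notation finLL := (finLL HK Hb Hfull Hg g_gt0).
Local Notation G := (@polar F K x).
Local Notation A := (A_eff K).

Lemma ex_odd_place : exists P, odd (d P).
Proof.
apply: contrapT => no; have even P : ~~ odd (d P) by apply/negP => h; apply: no; exists P.
have [nu nuK H] := ex_irreducible HK Hfull.
have [r rP] := ex_roots HK Hb nuK H even.
exact: (even_deg_absurd HK Hfull HF Hg g_gt0 Hb Hb2 nuK H rP).
Qed.

Let deg2 : hasdeg d G 2 := deg_polar_x HK Hfull HF Hg g_gt0 Hb Hb2.

(** Subtracting a multiple of [G], of degree 2, from a place of odd degree leaves a divisor of
    degree 1. *)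
Lemma ex_divisor (n : int) : exists D : divisor K, hasdeg d D n.
Proof.
have [P oP] := ex_odd_place; have h := hasdegB (hasdeg_point d P) (hasdegZ (d P)./2%:Z deg2).
exists (fun Q => n * (point P Q - (d P)./2%:Z * G Q)).
have e : n = n * ((d P)%:Z - (d P)./2%:Z * 2).
  by rewrite -{1}(odd_double_half (d P)) oP; lia.
by rewrite [X in hasdeg _ _ X]e; apply: hasdegZ h.
Qed.

Let prin := principalF HK Hfull Hg g_gt0 Hb.
Let f0 := (card_L0 HK Hb Hfull Hg g_gt0).1.
Let vM := @plM F K.
Let vD := @plD F K.
Let effn := finp_eff HK Hfull HF Hg g_gt0 Hb.

(** A_(n-2), with the value 0 for n < 2, where the degree is negative and no effective divisor
    exists. *)
Definition A2 (n : nat) : nat := if n is m.+2 then A m else 0.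

Lemma count_special (n : nat) (T : seq {classic (divisor K)}) : (n <= g)%N -> uniq T ->
  (forall D : {classic (divisor K)}, D \in T -> hasdeg d D n%:Z) ->
  (forall D E : {classic (divisor K)}, D \in T -> E \in T -> equiv v D E -> D = E) ->
  (forall D : divisor K, eff D -> hasdeg d D n%:Z ->
    exists2 E : {classic (divisor K)}, E \in T & equiv v D E) ->
  (count (fun D : {classic (divisor K)} => 1 < cardP (LL v D)) T + q * A2 n = A n)%N.
Proof.
move=> ng uT Tn Tinj Tcov; have q1 := q_gt1 HK.
have c0 := (card_L0 HK Hb Hfull Hg g_gt0).2.
have amc := Am_classes vM vD (residues HK Hb) (@pl_unif F K) f0 (pdeg_gt0 HK Hb) prin effn.
have h1 := amc _ _ uT Tn Tinj Tcov; rewrite c0 in h1.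
pose sub D : divisor K := fun P => D P - G P.
(* The shifted divisors D - G represent the classes of degree n - 2; for n < 2 their degree is
   negative and every term is 0. *)
have h2 : (A2 n * q.-1 = \sum_(D <- T) (cardP (LL v (sub D))).-1)%N.
  have deg_sub D : hasdeg d D n%:Z -> hasdeg d (sub D) (n%:Z - 2) by move=> Dn; apply: hasdegB Dn deg2.
  case: n {h1} ng Tn Tcov deg_sub => [|[|n]] ng Tn Tcov deg_sub.
  - rewrite mul0n big1_seq // => D /andP[_ /Tn /deg_sub Dn].
    by rewrite (card_LL_neg vM vD (residues HK Hb) (@pl_unif F K) f0 prin Dn).
  - rewrite mul0n big1_seq // => D /andP[_ /Tn /deg_sub Dn].
    by rewrite (card_LL_neg vM vD (residues HK Hb) (@pl_unif F K) f0 prin Dn).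
  have subK (D : divisor K) : (fun P => D P + G P - G P) = D by apply: funext => P; rewrite addrK.
  have addK (D : divisor K) : (fun P => sub D P + G P) = D by apply: funext => P; rewrite /sub subrK.
  transitivity (Am d n * (cardP (LL v (fun=> 0%R))).-1)%N; first by rewrite c0.
  rewrite (amc n (map (sub : {classic (divisor K)} -> {classic (divisor K)}) T)).
  - by rewrite big_map.
  - rewrite map_inj_uniq // => D E e.
    by rewrite -(addK D) e addK.
  - move=> _ /mapP[D /Tn/deg_sub DT ->]; rewrite (_ : n%:Z = n.+2%:Z - 2) //; lia.
  - move=> _ _ /mapP[D DT ->] /mapP[E ET ->] /(equivD G); rewrite !addK => DE.
    by rewrite (Tinj D E DT ET DE).
  - move=> D D0 Dn; have [||E ET DE] := Tcov (fun P => D P + G P).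
    + by move=> P; apply: addr_ge0 => //; apply: polar_ge0.
    + by rewrite (_ : n.+2%:Z = n%:Z + 2); [apply: hasdegD | lia].
    exists (sub E : {classic (divisor K)}); first exact: map_f.
    by have := equivB G DE; rewrite subK.
(* Termwise, |L(D)| = q |L(D - G)| gives |L(D)| - 1 = q (|L(D - G)| - 1) + (q - 1) when the
   dimension is positive, after passing to an effective divisor of the class. Otherwise all terms
   are 0. *)
have h3 : (\sum_(D <- T) (cardP (LL v D)).-1 =
    \sum_(D <- T) (q * (cardP (LL v (sub D))).-1 + (1 < cardP (LL v D)) * q.-1))%N.
  rewrite big_seq [RHS]big_seq; apply: eq_bigr => D DT.
  have Dn := Tn D DT; have Sn : hasdeg d (sub D) (n%:Z - 2) by apply: hasdegB Dn deg2.
  have s0 := card_LL_gt0 vM vD (residues HK Hb) (@pl_unif F K) f0 Sn.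
  have [gt|le] := ltnP 1 (cardP (LL v D)).
    have [E E0 ED] := LL_ex_eff (finLL Dn) gt.
    have En := hasdeg_equiv prin ED Dn.
    have [_ cE] := card_LL_equiv vM ED (finLL Dn).
    have [_ cS] := card_LL_equiv vM (equivB G ED) (finLL Sn).
    have := card_LL_subG HK Hfull HF Hg g_gt0 Hb Hb2 E0 En ng.
    by rewrite cE cS -/(sub D) => ->; move: s0 q1; case: (cardP _) => // l _; case: (q) => // m _; nia.
  have le' : (cardP (LL v (sub D)) <= 1)%N.
    apply: leq_trans le; apply: leq_card (finLL Dn) => z; apply: LL_le => P.
    by rewrite /sub lerBlDr lerDl polar_ge0.
  have -> : cardP (LL v (sub D)) = 1%N by apply/eqP; rewrite eqn_leq le' s0.
  by rewrite muln0 mul0n; case: (cardP _) le => [|[]].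
rewrite h3 big_split /= -big_distrr -big_distrl /= in h1.
have e : (\sum_(D <- T) (1 < cardP (LL v D)) = count (fun D : {classic (divisor K)} => 1 < cardP (LL v D)) T)%N.
  by rewrite -sum1_count [RHS]big_mkcond; apply: eq_bigr => D _; case: ifP.
rewrite e in h1; have q10 : (0 < q.-1)%N by rewrite -subn1 subn_gt0.
apply/eqP; rewrite -(eqn_pmul2r q10) -[A n]/(Am d n) h1 -h2.
by rewrite mulnDl addnC mulnA.
Qed.

Lemma class_reps_size n (s t : seq (divisor K)) : class_reps n s -> class_reps n t ->
  (size s <= size t)%N.
Proof.
move=> [s1 [s2 s3]] [t1 [t2 t3]].
have h i : exists j, (i < size s)%N -> (j < size t)%N /\
    lin_equiv (nth (fun=> 0) s i) (nth (fun=> 0) t j).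
  have [lti|//] := ltnP i (size s); last by exists 0%N.
  by have [d1 d2] := s1 i lti; have [j ltj ij] := t3 _ d1 d2; exists j.
have [f fP] := boolp.choice h.
have ci m : size (iota 0 m) = cardP (fun i => i \in iota 0 m) by rewrite card_seq ?iota_uniq.
rewrite -(size_iota 0 (size s)) -(size_iota 0 (size t)) !ci.
apply: (leq_card_in (f := f)); [| |exact: finp_seq|exact: finp_seq].
  by move=> i; rewrite !mem_iota !add0n /= => lti; case: (fP i lti).
move=> i j; rewrite !mem_iota !add0n /= => lti ltj e; apply: s2 => //.
have [_ h1] := fP i lti; have [_ h2] := fP j ltj; rewrite -e in h2.
exact: (equiv_trans vM h1 (equiv_sym vM h2)).
Qed.

(** Shifting by a divisor of degree g - n carries representatives of all classes of degree g to
    representatives of all classes of degree n, whatever their dimension; removing those counted by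
    B_n leaves dimension zero. *)
Lemma h0_count (n : nat) : (n <= g)%N ->
  ((h0 K n)%:Z = ((A g)%:Z - (q * A2 g)%N%:Z) - ((A n)%:Z - (q * A2 n)%N%:Z)).
Proof.
move=> ng; have [R [uR Rg Rinj Rcov]] := ex_class_reps vM effn g.
have q1 := q_gt1 HK; have [B Bd] := ex_divisor (g%:Z - n%:Z).
(* Degree g exceeds g - 1, so the dimension is positive and the effective representatives [R] reach
   every class of degree g. *)
have exeff D : hasdeg d D g%:Z -> exists2 E : divisor K, eff E & equiv v E D.
  move=> Dg; apply: (ex_eff vM vD (residues HK Hb) (@pl_unif F K) f0 q1 (riemannF HK Hb Hfull Hg g_gt0) Dg).
  by rewrite prednK // ltnW.
have eg : size R = count (fun D : {classic (divisor K)} => 1 < cardP (LL v D))%N R.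
  symmetry; apply/eqP; rewrite -all_count; apply/allP => D /Rg[D0 Dg].
  have f := finLL Dg; have [f1 ->] := card_predC1 f (LL0 v D).
  apply: (card_gt0 (x := 1)) => //; split; first exact: (LL1 vM).
  by apply/eqP; rewrite oner_neq0.
have cg := count_special (leqnn g) uR (fun D DR => (Rg D DR).2) Rinj (fun D h1 h2 => Rcov D (conj h1 h2)).
rewrite -eg in cg.
pose sub D : divisor K := fun P => D P - B P.
have addK (D : divisor K) : (fun P => sub D P + B P) = D by apply: funext => P; rewrite /sub subrK.
have subK (D : divisor K) : (fun P => D P + B P - B P) = D by apply: funext => P; rewrite addrK.
pose T : seq {classic (divisor K)} := map (sub : {classic (divisor K)} -> {classic (divisor K)}) R.
have uT : uniq T by rewrite map_inj_uniq // => D E e; rewrite -(addK D) e addK.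
have Tn (D : {classic (divisor K)}) : D \in T -> hasdeg d D n%:Z.
  case/mapP=> E /Rg[_ Eg] ->; rewrite (_ : n%:Z = g%:Z - (g%:Z - n%:Z)); last by ring.
  exact: hasdegB Eg Bd.
have Tinj (D E : {classic (divisor K)}) : D \in T -> E \in T -> equiv v D E -> D = E.
  move=> /mapP[D' DR ->] /mapP[E' ER ->] /(equivD B); rewrite !addK => DE.
  by rewrite (Rinj D' E' DR ER DE).
have Tcov D : hasdeg d D n%:Z -> exists2 E : {classic (divisor K)}, E \in T & equiv v D E.
  move=> Dn; have DBg : hasdeg d (fun P => D P + B P) g%:Z.
    by rewrite (_ : g%:Z = n%:Z + (g%:Z - n%:Z)); [apply: hasdegD | ring].
  have [E E0 ED] := exeff _ DBg; have Eg := hasdeg_equiv prin ED DBg.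
  have [E' E'R EE'] := Rcov E (conj E0 Eg).
  exists (sub E' : {classic (divisor K)}); first exact: map_f.
  by have := equivB B (equiv_trans vM (equiv_sym vM ED) EE'); rewrite subK.
have cn := count_special ng uT Tn Tinj (fun D _ h => Tcov D h).
pose T0 : seq {classic (divisor K)} := [seq D <- T | ~~ (1 < cardP (LL v D))%N].
have dim0 (D : divisor K) m : hasdeg d D m -> ddim D = 0%N <-> ~~ (1 < cardP (LL v D))%N.
  move=> Dm; rewrite (ddim_card HK (finLL Dm)); split=> [->//|].
  by rewrite -leqNgt -(expn0 q) leq_exp2l // leqn0 => /eqP.
have memT0 (D : {classic (divisor K)}) : D \in T0 <-> D \in T /\ ddim D = 0%N.
  rewrite mem_filter; split=> [/andP[h DT]|[DT h]].
    by split=> //; apply/(dim0 D _ (Tn D DT)).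
  by rewrite DT andbT; apply/(dim0 D _ (Tn D DT)).
have nthT0 i : (i < size T0)%N -> (nth (fun=> 0) (T0 : seq (divisor K)) i : {classic (divisor K)}) \in T0.
  exact: (@mem_nth {classic (divisor K)}).
have T0reps : class_reps n (T0 : seq (divisor K)).
  split; first by move=> i /nthT0/memT0[/Tn h1 h2].
  split=> [i j lti ltj ij|D Dn D0].
    apply/eqP; rewrite -(@nth_uniq {classic (divisor K)} (fun=> 0) T0) ?filter_uniq //; apply/eqP.
    have /memT0[h1 _] := nthT0 i lti; have /memT0[h2 _] := nthT0 j ltj.
    exact: Tinj h1 h2 ij.
  have [E ET DE] := Tcov D Dn.
  have E0 : ddim E = 0%N.
    apply/(dim0 E _ (Tn E ET)); have [_ <-] := card_LL_equiv vM DE (finLL (Tn E ET)).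
    exact/(dim0 D _ Dn).
  have ET0 : E \in T0 by apply/memT0.
  exists (index E T0); first by rewrite index_mem.
  by rewrite (@nth_index {classic (divisor K)}).
have -> : h0 K n = size T0.
  apply: theP; first by exists (T0 : seq (divisor K)).
  move=> m [s [<- sr]]; apply/eqP; rewrite eqn_leq.
  by rewrite (class_reps_size sr T0reps) (class_reps_size T0reps sr).
have sT0 : (size T0 + count (fun D : {classic (divisor K)} => 1 < cardP (LL v D)) T = size R)%N.
  by rewrite size_filter addnC count_predC size_map.
by move: sT0 cg cn; move: (count _ T) (size T0) (size R) (A g) (A n) => a1 a2 a3 a4 a5; lia.
Qed.

End ClassCount.

(** * Partial sums of the coefficients of L(t) in terms of the numbers A_n *)

Section LPolynomial.
Variables (F : fieldType) (K : {pred F}) (q : nat).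
Local Notation a := (Lcoef K q).
Local Notation A := (A_eff K).
Let A1 n : nat := if n is m.+1 then A m else 0.

(** Partial sums are the coefficients of L(t)/(1 - t) = (1 - q t) Z(t). *)
Lemma sum_Lcoef n : \sum_(0 <= i < n.+1) a i = (A n)%:Z - (q * A1 n)%N%:Z.
Proof.
elim: n => [|n IHn]; first by rewrite big_nat1 /Lcoef /A1; lia.
rewrite big_nat_recr //= IHn /Lcoef /A1; case: n {IHn} => [|n]; nia.
Qed.

(** These are the coefficients of q t L(t)/(1 - q t) = q t (1 - t) Z(t). *)
Lemma wsum_Lcoef n :
  \sum_(0 <= i < n) (q ^ (n - i))%N%:Z * a i = (q * A1 n)%N%:Z - (q * A2 K n)%N%:Z.
Proof.
elim: n => [|n IHn]; first by rewrite big_geq // /A1 /A2; lia.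
rewrite big_nat_recr //= (@eq_big_nat _ _ _ _ _ _ (fun i => q%:Z * ((q ^ (n - i))%N%:Z * a i))); last first.
  by move=> i /andP[_ lti]; rewrite subSn 1?ltnW // expnS PoszM mulrA.
rewrite -mulr_sumr IHn subSn // subnn expn1 /Lcoef /A1 /A2.
case: n {IHn} => [|[|n]]; nia.
Qed.

(** In the last sum, the factor q^k extends the middle sum to all i < g, and the -1 subtracts the
    weighted part of B_(g-k). The plain sums supply the remaining parts of B_g and B_(g-k). *)
Lemma Lcoef_formula g k : (k <= g)%N ->
    \sum_(g - k + 1 <= i < g + 1) a i
  + \sum_(g - k <= i < g) (q ^ (g - i))%N%:Z * a i
  + ((q ^ k)%N%:Z - 1) * \sum_(0 <= i < g - k) (q ^ (g - i - k))%N%:Z * a i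
  = ((A g)%:Z - (q * A2 K g)%N%:Z) - ((A (g - k))%:Z - (q * A2 K (g - k))%N%:Z).
Proof.
move=> kg; set n := (g - k)%N; have ng : (n <= g)%N by apply: leq_subr.
rewrite !addn1.
have e1 : \sum_(n.+1 <= i < g.+1) a i = \sum_(0 <= i < g.+1) a i - \sum_(0 <= i < n.+1) a i.
  by rewrite (@big_cat_nat _ _ _ n.+1 0 g.+1) //= [RHS]addrC addKr.
have e2 : \sum_(n <= i < g) (q ^ (g - i))%N%:Z * a i =
    \sum_(0 <= i < g) (q ^ (g - i))%N%:Z * a i - \sum_(0 <= i < n) (q ^ (g - i))%N%:Z * a i.
  by rewrite [X in _ = X - _](@big_cat_nat _ _ _ n 0 g) //= [RHS]addrC addKr.
have e3 : \sum_(0 <= i < n) (q ^ (g - i))%N%:Z * a i =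
    (q ^ k)%N%:Z * \sum_(0 <= i < n) (q ^ (n - i))%N%:Z * a i.
  rewrite mulr_sumr; apply: eq_big_nat => i /andP[_ lti].
  rewrite mulrA -PoszM -expnD; congr (_%:Z * _); congr (_ ^ _)%N.
  by rewrite addnBA ?(ltnW lti) // /n subnKC.
have e4 : \sum_(0 <= i < n) (q ^ (g - i - k))%N%:Z * a i = \sum_(0 <= i < n) (q ^ (n - i))%N%:Z * a i.
  by apply: eq_bigr => i _; rewrite /n subnAC.
rewrite e1 e2 e3 e4 !sum_Lcoef !wsum_Lcoef; ring.
Qed.

End LPolynomial.

Theorem theorem3p9 (F : fieldType) (K : {pred F}) (q g : nat)
  (HK : is_Fq_subfield K q) (Hfull : full_constant_field K)
  (HF : function_field K) (Hg : is_genus K g) (Hhyp : hyperelliptic K g)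
  (Hg2 : (2 < g)%N) :
  forall k : nat, (1 <= k <= g)%N ->
    (h0 K (g - k))%:Z =
      \sum_(g - k + 1 <= i < g + 1) Lcoef K q i
    + \sum_(g - k <= i < g) (q ^ (g - i))%N%:Z * Lcoef K q i
    + ((q ^ k)%N%:Z - 1) * \sum_(0 <= i < g - k) (q ^ (g - i - k))%N%:Z * Lcoef K q i.
Proof.
move=> k /andP[_ kg]; have [g2 [x [b [sb Hb]]]] := Hhyp.
by rewrite Lcoef_formula // (h0_count HK Hfull HF Hg g2 Hb sb) // leq_subr.
Qed.
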